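(* Let $\Omega$ be a bounded pseudoconvex complete Reinhardt domain in $\mathbb{C}^2$ and let $\phi\in C(\overline{\Omega})$ be such that the Hankel operator $H_{\phi}$ is compact on the Bergman space $A^2(\Omega)$. Then $\phi\circ f$ is holomorphic on $\mathbb{D}$ for any holomorphic $f:\mathbb{D}\to b\Omega$.
   Context: A domain $\Omega\subset\mathbb{C}^n$ is called complete Reinhardt if $(z_1,\ldots,z_n)\in\Omega$ and $\xi_1,\ldots,\xi_n\in\mathbb{C}$ with $|\xi_j|\leq 1$ for all $j$ imply $(\xi_1z_1,\ldots,\xi_nz_n)\in\Omega$. $\mathbb{D}$ is the open unit disc in $\mathbb{C}$, $b\Omega$ is the topological boundary of $\Omega$, and $C(\overline{\Omega})$ is the space of complex-valued continuous functions on the closure $\overline{\Omega}$. A holomorphic $f:\mathbb{D}\to b\Omega$ means a holomorphic map $f:\mathbb{D}\to\mathbb{C}^2$ with $f(\mathbb{D})\subset b\Omega$ (possibly constant). $L^2(\Omega)$ is the space of square integrable functions with respect to Lebesgue measure, and $A^2(\Omega)$ (the Bergman space) is the closed subspace of square integrable holomorphic functions. $P:L^2(\Omega)\to A^2(\Omega)$ is the orthogonal projection (Bergman projection). For $\phi\in L^{\infty}(\Omega)$ the Hankel operator $H_{\phi}:A^2(\Omega)\to L^2(\Omega)$ is defined by $H_{\phi}g=(I-P)(\phi g)$, where $I$ is the identity operator. *)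

(* Defs.v *)
From HB Require Import structures.
From mathcomp Require Import all_boot all_order all_algebra.
From mathcomp Require Import complex.
From mathcomp Require Import all_classical all_reals all_analysis.

Set Implicit Arguments.
Unset Strict Implicit.
Unset Printing Implicit Defensive.

Import Order.TTheory GRing.Theory Num.Theory.
Import numFieldNormedType.Exports.

Local Open Scope classical_set_scope.
Local Open Scope ring_scope.
Local Open Scope complex_scope.

(* R[i] packed as a numClosedFieldType: the topology, norm and normed module
   structures of the library are attached to numeric fields, and are not found
   from R[i] itself. *)
Definition Cplx (R : realType) : numClosedFieldType := R[i].

(* The product normed module carries the sup norm; only its topology and its
   bounded sets matter here. *)
Notation C2 R := (Cplx R * Cplx R)%type.

(* [differentiable] is over the scalar field of V and W, i.e. it is Frechet
   differentiability with a C-linear differential. Meant for U open. *)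
Definition holomorphic_on (R : realType) (V W : normedModType (Cplx R))
  (U : set V) (f : V -> W) : Prop := forall z, U z -> differentiable f z.

Definition unit_disc (R : realType) : set (Cplx R) := [set z | `|z| < 1].

Definition boundary (T : topologicalType) (A : set T) : set T :=
  closure A `\` A°.

Definition domain (R : realType) (Omega : set (C2 R)) : Prop :=
  [/\ open Omega, connected Omega & Omega !=set0].

Definition complete_Reinhardt (R : realType) (Omega : set (C2 R)) : Prop :=
  forall z xi : C2 R, Omega z -> `|xi.1| <= 1 -> `|xi.2| <= 1 ->
    Omega (xi.1 * z.1, xi.2 * z.2).

Definition cis (R : realType) (t : R) : Cplx R := cos t +i* sin t.

(* Plurisubharmonicity of a real-valued continuous function: the sub-mean value
   inequality on every closed affine disc {z + t w : |t| <= 1} inside Omega. *)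
Definition continuous_psh (R : realType) (Omega : set (C2 R)) (u : C2 R -> R)
    : Prop :=
  {within Omega, continuous u} /\
  forall z w : C2 R, (forall t : Cplx R, `|t| <= 1 -> Omega (z + t *: w)) ->
    u z <= (2 * pi)^-1 *
           \int[lebesgue_measure]_(t in `[0, 2 * pi]) u (z + cis t *: w).

(* Existence of a continuous plurisubharmonic exhaustion function; the closure
   is taken in C^2, so each sublevel set is relatively compact in Omega. *)
Definition pseudoconvex (R : realType) (Omega : set (C2 R)) : Prop :=
  exists u : C2 R -> R, continuous_psh Omega u /\
    forall c : R, let S := [set z | Omega z /\ u z < c] in
      compact (closure S) /\ closure S `<=` Omega.

(* The sigma-finiteness of product measures is not inferred canonically from the
   library. *)
Lemma product_sigma_finite (R : realType) (d1 d2 : measure_display)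
    (T1 : measurableType d1) (T2 : measurableType d2)
    (m1 : {sigma_finite_measure set T1 -> \bar R})
    (m2 : {sigma_finite_measure set T2 -> \bar R}) :
  sigma_finite setT (m1 \x m2)%E.
Proof.
have /sigma_finiteP[F [TF ndF Foo]] := sigma_finiteT m1.
have /sigma_finiteP[G [TG ndG Goo]] := sigma_finiteT m2.
exists (fun n => F n `*` G n).
  rewrite -setXTT TF TG predeqE => -[x y]; split.
    move=> [/= [n _ Fnx] [k _ Gky]]; exists (maxn n k) => //; split.
    - by move: x Fnx; exact/subsetPset/ndF/leq_maxl.
    - by move: y Gky; exact/subsetPset/ndG/leq_maxr.
  by move=> [n _ []/= ? ?]; split; exists n.
move=> k; have [? ?] := Foo k; have [? ?] := Goo k.
split; first exact: measurableX.
by rewrite product_measure1E// lte_mul_pinfty// ge0_fin_numE.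
Qed.

Definition mR (R : realType) : measurableType _ := measurableTypeR R.

Definition leb1 (R : realType) : {sigma_finite_measure set (mR R) -> \bar R} :=
  lebesgue_measure.

Definition leb2 (R : realType) : set (mR R * mR R) -> \bar R :=
  (leb1 R \x leb1 R)%E.
HB.instance Definition _ (R : realType) := Measure.on (@leb2 R).
HB.instance Definition _ (R : realType) :=
  Measure_isSigmaFinite.Build _ _ _ (@leb2 R)
    (product_sigma_finite (leb1 R) (leb1 R)).

Notation R4 R := ((mR R * mR R) * (mR R * mR R))%type.

Definition leb4 (R : realType) : set (R4 R) -> \bar R :=
  (@leb2 R \x @leb2 R)%E.
HB.instance Definition _ (R : realType) := Measure.on (@leb4 R).
HB.instance Definition _ (R : realType) :=
  Measure_isSigmaFinite.Build _ _ _ (@leb4 R)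
    (product_sigma_finite (@leb2 R) (@leb2 R)).

(* Integrals over a subset of C^2 are taken in real coordinates. *)
Definition toC2 (R : realType) (p : R4 R) : C2 R :=
  (p.1.1 +i* p.1.2, p.2.1 +i* p.2.2).

(* Elements of L^2(Omega) are represented by functions on C^2, of which only the
   restriction to Omega matters. *)
Definition L2norm (R : realType) (Omega : set (C2 R)) (f : C2 R -> Cplx R)
    : \bar R :=
  ('N[@leb4 R]_2%:E [(fun p => (Normc.normc (f (toC2 p)))%:E)
                       \_ (@toC2 R @^-1` Omega)])%E.

Definition L2 (R : realType) (Omega : set (C2 R)) (f : C2 R -> Cplx R) : Prop :=
  [/\ measurable_fun (@toC2 R @^-1` Omega) (fun p => complex.Re (f (toC2 p))),
      measurable_fun (@toC2 R @^-1` Omega) (fun p => complex.Im (f (toC2 p)))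
    & (L2norm Omega f < +oo)%E].

Definition cintegral (R : realType) (Omega : set (C2 R)) (f : C2 R -> Cplx R)
    : Cplx R :=
  (\int[@leb4 R]_(p in @toC2 R @^-1` Omega) complex.Re (f (toC2 p))) +i*
  (\int[@leb4 R]_(p in @toC2 R @^-1` Omega) complex.Im (f (toC2 p))).

Definition L2inner (R : realType) (Omega : set (C2 R)) (f g : C2 R -> Cplx R)
    : Cplx R :=
  cintegral Omega (fun z => f z * (g z)^*%R).

Definition A2 (R : realType) (Omega : set (C2 R)) (f : C2 R -> Cplx R) : Prop :=
  holomorphic_on Omega f /\ L2 Omega f.

(* For f in L^2(Omega), the p below exists and is unique on Omega, because
   A^2(Omega) is closed in L^2(Omega). *)
Definition bergman_proj (R : realType) (Omega : set (C2 R))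
    (f : C2 R -> Cplx R) : C2 R -> Cplx R :=
  get [set p : C2 R -> Cplx R | A2 Omega p /\
         forall g, A2 Omega g -> L2inner Omega (f \- p) g = 0].

Definition hankel (R : realType) (Omega : set (C2 R)) (phi g : C2 R -> Cplx R)
    : C2 R -> Cplx R :=
  (phi \* g) \- bergman_proj Omega (phi \* g).

(* Compactness of an operator from A^2(Omega) to L^2(Omega): the image of every
   bounded sequence has a subsequence converging in L^2(Omega). *)
Definition compact_operator (R : realType) (Omega : set (C2 R))
    (T : (C2 R -> Cplx R) -> (C2 R -> Cplx R)) : Prop :=
  forall g : nat -> C2 R -> Cplx R,
    (forall n, A2 Omega (g n)) ->
    (exists M : R, forall n, (L2norm Omega (g n) <= M%:E)%E) ->
    exists s : nat -> nat, {homo s : m n / (m < n)%N} /\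
    exists h : C2 R -> Cplx R, L2 Omega h /\
      (fun k => L2norm Omega (T (g (s k)) \- h)) @ \oo --> 0%E.

(* Main.v *)
Require Import Defs.
From HB Require Import structures.
From mathcomp Require Import all_boot all_order all_algebra.
From mathcomp Require Import complex.
From mathcomp Require Import all_classical all_reals all_analysis measurable_realfun.
From mathcomp Require Import ring lra.

Set Implicit Arguments.
Unset Strict Implicit.
Unset Printing Implicit Defensive.

Import Order.TTheory GRing.Theory Num.Theory.
Import numFieldNormedType.Exports.

Local Open Scope classical_set_scope.
Local Open Scope ring_scope.

(** Fix a point [q = f z0] on the disc. Pseudoconvexity makes the logarithmic image
    of a complete Reinhardt domain convex ([log_convex]), so [q] lies on a face of
    the domain, described by a coordinate or by a monomial [|z1|^m * |z2|]
    ([monomial_support]). Let [lam] be the modulus of that coordinate or monomial,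
    normalised by [lam q = 1]; then [lam < 1] on the domain. By the maximum
    principle [lam (f s) = 1] for [s] near [z0]. Two kinds of diagonal affine
    maps preserve [lam]: a holomorphic family [T s] with [T z0 = id] and
    [T s q = f s], and maps that carry any boundary point of level [1] to [q]. If
    [f] is not constant, [lam < 1] describes the domain near [q]
    ([face1_cderivable], [face2_cderivable], [monomial_cderivable]).

    Now take holomorphic functions of size [lam ^+ n] and normalise them in [L2] to
    [g n]. Their mass leaves every set [lam < t] ([slab_tail]), but a fixed
    proportion of it stays near [q], because other boundary points of level [1] can
    be moved to [q] ([mass_compare]). Compactness of the Hankel operator says that,
    along a subsequence, [phi * (g k - g l)] is close in [L2] to holomorphic
    functions ([hankel_cauchy]). Restricting to a set [lam < t] and letting [l] grow
    removes [g l]: near [q], [phi * g k] is close to a holomorphic [P], relatively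
    to the mass of [g k] ([peaks_asymptotically_holomorphic]).

    Finally consider [s -> phi (T s z)] for [z] near [q] in the domain. It is close,
    in mean square over [z], to the holomorphic function
    [s -> P (T s z) / g k (T s z)], and Cauchy's formula for the latter shows that
    the former satisfies Cauchy's formula up to a small error ([cauchy_defect]).
    Letting [z] tend to [q], where [T s q = f s], the function [s -> phi (f s)]
    satisfies Cauchy's formula exactly ([flow_cderivable]), hence is holomorphic
    ([cauchy_integral_cderivable]). *)

(** * Modulus and derivative of complex numbers *)

Section ComplexModulus.
Variable R : realType.
Local Notation C := (Cplx R).
Implicit Types x y z : C.

Definition cmod (z : C) : R := Normc.normc z.

Lemma cmodE z : `|z| = (cmod z)%:C%C.
Proof. by []. Qed.

Lemma cmod_ge0 z : 0 <= cmod z.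
Proof. by have := normr_ge0 z; rewrite cmodE ler0c. Qed.

Lemma cmodM x y : cmod (x * y) = cmod x * cmod y.
Proof. exact: Normc.normcM. Qed.

Lemma cmodD x y : cmod (x + y) <= cmod x + cmod y.
Proof. exact: le_normcD. Qed.

Lemma cmodN z : cmod (- z) = cmod z.
Proof. exact: normcN. Qed.

Lemma cmodB x y : cmod (x - y) <= cmod x + cmod y.
Proof. by rewrite (le_trans (cmodD _ _))// cmodN. Qed.

Lemma cmodBC x y : cmod (x - y) = cmod (y - x).
Proof. by rewrite -cmodN opprB. Qed.

Lemma cmod0 : cmod 0 = 0.
Proof. exact: Normc.normc0. Qed.

Lemma cmod1 : cmod 1 = 1.
Proof. exact: Normc.normc1. Qed.

Lemma cmodV z : cmod z^-1 = (cmod z)^-1.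
Proof. exact: Normc.normcV. Qed.

Lemma cmodX z n : cmod (z ^+ n) = cmod z ^+ n.
Proof. by elim: n => [|n IH]; rewrite ?expr0 ?cmod1// !exprS cmodM IH. Qed.

Lemma cmod_eq0 z : (cmod z == 0) = (z == 0).
Proof. by apply/eqP/eqP => [/Normc.eq0_normc//|->]; rewrite cmod0. Qed.

Lemma cmod_gt0 z : (0 < cmod z) = (z != 0).
Proof. by rewrite lt_def cmod_ge0 andbT cmod_eq0. Qed.

Lemma cmod_real (r : R) : cmod (r%:C%C : C) = `|r|.
Proof. by rewrite /cmod /= expr0n addr0 sqrtr_sqr. Qed.

Lemma cmod_sqr z : cmod z ^+ 2 = complex.Re z ^+ 2 + complex.Im z ^+ 2.
Proof. by case: z => a b; rewrite /cmod /= sqr_sqrtr// addr_ge0// sqr_ge0. Qed.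

Lemma ler_Re_cmod z : `|complex.Re z| <= cmod z.
Proof.
rewrite -(@ler_pXn2r _ 2) ?nnegrE ?normr_ge0 ?cmod_ge0// cmod_sqr.
by rewrite real_normK ?num_real// lerDl sqr_ge0.
Qed.

Lemma ler_Im_cmod z : `|complex.Im z| <= cmod z.
Proof.
rewrite -(@ler_pXn2r _ 2) ?nnegrE ?normr_ge0 ?cmod_ge0// cmod_sqr.
by rewrite real_normK ?num_real// lerDr sqr_ge0.
Qed.

Lemma cmod_le_ReIm z : cmod z <= `|complex.Re z| + `|complex.Im z|.
Proof.
have h : 0 <= `|complex.Re z| * `|complex.Im z| by rewrite mulr_ge0.
rewrite -(@ler_pXn2r _ 2) ?nnegrE ?cmod_ge0 ?addr_ge0// cmod_sqr sqrrD.
by rewrite !real_normK ?num_real//; lra.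
Qed.

Lemma ler_cmodD_dist x y : cmod x - cmod y <= cmod (x - y).
Proof. by rewrite lerBlDr; apply: le_trans (cmodD _ _); rewrite subrK. Qed.

Lemma cmod_dist x y : `|cmod x - cmod y| <= cmod (x - y).
Proof. by rewrite ler_norml ler_cmodD_dist andbT lerNl opprB cmodBC ler_cmodD_dist. Qed.

Lemma cpos_real (e : C) : 0 < e -> exists2 r : R, 0 < r & e = r%:C%C.
Proof.
case: e => a b; rewrite ltcE/= => /andP[/eqP b0 a0]; exists a => //.
by rewrite b0.
Qed.

Lemma nbhs_cmodP (z : C) (A : set C) :
  nbhs z A <-> exists2 r : R, 0 < r & forall w, cmod (w - z) < r -> A w.
Proof.
split=> [/nbhs_ballP[e /= e0 eA]|[r r0 rA]].
  have [r r0 re] := cpos_real e0; exists r => // w wz; apply: eA.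
  by rewrite /ball/= /ball_/= distrC cmodE re ltcR.
apply/nbhs_ballP; exists r%:C%C => /=; first by rewrite ltcR.
by move=> w; rewrite /ball/= /ball_/= distrC cmodE ltcR => /rA.
Qed.

Lemma nbhs_C2P (z : C2 R) (A : set (C2 R)) :
  nbhs z A <-> exists2 r : R, 0 < r &
    forall w, cmod (w.1 - z.1) < r -> cmod (w.2 - z.2) < r -> A w.
Proof.
split=> [[[U V] [/= /nbhs_cmodP[r r0 rU] /nbhs_cmodP[s s0 sV] UV]]|[r r0 rA]].
  exists (Num.min r s); first by rewrite lt_min r0.
  move=> w; rewrite !lt_min => /andP[w1 _] /andP[_ w2].
  by apply: UV; split; [exact: rU|exact: sV].
exists ([set w | cmod (w - z.1) < r], [set w | cmod (w - z.2) < r]) => /=.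
  by split; apply/nbhs_cmodP; exists r.
by move=> w [/= w1 w2]; exact: rA.
Qed.

Lemma cvg_cmodP (T : Type) (F : set_system T) (FF : Filter F) (f : T -> C) (l : C) :
  f @ F --> l <-> forall e : R, 0 < e -> \forall x \near F, cmod (f x - l) < e.
Proof.
split=> [fl e e0|fl A /nbhs_cmodP[r r0 rA]].
  by apply: (fl [set w | cmod (w - l) < e]); apply/nbhs_cmodP; exists e.
by apply: filterS (fl _ r0) => x /rA.
Qed.

Lemma continuous_cmod : continuous (cmod : C -> R).
Proof.
move=> z; apply/(@cvgrPdist_lt _ _ _ (nbhs z)) => e e0; apply/nbhs_cmodP; exists e => // w wz.
by rewrite (le_lt_trans (cmod_dist _ _))// cmodBC.
Qed.

Lemma continuous_Re : continuous (@complex.Re R : C -> R).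
Proof.
move=> z; apply/(@cvgrPdist_lt _ _ _ (nbhs z)) => e e0; apply/nbhs_cmodP; exists e => // w wz.
by rewrite -raddfB (le_lt_trans (ler_Re_cmod _))// cmodBC.
Qed.

Lemma continuous_Im : continuous (@complex.Im R : C -> R).
Proof.
move=> z; apply/(@cvgrPdist_lt _ _ _ (nbhs z)) => e e0; apply/nbhs_cmodP; exists e => // w wz.
by rewrite -raddfB (le_lt_trans (ler_Im_cmod _))// cmodBC.
Qed.

Lemma cvg_complex (T : Type) (F : set_system T) (FF : Filter F) (f : T -> C) (l : C) :
  (complex.Re (f x) @[x --> F] --> complex.Re l) ->
  (complex.Im (f x) @[x --> F] --> complex.Im l) -> f @ F --> l.
Proof.
move=> /cvgrPdist_lt fr /cvgrPdist_lt fi; apply/cvg_cmodP => e e0.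
have e20 : 0 < e / 2 by rewrite divr_gt0.
near=> x; rewrite cmodBC (le_lt_trans (cmod_le_ReIm _))// (splitr e) !raddfB ltrD//.
  by near: x; exact: fr.
by near: x; exact: fi.
Unshelve. all: by end_near. Qed.

Lemma continuous_real_complex : continuous (fun r : R => r%:C%C : C).
Proof.
move=> r; apply: cvg_complex => /=; first exact: cvg_id.
exact: cvg_cst.
Qed.

(** Radii and errors are taken in [R] rather than among the positive elements of
    [C], so that all estimates below are between real numbers. *)
Definition cderiv (f : C -> C) (z d : C) := forall e : R, 0 < e ->
  exists2 r : R, 0 < r & forall h, cmod h < r ->
    cmod (f (z + h) - f z - d * h) <= e * cmod h.

Lemma cderivP (f : C -> C) (z : C) :
  differentiable f z <-> exists d, cderiv f z d.
Proof.
rewrite -derivable1_diffP; split=> [|[d df]].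
  move=> /cvg_ex[d /cvg_cmodP df]; exists d => e e0.
  have [r r0 rP] : exists2 r : R, 0 < r & forall h : C, cmod (h - 0) < r ->
      h != 0 -> cmod (h^-1 *: (f (h *: (1 : C) + z) - f z) - d) < e.
    by apply/nbhs_cmodP; exact: df.
  exists r => // h hr; have [->|h0] := eqVneq h 0.
    by rewrite addr0 subrr mulr0 subr0 cmod0 mulr0.
  have := rP h; rewrite subr0 => /(_ hr h0)/ltW he.
  have -> : f (z + h) - f z - d * h =
      (h^-1 *: (f (h *: (1 : C) + z) - f z) - d) * h.
    rewrite mulrBl -[h^-1 *: _]/(h^-1 * _) -[h *: _]/(h * _) mulr1 (addrC h z).
    by rewrite mulrAC mulVf ?mul1r.
  by rewrite cmodM ler_pM2r// cmod_gt0.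
apply/cvg_ex; exists d; apply/cvg_cmodP => e e0.
have e20 : 0 < e / 2 by rewrite divr_gt0.
have [r r0 rP] := df _ e20; apply/nbhs_cmodP; exists r => // h; rewrite subr0 => hr /= h0.
have -> : (h^-1 *: (f (h *: (1 : C) + z) - f z) - d) =
    (f (z + h) - f z - d * h) * h^-1.
  rewrite mulrBl -[h^-1 *: _]/(h^-1 * _) -[h *: _]/(h * _) mulr1 (addrC h z).
  by rewrite mulrK ?unitfE// mulrC.
rewrite cmodM cmodV ltr_pdivrMr ?cmod_gt0// (le_lt_trans (rP _ hr))//.
by rewrite ltr_pM2r ?cmod_gt0// ltr_pdivrMr// ltr_pMr// ltr1n.
Qed.

End ComplexModulus.

(** * Integrals of complex functions of a real variable *)

Section ComplexIntegral.
Variable R : realType.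
Local Notation C := (Cplx R).
Local Notation mu := (@lebesgue_measure R).

(** Continuity is two-sided at the end points too: the integrands below are
    defined beyond the interval, and no one-sided limits appear. *)
Definition cont_itv (T : topologicalType) (a b : R) (f : R -> T) :=
  forall x, a <= x <= b -> {for x, continuous f}.

Lemma cont_itv_within (T : topologicalType) (a b : R) (f : R -> T) :
  cont_itv a b f -> {within `[a, b], continuous f}.
Proof.
move=> cf; apply: continuous_in_subspaceT => x.
by rewrite inE/= in_itv/= => /cf.
Qed.

Lemma cont_itv_comp (T U : topologicalType) (a b : R) (f : R -> T) (g : T -> U) :
  (forall x, a <= x <= b -> {for f x, continuous g}) -> cont_itv a b f ->
  cont_itv a b (g \o f).
Proof. by move=> cg cf x xab; apply: continuous_comp; [exact: cf|exact: cg]. Qed.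

Lemma cont_itv_sub (T : topologicalType) (a b c d : R) (f : R -> T) :
  a <= c -> d <= b -> cont_itv a b f -> cont_itv c d f.
Proof. by move=> ac db cf x /andP[cx xd]; apply: cf; lra. Qed.

Lemma cont_itv_Re (a b : R) (f : R -> C) : cont_itv a b f ->
  cont_itv a b (fun x => complex.Re (f x)).
Proof. by apply: cont_itv_comp => x _; exact: continuous_Re. Qed.

Lemma cont_itv_Im (a b : R) (f : R -> C) : cont_itv a b f ->
  cont_itv a b (fun x => complex.Im (f x)).
Proof. by apply: cont_itv_comp => x _; exact: continuous_Im. Qed.

Lemma cont_itv_cmod (a b : R) (f : R -> C) : cont_itv a b f ->
  cont_itv a b (fun x => cmod (f x)).
Proof. by apply: cont_itv_comp => x _; exact: continuous_cmod. Qed.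

Lemma cont_itvM (a b : R) (f g : R -> C) : cont_itv a b f -> cont_itv a b g ->
  cont_itv a b (fun x => f x * g x).
Proof. by move=> cf cg x xab; apply: continuousM; [exact: cf|exact: cg]. Qed.

Lemma cont_itvD (a b : R) (f g : R -> C) : cont_itv a b f -> cont_itv a b g ->
  cont_itv a b (fun x => f x + g x).
Proof. by move=> cf cg x xab; apply: continuousD; [exact: cf|exact: cg]. Qed.

Lemma cont_itvB (a b : R) (f g : R -> C) : cont_itv a b f -> cont_itv a b g ->
  cont_itv a b (fun x => f x - g x).
Proof. by move=> cf cg x xab; apply: continuousB; [exact: cf|exact: cg]. Qed.

Lemma cont_itvV (a b : R) (f : R -> C) : cont_itv a b f ->
  (forall x, a <= x <= b -> f x != 0) -> cont_itv a b (fun x => (f x)^-1).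
Proof. by move=> cf f0 x xab; apply: continuousV; [exact: f0|exact: cf]. Qed.

Lemma cont_itv_cst (T : topologicalType) (a b : R) (c : T) : cont_itv a b (fun=> c).
Proof. by move=> x _; exact: cvg_cst. Qed.

Lemma cont_itvZ (a b : R) (c : C) (f : R -> C) : cont_itv a b f ->
  cont_itv a b (fun x => c * f x).
Proof. exact: (@cont_itvM a b (fun=> c) f (@cont_itv_cst _ a b c)). Qed.

Lemma cont_itv_integrable (a b : R) (f : R -> R) : cont_itv a b f ->
  mu.-integrable `[a, b] (EFin \o f).
Proof.
move=> cf; apply: continuous_compact_integrable; first exact: segment_compact.
exact: cont_itv_within.
Qed.

Definition cint (a b : R) (f : R -> C) : C :=
  ((\int[mu]_(x in `[a, b]) complex.Re (f x)) +i*
   (\int[mu]_(x in `[a, b]) complex.Im (f x)))%C.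

Lemma eq_cint (a b : R) (f g : R -> C) :
  (forall x, a <= x <= b -> f x = g x) -> cint a b f = cint a b g.
Proof.
move=> fg; congr (_ +i* _)%C; apply: eq_Rintegral => x;
  by rewrite inE/= in_itv/= => /fg ->.
Qed.

Lemma cintD (a b : R) (f g : R -> C) : cont_itv a b f -> cont_itv a b g ->
  cint a b (fun x => f x + g x) = cint a b f + cint a b g.
Proof.
move=> cf cg; rewrite /cint; congr (_ +i* _)%C.
- under eq_Rintegral do rewrite raddfD.
  by rewrite RintegralD//; apply: cont_itv_integrable; exact: cont_itv_Re.
- under eq_Rintegral do rewrite raddfD.
  by rewrite RintegralD//; apply: cont_itv_integrable; exact: cont_itv_Im.
Qed.

Lemma cintZ (a b : R) (c : C) (f : R -> C) : cont_itv a b f ->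
  cint a b (fun x => c * f x) = c * cint a b f.
Proof.
move=> cf; rewrite /cint; case: c => c d.
have iRe := cont_itv_integrable (cont_itv_Re cf).
have iIm := cont_itv_integrable (cont_itv_Im cf).
have Zi k g : mu.-integrable `[a, b] (EFin \o g) ->
    mu.-integrable `[a, b] (EFin \o (fun x => k * g x)).
  by move=> ig; exact: (integrableZl _ k ig).
apply/eqP; rewrite eq_complex /=; apply/andP; split; apply/eqP.
- under eq_Rintegral => x _.
    have -> : complex.Re ((c +i* d)%C * f x) = c * complex.Re (f x) - d * complex.Im (f x).
      by case: (f x).
    over.
  by rewrite RintegralB ?RintegralZl//; exact: Zi.
- under eq_Rintegral => x _.
    have -> : complex.Im ((c +i* d)%C * f x) = c * complex.Im (f x) + d * complex.Re (f x).
      by case: (f x).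
    over.
  by rewrite RintegralD ?RintegralZl//; exact: Zi.
Qed.

Lemma cintB (a b : R) (f g : R -> C) : cont_itv a b f -> cont_itv a b g ->
  cint a b (fun x => f x - g x) = cint a b f - cint a b g.
Proof.
move=> cf cg; transitivity (cint a b (fun x => f x + (-1) * g x)).
  by apply: eq_cint => x _; rewrite mulN1r.
by rewrite (cintD cf (cont_itvZ (c:=-1) cg)) cintZ// mulN1r.
Qed.

Lemma le_rint (a b : R) (f g : R -> R) : cont_itv a b f -> cont_itv a b g ->
  (forall x, a <= x <= b -> f x <= g x) ->
  (\int[mu]_(x in `[a, b]) f x) <= \int[mu]_(x in `[a, b]) g x.
Proof.
move=> cf cg fg; apply: le_Rintegral => //; try exact: cont_itv_integrable.
Qed.

Lemma rint_cst (a b c : R) : a <= b ->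
  \int[mu]_(x in `[a, b]) c = c * (b - a).
Proof.
move=> ab; rewrite Rintegral_cst//= lebesgue_measure_itv/= lte_fin.
case: ltP => //= ba; have -> : a = b by lra.
by rewrite subrr mulr0.
Qed.

Lemma cint_cst (a b : R) (c : C) : a <= b -> cint a b (fun=> c) = (b - a)%:C%C * c.
Proof.
by move=> ab; rewrite /cint !rint_cst//; case: c => c d; simpc; rewrite mulrC (mulrC d).
Qed.

(** Multiplying by a unimodular constant makes the integral a nonnegative real,
    that is, the integral of a real part. *)
Lemma cmod_cint (a b : R) (f : R -> C) : cont_itv a b f ->
  cmod (cint a b f) <= \int[mu]_(x in `[a, b]) cmod (f x).
Proof.
move=> cf; have [->|I0] := eqVneq (cint a b f) 0.
  by rewrite cmod0; apply: Rintegral_ge0 => x _; exact: cmod_ge0.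
pose u : C := (cmod (cint a b f))%:C%C / cint a b f.
have u1 : cmod u = 1.
  by rewrite cmodM cmod_real cmodV ger0_norm ?cmod_ge0// mulfV// cmod_eq0.
have -> : cmod (cint a b f) = complex.Re (cint a b (fun x => u * f x)).
  by rewrite cintZ// /u mulfVK.
rewrite /cint /=; apply: le_rint.
- exact: (@cont_itv_Re a b (fun x => u * f x) (cont_itvZ (c:=u) cf)).
- exact: cont_itv_cmod.
- move=> x _; rewrite (le_trans (ler_norm _))// (le_trans (ler_Re_cmod _))//.
  by rewrite cmodM u1 mul1r.
Qed.

Lemma cmod_cint_le (a b M : R) (f : R -> C) : a <= b -> cont_itv a b f ->
  (forall x, a <= x <= b -> cmod (f x) <= M) -> cmod (cint a b f) <= M * (b - a).
Proof.
move=> ab cf fM; rewrite (le_trans (cmod_cint cf))// -rint_cst//.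
by apply: le_rint => //; [exact: cont_itv_cmod|exact: cont_itv_cst].
Qed.

Lemma rint_affine (b a1 a2 a3 : R) (f g : R -> R) : 0 <= b -> cont_itv 0 b f -> cont_itv 0 b g ->
  \int[mu]_(t in `[0, b]) (a1 + a2 * f t + a3 * g t) =
  a1 * b + a2 * (\int[mu]_(t in `[0, b]) f t) + a3 * (\int[mu]_(t in `[0, b]) g t).
Proof.
move=> b0 cf cg.
have cM (a : R) (h : R -> R) : cont_itv 0 b h -> cont_itv 0 b (fun t => a * h t).
  by move=> ch t tb; apply: (@continuousM _ _ (fun=> a) h); [exact: cvg_cst|exact: ch].
have i1 : mu.-integrable `[0, b] (EFin \o (fun=> a1)) := cont_itv_integrable (@cont_itv_cst R 0 b a1).
have i2 : mu.-integrable `[0, b] (EFin \o (fun t => a2 * f t)) := cont_itv_integrable (cM a2 f cf).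
have i3 : mu.-integrable `[0, b] (EFin \o (fun t => a3 * g t)) := cont_itv_integrable (cM a3 g cg).
have i12 : mu.-integrable `[0, b] (EFin \o (fun t => a1 + a2 * f t)).
  apply: cont_itv_integrable => t tb; apply: (@continuousD _ _ _ (fun=> a1) (fun t => a2 * f t)).
    exact: cvg_cst.
  exact: (cM a2 f cf).
rewrite (RintegralD _ i12 i3)// (RintegralD _ i1 i2)//.
have jf := cont_itv_integrable cf; have jg := cont_itv_integrable cg.
rewrite RintegralZl// RintegralZl//.
by rewrite rint_cst// subr0.
Qed.

Lemma rint_split (a c b : R) (g : R -> R) : a <= c -> c <= b -> cont_itv a b g ->
  \int[mu]_(x in `[a, b]) g x =
  \int[mu]_(x in `[a, c]) g x + \int[mu]_(x in `[c, b]) g x.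
Proof.
move=> ac cb cg; have := @Rintegral_itvB R g (BLeft a) (BRight b) c.
move=> /(_ (cont_itv_integrable cg)) /(_ ac cb).
rewrite Rintegral_itv_obnd_cbnd => [<-|]; first by rewrite addrC subrK.
have /integrableS : mu.-integrable `[a, b] (EFin \o g) by exact: cont_itv_integrable.
move=> /(_ `]c, b]%classic); apply => //.
by move=> x /=; rewrite !in_itv/= => /andP[/ltW cx ->]; rewrite (le_trans ac).
Qed.

Lemma cint_split (a c b : R) (f : R -> C) : a <= c -> c <= b -> cont_itv a b f ->
  cint a b f = cint a c f + cint c b f.
Proof.
move=> ac cb cf.
by rewrite /cint (rint_split ac cb (cont_itv_Re cf)) (rint_split ac cb (cont_itv_Im cf)).
Qed.

Lemma rint_FTC (a b : R) (F f : R -> R) : a <= b ->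
  (forall x, a <= x <= b -> is_derive x 1 F (f x)) -> cont_itv a b f ->
  \int[mu]_(x in `[a, b]) f x = F b - F a.
Proof.
rewrite le_eqVlt => /predU1P[<-|ab] dF cf.
  by rewrite set_itv1 Rintegral_set1 subrr.
have cF x : a <= x <= b -> {for x, continuous F}.
  move=> /dF [dFx _]; apply: differentiable_continuous.
  exact/derivable1_diffP.
rewrite /Rintegral (@continuous_FTC2 _ f F a b)//.
- exact: cont_itv_within.
- split.
  + by move=> x; rewrite in_itv/= => /andP[ax xb]; have [] := dF x; rewrite ?ltW.
  + by apply: cvg_at_right_filter; apply: cF; rewrite lexx ltW.
  + by apply: cvg_at_left_filter; apply: cF; rewrite lexx ltW.
- move=> x; rewrite in_itv/= => /andP[ax xb]; rewrite derive1E.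
  by have [] := dF x; rewrite ?ltW.
Qed.

(** A complex curve is differentiated through its two real coordinates, where
    the fundamental theorem of calculus applies. *)
Definition rderiv (F : R -> C) (x : R) (d : C) :=
  is_derive x 1 (fun t => complex.Re (F t)) (complex.Re d) /\
  is_derive x 1 (fun t => complex.Im (F t)) (complex.Im d).

Lemma cint_FTC (a b : R) (F f : R -> C) : a <= b ->
  (forall x, a <= x <= b -> rderiv F x (f x)) -> cont_itv a b f ->
  cint a b f = F b - F a.
Proof.
move=> ab dF cf; rewrite /cint.
have h1 x : a <= x <= b -> is_derive x 1 (fun t => complex.Re (F t)) (complex.Re (f x)).
  by move=> /dF[].
have h2 x : a <= x <= b -> is_derive x 1 (fun t => complex.Im (F t)) (complex.Im (f x)).
  by move=> /dF[].
rewrite (rint_FTC ab h1 (cont_itv_Re cf)) (rint_FTC ab h2 (cont_itv_Im cf)).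
by case: (F a) (F b) => ? ? [].
Qed.

Lemma rderivM (F G : R -> C) x d e : rderiv F x d -> rderiv G x e ->
  rderiv (fun t => F t * G t) x (d * G x + F x * e).
Proof.
move=> [Fr Fi] [Gr Gi]; split.
- rewrite (_ : (fun t => complex.Re (F t * G t)) =
    (fun t => complex.Re (F t)) * (fun t => complex.Re (G t)) -
    (fun t => complex.Im (F t)) * (fun t => complex.Im (G t))); last first.
    by apply/funext => t /=; rewrite !fctE; case: (F t) (G t) => ? ? [].
  apply: (is_derive_eq (is_deriveB (is_deriveM Fr Gr) (is_deriveM Fi Gi))).
  by case: d e (F x) (G x) Fr Fi Gr Gi => [? ?] [? ?] [? ?] [? ?] ? ? ? ? /=; rewrite /GRing.scale /=; ring.
- rewrite (_ : (fun t => complex.Im (F t * G t)) =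
    (fun t => complex.Re (F t)) * (fun t => complex.Im (G t)) +
    (fun t => complex.Im (F t)) * (fun t => complex.Re (G t))); last first.
    by apply/funext => t /=; rewrite !fctE; case: (F t) (G t) => ? ? [].
  apply: (is_derive_eq (is_deriveD (is_deriveM Fr Gi) (is_deriveM Fi Gr))).
  by case: d e (F x) (G x) Fr Fi Gr Gi => [? ?] [? ?] [? ?] [? ?] ? ? ? ? /=; rewrite /GRing.scale /=; ring.
Qed.

Lemma rderivD (F G : R -> C) x d e : rderiv F x d -> rderiv G x e ->
  rderiv (fun t => F t + G t) x (d + e).
Proof.
move=> [Fr Fi] [Gr Gi]; split.
- rewrite (_ : (fun t => complex.Re (F t + G t)) =
    (fun t => complex.Re (F t)) + (fun t => complex.Re (G t))); last first.
    by apply/funext => t /=; rewrite fctE raddfD.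
  by apply: is_derive_eq; rewrite raddfD.
- rewrite (_ : (fun t => complex.Im (F t + G t)) =
    (fun t => complex.Im (F t)) + (fun t => complex.Im (G t))); last first.
    by apply/funext => t /=; rewrite fctE raddfD.
  by apply: is_derive_eq; rewrite raddfD.
Qed.

Lemma rderiv_cst (c : C) x : rderiv (fun=> c) x 0.
Proof. by split; exact: is_derive_cst. Qed.

Lemma rderiv_real x : rderiv (fun t => t%:C%C) x 1.
Proof. by split; [exact: is_derive_id|exact: is_derive_cst]. Qed.

Lemma rderiv_cis x : rderiv (@cis R) x ('i * cis x).
Proof.
split; rewrite /=.
- by have := is_derive_cos x; rewrite mul0r mul1r sub0r.
- by have := is_derive_sin x; rewrite mul0r mul1r add0r.
Qed.

Lemma rderiv_continuous (F : R -> C) x d : rderiv F x d -> {for x, continuous F}.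
Proof.
move=> [[Fr _] [Fi _]]; apply: cvg_complex.
- exact/differentiable_continuous/derivable1_diffP/Fr.
- exact/differentiable_continuous/derivable1_diffP/Fi.
Qed.

Lemma continuous_cis : continuous (@cis R).
Proof. by move=> x; exact: rderiv_continuous (rderiv_cis x). Qed.

Lemma cmod_cis (t : R) : cmod (cis t) = 1.
Proof.
apply/eqP; rewrite -(@pexpr_eq1 _ _ 2) ?cmod_ge0// cmod_sqr /=.
by rewrite cos2Dsin2.
Qed.

Lemma cis0 : cis (0 : R) = 1.
Proof. by rewrite /cis cos0 sin0. Qed.

Lemma cis2pi : cis (2 * pi : R) = 1.
Proof. by rewrite /cis mulr_natl cos2pi sin2pi. Qed.

End ComplexIntegral.

(** * Goursat's theorem *)

Section Bisection.
Variable R : realType.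
Local Notation C := (Cplx R).

(** Intervals are pairs of end points; [true] selects the left half. *)
Definition half (X : R * R) (b : bool) : R * R :=
  let m := (X.1 + X.2) / 2 in if b then (X.1, m) else (m, X.2).

Lemma half_ord (X : R * R) b : X.1 <= X.2 ->
  [/\ X.1 <= (half X b).1, (half X b).1 <= (half X b).2, (half X b).2 <= X.2 &
    (half X b).2 - (half X b).1 = (X.2 - X.1) / 2].
Proof. by case: X => x y /= xy; rewrite /half; case: b => /=; split; lra. Qed.

Variable I : R * R -> R * R -> C.
Variables A B : R * R.
Hypotheses (hA : A.1 <= A.2) (hB : B.1 <= B.2).

Definition subitv (X Y : R * R) := [/\ Y.1 <= X.1, X.1 <= X.2 & X.2 <= Y.2].

Lemma half_subitv (X Y : R * R) b : subitv X Y -> subitv (half X b) Y.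
Proof.
move=> [h1 h2 h3]; have [g1 g2 g3 _] := half_ord b h2.
by split => //; [exact: le_trans g1|exact: le_trans h3].
Qed.

Hypothesis addX : forall X Y, subitv X A -> subitv Y B ->
  I X Y = I (half X true) Y + I (half X false) Y.
Hypothesis addY : forall X Y, subitv X A -> subitv Y B ->
  I X Y = I X (half Y true) + I X (half Y false).
Hypothesis loc : forall x y, A.1 <= x <= A.2 -> B.1 <= y <= B.2 ->
  forall e : R, 0 < e -> exists2 d : R, 0 < d & forall X Y,
    subitv X A -> subitv Y B -> X.1 <= x <= X.2 -> Y.1 <= y <= Y.2 ->
    X.2 - X.1 < d -> Y.2 - Y.1 < d ->
    cmod (I X Y) <= e * ((X.2 - X.1) + (Y.2 - Y.1)) ^+ 2.

(* [step] keeps a quarter that carries at least a quarter of [I]; by additivity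
   the default of [pick] is never reached *)
Let good (Q : (R * R) * (R * R)) (p : bool * bool) :=
  cmod (I Q.1 Q.2) <= 4 * cmod (I (half Q.1 p.1) (half Q.2 p.2)).

Let step (Q : (R * R) * (R * R)) : (R * R) * (R * R) :=
  let p := odflt (true, true) [pick p | good Q p] in (half Q.1 p.1, half Q.2 p.2).

Let Qn n := iter n step (A, B).

Let Qn_sub n : subitv (Qn n).1 A /\ subitv (Qn n).2 B.
Proof.
elim: n => [|n [IH1 IH2]] /=; first by split.
by split; exact: half_subitv.
Qed.

Let Qn_size n : (Qn n).1.2 - (Qn n).1.1 = (A.2 - A.1) / 2 ^+ n /\
  (Qn n).2.2 - (Qn n).2.1 = (B.2 - B.1) / 2 ^+ n.
Proof.
elim: n => [|n [IH1 IH2]] /=; first by rewrite expr0 !divr1.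
have [[_ h _] [_ k _]] := Qn_sub n; rewrite -/(Qn n) /step /=.
set p := odflt _ _; have [_ _ _ ->] := half_ord p.1 h.
have [_ _ _ ->] := half_ord p.2 k.
by rewrite IH1 IH2 exprSr invfM !mulrA.
Qed.

Let Qn_big n : cmod (I A B) <= 4 ^+ n * cmod (I (Qn n).1 (Qn n).2).
Proof.
elim: n => [|n IH] /=; first by rewrite expr0 mul1r.
rewrite (le_trans IH)// exprSr -mulrA ler_pM2l ?exprn_gt0//.
rewrite -/(Qn n) /step; case: pickP => [p|nop] //=.
have {}nop p : 4 * cmod (I (half (Qn n).1 p.1) (half (Qn n).2 p.2)) <
    cmod (I (Qn n).1 (Qn n).2) by rewrite ltNge; have := nop p; rewrite /good => ->.
have [sA sB] := Qn_sub n.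
have := nop (true, true); have := nop (true, false).
have := nop (false, true); have := nop (false, false) => /=.
have : cmod (I (Qn n).1 (Qn n).2) <=
    (cmod (I (half (Qn n).1 true) (half (Qn n).2 true)) +
     cmod (I (half (Qn n).1 true) (half (Qn n).2 false))) +
    (cmod (I (half (Qn n).1 false) (half (Qn n).2 true)) +
     cmod (I (half (Qn n).1 false) (half (Qn n).2 false))).
  rewrite (addX sA sB) (addY (half_subitv true sA) sB) (addY (half_subitv false sA) sB).
  by rewrite (le_trans (cmodD _ _))// lerD// cmodD.
lra.
Qed.

Let Qn_mono m n : (m <= n)%N -> subitv (Qn n).1 (Qn m).1 /\ subitv (Qn n).2 (Qn m).2.
Proof.
elim: n => [|n IH].
  by rewrite leqn0 => /eqP ->; have [[? ? ?] [? ? ?]] := Qn_sub 0.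
rewrite leq_eqVlt => /predU1P[->|/IH[h1 h2]] /=; last first.
  by split; exact: half_subitv.
by have [[? ? ?] [? ? ?]] := Qn_sub n.+1.
Qed.

Let Qn_pt : exists x y, forall n, (Qn n).1.1 <= x <= (Qn n).1.2 /\ (Qn n).2.1 <= y <= (Qn n).2.2.
Proof.
have cross m n : (Qn m).1.1 <= (Qn n).1.2 /\ (Qn m).2.1 <= (Qn n).2.2.
  have [[h1 h2 h3] [k1 k2 k3]] := Qn_mono (leq_maxl m n).
  have [[h4 h5 h6] [k4 k5 k6]] := Qn_mono (leq_maxr m n).
  by split; [apply: (le_trans h1); apply: (le_trans h2)|apply: (le_trans k1); apply: (le_trans k2)].
exists (sup (range (fun n => (Qn n).1.1))), (sup (range (fun n => (Qn n).2.1))) => n.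
split; apply/andP; split.
- by apply: ub_le_sup; [exists (Qn 0).1.2 => _ [m _ <-]; have [] := cross m 0|exists n].
- by apply: ge_sup; [exists (Qn 0).1.1; exists 0|move=> _ [m _ <-]; have [] := cross m n].
- by apply: ub_le_sup; [exists (Qn 0).2.2 => _ [m _ <-]; have [] := cross m 0|exists n].
- by apply: ge_sup; [exists (Qn 0).2.1; exists 0|move=> _ [m _ <-]; have [] := cross m n].
Qed.

(** Bisection on pairs of intervals: one of the four quarters carries at least a
    quarter of [I], and after [n] steps the local bound is by a multiple of
    [4 ^ -n] that is as small as desired. *)
Lemma bisection_eq0 : I A B = 0.
Proof.
apply/eqP; rewrite -cmod_eq0; apply/negPn/negP => I0.
have {}I0 : 0 < cmod (I A B) by rewrite lt_def I0 cmod_ge0.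
have [x [y xy]] := Qn_pt.
have := hA; have := hB => hB' hA'.
pose L := (A.2 - A.1) + (B.2 - B.1) + 1.
have L0 : 0 < L by rewrite /L; lra.
have L20 : 0 < L ^+ 2 by rewrite exprn_gt0.
have [x0 y0] := xy 0.
have e0 : 0 < cmod (I A B) / (2 * L ^+ 2) by rewrite divr_gt0// mulr_gt0.
have [d d0 dP] := loc x0 y0 e0.
have [n nd] : exists n, L / 2 ^+ n < d.
  have [n nd] := ltr_add_invr (y := 0) (x := d / L) (divr_gt0 d0 L0).
  exists n; rewrite ltr_pdivrMr ?exprn_gt0//.
  rewrite add0r ltr_pdivlMr// mulrC ltr_pdivrMr ?ltr0n// in nd.
  rewrite (lt_le_trans nd)// ler_pM2l// -natrX ler_nat.
  exact: ltn_expl.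
have [sA sB] := Qn_sub n; have [xn yn] := xy n; have [sx sy] := Qn_size n.
have n0 : 0 < (2 : R) ^+ n by rewrite exprn_gt0.
have h1 : (Qn n).1.2 - (Qn n).1.1 < d.
  by rewrite sx (le_lt_trans _ nd)// ler_pM2r ?invr_gt0// /L; lra.
have h2 : (Qn n).2.2 - (Qn n).2.1 < d.
  by rewrite sy (le_lt_trans _ nd)// ler_pM2r ?invr_gt0// /L; lra.
have := dP _ _ sA sB xn yn h1 h2; rewrite sx sy -mulrDl expr_div_n.
have -> : ((2 : R) ^+ n) ^+ 2 = 4 ^+ n by rewrite -exprM mulnC exprM -natrX.
have := Qn_big n; set c := cmod (I (Qn n).1 _); set S := A.2 - A.1 + _ => h3 h4.
have p4 : 0 < (4 : R) ^+ n by rewrite exprn_gt0.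
have : cmod (I A B) <= cmod (I A B) / 2 * (S ^+ 2 / L ^+ 2).
  rewrite (le_trans h3)// mulrC -ler_pdivlMr// (le_trans h4)// le_eqVlt; apply/orP; left.
  by apply/eqP; field; rewrite !gt_eqF.
have : S ^+ 2 / L ^+ 2 <= 1.
  rewrite ler_pdivrMr// mul1r ler_pXn2r ?nnegrE// ?(ltW L0)//.
    by rewrite /L /S; lra.
  by rewrite /S; lra.
nra.
Qed.

End Bisection.

Section Goursat.
Variable R : realType.
Local Notation C := (Cplx R).

Lemma cderiv_continuous (f : C -> C) z d : cderiv f z d -> {for z, continuous f}.
Proof.
move=> df; apply: differentiable_continuous; apply/cderivP; by exists d.
Qed.

(* a primitive of the affine function [F0 + F1 * (z - z0)] *)
Let quad (F0 F1 z0 z : C) : C := F0 * z + F1 * (2^-1 * (z * z) - z0 * z).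

(** Along one side, [F] is replaced by its affine approximation, whose primitive
    [quad] will cancel when the four sides are added. *)
Let side (F : C -> C) (g dg : R -> C) (a b K M : R) (F0 F1 z0 : C) :
  a <= b -> (forall x, a <= x <= b -> rderiv g x (dg x)) -> cont_itv a b dg ->
  (forall x, a <= x <= b -> {for g x, continuous F}) ->
  (forall x, a <= x <= b -> cmod (dg x) <= M) ->
  (forall x, a <= x <= b -> cmod (F (g x) - F0 - F1 * (g x - z0)) <= K) ->
  cmod (cint a b (fun x => F (g x) * dg x) -
        (quad F0 F1 z0 (g b) - quad F0 F1 z0 (g a))) <= K * M * (b - a).
Proof.
move=> ab dgP cdg cF dgM FK.
have cg : cont_itv a b g by move=> x /dgP/rderiv_continuous.
have cFg : cont_itv a b (fun x => F (g x)) by exact: cont_itv_comp cF cg.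
have cL : cont_itv a b (fun x => F0 + F1 * (g x - z0)).
  apply: (@cont_itvD _ a b (fun=> F0) (fun x => F1 * (g x - z0))).
    exact: (@cont_itv_cst R C a b F0).
  apply: (@cont_itvZ _ a b F1 (fun x => g x - z0)).
  exact: (cont_itvB cg (@cont_itv_cst R C a b z0)).
have cLg := cont_itvM cL cdg.
rewrite -(@cint_FTC R a b (fun x => quad F0 F1 z0 (g x))
  (fun x => (F0 + F1 * (g x - z0)) * dg x))//; last first.
  move=> x xab; have h := dgP _ xab.
  have cst (c : C) := rderiv_cst c x.
  have -> : (F0 + F1 * (g x - z0)) * dg x =
     ((0 * g x + F0 * dg x) + (0 * (2^-1 * (g x * g x) + (- z0) * g x) +
      F1 * ((0 * (g x * g x) + 2^-1 * (dg x * g x + g x * dg x)) + (0 * g x + (- z0) * dg x)))).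
    by field.
  have := rderivD (rderivM (cst F0) h) (rderivM (cst F1) (rderivD
    (rderivM (cst 2^-1) (rderivM h h)) (rderivM (cst (- z0)) h))).
  congr rderiv; apply/funext => t; rewrite /quad; by rewrite mulNr.
have cFd := cont_itvM cFg cdg.
rewrite -(cintB cFd cLg).
apply: (cmod_cint_le ab (cont_itvB cFd cLg)).
move=> x xab; rewrite -mulrBl opprD addrA cmodM ler_pM ?cmod_ge0//.
- exact: FK.
- exact: dgM.
Qed.

Variables (G Gx Gy : R -> R -> C) (F : C -> C) (A B : R * R) (M : R).
Hypotheses (hA : A.1 <= A.2) (hB : B.1 <= B.2).
Let inA x := A.1 <= x <= A.2.
Let inB y := B.1 <= y <= B.2.
Hypothesis dGx : forall x y, inA x -> inB y -> rderiv (G^~ y) x (Gx x y).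
Hypothesis dGy : forall x y, inA x -> inB y -> rderiv (G x) y (Gy x y).
Hypothesis cGx : forall y, inB y -> cont_itv A.1 A.2 (Gx^~ y).
Hypothesis cGy : forall x, inA x -> cont_itv B.1 B.2 (Gy x).
Hypothesis GxM : forall x y, inA x -> inB y -> cmod (Gx x y) <= M.
Hypothesis GyM : forall x y, inA x -> inB y -> cmod (Gy x y) <= M.
Hypothesis lipG : forall x y x' y', inA x -> inB y -> inA x' -> inB y' ->
  cmod (G x y - G x' y') <= M * (`|x - x'| + `|y - y'|).
Hypothesis dF : forall x y, inA x -> inB y -> exists d, cderiv F (G x y) d.

Let V (Y : R * R) x := cint Y.1 Y.2 (fun y => F (G x y) * Gy x y).
Let H (X : R * R) y := cint X.1 X.2 (fun x => F (G x y) * Gx x y).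
Let bd (X Y : R * R) : C := (V Y X.2 - V Y X.1) - (H X Y.2 - H X Y.1).

Let cF x y : inA x -> inB y -> {for G x y, continuous F}.
Proof. by move=> hx hy; have [d /cderiv_continuous] := dF hx hy. Qed.

Let cV x : inA x -> cont_itv B.1 B.2 (fun y => F (G x y) * Gy x y).
Proof.
move=> hx; apply: cont_itvM; last exact: cGy.
apply: (@cont_itv_comp R C C B.1 B.2 (G x) F) => y hy; first exact: cF.
exact: rderiv_continuous (dGy hx hy).
Qed.

Let cH y : inB y -> cont_itv A.1 A.2 (fun x => F (G x y) * Gx x y).
Proof.
move=> hy; apply: (@cont_itvM _ _ _ (fun x => F (G x y)) (Gx^~ y)); last exact: cGx.
apply: (@cont_itv_comp R C C A.1 A.2 (G^~ y) F) => x hx; first exact: cF.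
exact: rderiv_continuous (dGx hx hy).
Qed.

(** The integral of [F] over the boundary of a curvilinear rectangle vanishes. It
    is additive under bisection, and at a point where [F] is differentiable it is
    small compared with the square of the size, because the affine part of [F]
    contributes nothing. *)
Lemma goursat : V B A.2 - V B A.1 = H A B.2 - H A B.1.
Proof.
apply/eqP; rewrite -subr_eq0; apply/eqP; apply: (@bisection_eq0 R bd A B) => //.
- move=> X Y [X1 X12 X2] [Y1 Y12 Y2]; rewrite /bd /half /=.
  set m := (X.1 + X.2) / 2; have mX : X.1 <= m <= X.2 by rewrite /m; lra.
  have HE y : inB y -> H X y = H (X.1, m) y + H (m, X.2) y.
    move=> hy; have [m1 m2] := andP mX; apply: (cint_split m1 m2).
    exact: cont_itv_sub (cH hy).
  rewrite !HE; first by ring.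
    by rewrite /inB; lra.
  by rewrite /inB; lra.
- move=> X Y [X1 X12 X2] [Y1 Y12 Y2]; rewrite /bd /half /=.
  set m := (Y.1 + Y.2) / 2; have mY : Y.1 <= m <= Y.2 by rewrite /m; lra.
  have VE x : inA x -> V Y x = V (Y.1, m) x + V (m, Y.2) x.
    move=> hx; have [m1 m2] := andP mY; apply: (cint_split m1 m2).
    exact: cont_itv_sub (cV hx).
  rewrite !VE; first by ring.
    by rewrite /inA; lra.
  by rewrite /inA; lra.
move=> x0 y0 hx0 hy0 e e0.
have [d dP] := dF hx0 hy0.
have M0 : 0 <= M by rewrite (le_trans _ (GxM hx0 hy0))// cmod_ge0.
have K0 : 0 < 2 * (M + 1) ^+ 2 by rewrite mulr_gt0// exprn_gt0//; lra.
have [r r0 rP] := dP _ (divr_gt0 e0 K0).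
exists (r / (2 * (M + 1))); first by rewrite divr_gt0// mulr_gt0//; lra.
move=> X Y [X1 X12 X2] [Y1 Y12 Y2] xX yY; rewrite !ltr_pdivlMr; [|lra|lra] => Xd Yd.
set w := X.2 - X.1 in Xd *; set h := Y.2 - Y.1 in Yd *.
have w0 : 0 <= w by rewrite /w; lra.
have h0 : 0 <= h by rewrite /h; lra.
pose K := e / (2 * (M + 1) ^+ 2) * (M * (w + h)).
have close x y : X.1 <= x <= X.2 -> Y.1 <= y <= Y.2 ->
    cmod (F (G x y) - F (G x0 y0) - d * (G x y - G x0 y0)) <= K.
  move=> hx hy.
  have hxy : cmod (G x y - G x0 y0) <= M * (w + h).
    rewrite (le_trans (lipG _ _ _ _)) ?/inA ?/inB//; [lra|lra|].
    by rewrite ler_wpM2l// lerD// ler_norml /w /h; lra.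
  have := rP (G x y - G x0 y0); rewrite [G x0 y0 + _]addrC subrK => /(_ _)/le_trans; apply.
    by rewrite (le_lt_trans hxy)//; nra.
  by rewrite /K ler_wpM2l// ltW// divr_gt0.
have sx y : Y.1 <= y <= Y.2 -> cmod (H X y -
   (quad (F (G x0 y0)) d (G x0 y0) (G X.2 y) - quad (F (G x0 y0)) d (G x0 y0) (G X.1 y))) <= K * M * w.
  move=> hy; have hy' : inB y by rewrite /inB; lra.
  apply: (@side F (G^~ y) (Gx^~ y)) => //.
  + by move=> x hx; apply: dGx => //; rewrite /inA; lra.
  + exact: cont_itv_sub (cGx hy').
  + by move=> x hx; apply: cF => //; rewrite /inA; lra.
  + by move=> x hx; apply: GxM => //; rewrite /inA; lra.
  + by move=> x hx; exact: close.
have sy x : X.1 <= x <= X.2 -> cmod (V Y x -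
   (quad (F (G x0 y0)) d (G x0 y0) (G x Y.2) - quad (F (G x0 y0)) d (G x0 y0) (G x Y.1))) <= K * M * h.
  move=> hx; have hx' : inA x by rewrite /inA; lra.
  apply: (@side F (G x) (Gy x)) => //.
  + by move=> y hy; apply: dGy => //; rewrite /inB; lra.
  + exact: cont_itv_sub (cGy hx').
  + by move=> y hy; apply: cF => //; rewrite /inB; lra.
  + by move=> y hy; apply: GyM => //; rewrite /inB; lra.
  + by move=> y hy; exact: close.
have hX1 : X.1 <= X.1 <= X.2 by rewrite lexx.
have hX2 : X.1 <= X.2 <= X.2 by rewrite lexx andbT.
have hY1 : Y.1 <= Y.1 <= Y.2 by rewrite lexx.
have hY2 : Y.1 <= Y.2 <= Y.2 by rewrite lexx andbT.
set q := quad _ _ _ in sx sy.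
have -> : bd X Y = ((V Y X.2 - (q (G X.2 Y.2) - q (G X.2 Y.1))) -
   (V Y X.1 - (q (G X.1 Y.2) - q (G X.1 Y.1)))) -
   ((H X Y.2 - (q (G X.2 Y.2) - q (G X.1 Y.2))) -
   (H X Y.1 - (q (G X.2 Y.1) - q (G X.1 Y.1)))) by rewrite /bd; ring.
rewrite (le_trans (cmodB _ _))//.
apply: (@le_trans _ _ ((K * M * h + K * M * h) + (K * M * w + K * M * w))).
  by apply: lerD; rewrite (le_trans (cmodB _ _))// lerD// ?sx// ?sy.
have -> : K * M * h + K * M * h + (K * M * w + K * M * w) =
   e * (w + h) ^+ 2 * (M ^+ 2 / (M + 1) ^+ 2).
  by rewrite /K; field; rewrite gt_eqF//; lra.
apply: ler_piMr; first by rewrite mulr_ge0 ?sqr_ge0// ltW.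
have M10 : 0 < M + 1 by lra.
rewrite ler_pdivrMr ?exprn_gt0// mul1r ler_pXn2r ?nnegrE//; lra.
Qed.

End Goursat.

(** * Cauchy's formula and its consequences *)

Section Cauchy.
Variable R : realType.
Local Notation C := (Cplx R).
Local Notation mu := (@lebesgue_measure R).

Definition cderivable (f : C -> C) z := exists d, cderiv f z d.

Lemma cderivable_cst (a : C) z : cderivable (fun=> a) z.
Proof. by apply/cderivP. Qed.

Lemma cderivable_id z : cderivable id z.
Proof. by apply/cderivP. Qed.

Lemma cderivableD f g z : cderivable f z -> cderivable g z ->
  cderivable (fun w => f w + g w) z.
Proof. by move=> /cderivP df /cderivP dg; apply/cderivP; exact: differentiableD. Qed.

Lemma cderivableM f g z : cderivable f z -> cderivable g z ->
  cderivable (fun w => f w * g w) z.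
Proof. by move=> /cderivP df /cderivP dg; apply/cderivP; exact: differentiableM. Qed.

Lemma cderivableV f z : cderivable f z -> f z != 0 ->
  cderivable (fun w => (f w)^-1) z.
Proof.
move=> /cderivP/derivable1_diffP df f0; apply/cderivP/derivable1_diffP.
exact: derivableV.
Qed.

Lemma cderivable_comp f g z : cderivable f z -> cderivable g (f z) ->
  cderivable (fun w => g (f w)) z.
Proof.
move=> /cderivP df /cderivP dg; apply/cderivP; exact: (differentiable_comp df dg).
Qed.

Lemma cderivableX f z n : cderivable f z -> cderivable (fun w => f w ^+ n) z.
Proof.
move=> df; elim: n => [|n IH]; first exact: cderivable_cst.
have := cderivableM df IH; congr (cderivable _ _); apply/funext => w.
by rewrite exprS.
Qed.

Lemma cderivable_continuous f z : cderivable f z -> {for z, continuous f}.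
Proof. by move=> [d /cderiv_continuous]. Qed.

Lemma cderivable_near f g z : (\forall w \near z, f w = g w) ->
  cderivable f z -> cderivable g z.
Proof.
move=> fg [d df]; exists d => e e0; have [r r0 rP] := df e e0.
have [s s0 sP] := (@nbhs_cmodP R z _).1 fg.
exists (Num.min r s); rewrite ?lt_min ?r0// => h; rewrite lt_min => /andP[hr hs].
rewrite -!sP ?rP//; first by rewrite subrr cmod0.
by rewrite addrC addKr.
Qed.

Lemma small_eq0 (x : C) (K : R) : (forall e, 0 < e -> cmod x <= e * K) -> x = 0.
Proof.
move=> h; apply/eqP; rewrite -cmod_eq0 eq_le cmod_ge0 andbT.
apply/ler_addgt0Pr => e e0; rewrite add0r.
have K1 : 0 < `|K| + 1 by rewrite ltr_wpDl.
have := h (e / (`|K| + 1)); rewrite divr_gt0// => /(_ isT)/le_trans; apply.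
rewrite mulrAC ler_pdivrMr// ler_wpM2l ?ltW//.
by rewrite (le_lt_trans (ler_norm _))// ltrDl.
Qed.

Lemma twopi_gt0 : 0 < 2 * pi :> R.
Proof. by rewrite mulr_gt0// pi_gt0. Qed.

Definition circ (c : C) (r t : R) : C := c + r%:C%C * cis t.

Lemma continuous_circ c r : continuous (circ c r).
Proof.
move=> t; apply: (@continuousD _ _ _ (fun=> c) (fun t => r%:C%C * cis t)).
  exact: cst_continuous.
apply: (@continuousM _ _ (fun=> r%:C%C) (@cis R)); first exact: cst_continuous.
exact: continuous_cis.
Qed.

Lemma cont_contract (c : C) (r : R) (z : C) (x a b : R) :
  cont_itv a b (fun t => z + x%:C%C * (circ c r t - z)).
Proof.
have cc : cont_itv a b (circ c r) by move=> t _; exact: continuous_circ.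
have cz := @cont_itv_cst R C a b z.
exact: (cont_itvD cz (cont_itvZ (c := x%:C%C) (cont_itvB cc cz))).
Qed.

Lemma cmod_circ c r t : 0 <= r -> cmod (circ c r t - c) = r.
Proof. by move=> r0; rewrite /circ addrC addKr cmodM cmod_real cmod_cis mulr1 ger0_norm. Qed.

Lemma circ2pi c r : circ c r (2 * pi) = circ c r 0.
Proof. by rewrite /circ cis2pi cis0. Qed.

Lemma circ_neq (c : C) (r t : R) (z : C) : 0 <= r -> cmod (z - c) < r -> circ c r t - z != 0.
Proof.
move=> r0 zr; rewrite -cmod_gt0.
have : cmod (circ c r t - c) <= cmod (circ c r t - z) + cmod (z - c).
  by apply: le_trans (cmodD _ _); rewrite addrA subrK.
by rewrite cmod_circ//; lra.
Qed.

Lemma cmod_cisB (x y : R) : cmod (cis x - cis y) <= `|x - y|.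
Proof.
wlog yx : x y / y <= x.
  move=> h; have [/h//|/ltW xy] := leP y x.
  by rewrite cmodBC distrC; exact: h.
rewrite ger0_norm ?subr_ge0//.
have cc : cont_itv y x (fun t => 'i * cis t : C).
  by apply: (@cont_itvZ R y x 'i (@cis R)) => t _; exact: continuous_cis.
rewrite -(cint_FTC yx (fun t _ => rderiv_cis t) cc).
rewrite (le_trans (@cmod_cint_le R y x 1 _ yx cc _)) ?mul1r// => t _.
by rewrite cmodM cmod_cis mulr1 /cmod /= expr0n expr1n add0r sqrtr1.
Qed.

(** The form [ds / (s - z)] on the circle, divided by [i] so that the kernel of
    the centre is [1]. *)
Definition kern (c : C) (r : R) (z : C) (t : R) : C :=
  (r%:C%C * cis t) / (circ c r t - z).

Lemma cont_kern c r z a b : 0 <= r -> cmod (z - c) < r -> cont_itv a b (kern c r z).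
Proof.
move=> r0 zr; apply: cont_itvM.
  by apply: (@cont_itvZ R a b _ (@cis R)) => t _; exact: continuous_cis.
apply: (@cont_itvV R a b (fun t => circ c r t - z)).
  by apply: (cont_itvB _ (@cont_itv_cst R C a b z)) => t _; exact: continuous_circ.
by move=> t _; exact: circ_neq.
Qed.

Lemma kern_center c r t : 0 < r -> kern c r c t = 1.
Proof.
move=> r0; rewrite /kern /circ addrC addKr divff// -cmod_gt0.
by rewrite cmodM cmod_real cmod_cis mulr1 normr_gt0 gt_eqF.
Qed.

Lemma cmod_kern_le c r z t : 0 < r -> cmod (z - c) < r ->
  cmod (kern c r z t) <= r / (r - cmod (z - c)).
Proof.
move=> r0 zr; rewrite /kern cmodM cmodV cmodM cmod_real cmod_cis mulr1 gtr0_norm//.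
rewrite ler_pM2l// lef_pV2 ?posrE ?subr_gt0//; last by rewrite cmod_gt0 circ_neq// ltW.
have : cmod (circ c r t - c) <= cmod (circ c r t - z) + cmod (z - c).
  by apply: le_trans (cmodD _ _); rewrite addrA subrK.
by rewrite cmod_circ ?(ltW r0)//; lra.
Qed.

Lemma i_neq0 : ('i : C) != 0.
Proof. by rewrite eq_complex /= oner_eq0 andbF. Qed.

(** Contracting the circle to [z] does not change the integral: this is [goursat]
    for the rectangle of contraction ratios and angles, whose two sides at the
    angles [0] and [2 * pi] agree. *)
Lemma cauchy_homotopy (p : C -> C) (c : C) (r : R) (z : C) (x : R) : 0 < r ->
  cmod (z - c) < r ->
  (forall w, cmod (w - c) <= r -> cderivable p w) -> 0 < x -> x <= 1 ->
  cint 0 (2 * pi) (fun t => p (z + x%:C%C * (circ c r t - z)) * kern c r z t) =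
  cint 0 (2 * pi) (fun t => p (circ c r t) * kern c r z t).
Proof.
move=> r0 zr dp x0 x1.
pose G x y : C := z + x%:C%C * (circ c r y - z).
pose Gx (x y : R) : C := circ c r y - z.
pose Gy (x y : R) : C := x%:C%C * (r%:C%C * ('i * cis y)).
pose F w := p w / (w - z).
have pi2 : 0 <= 2 * pi :> R by rewrite ltW// twopi_gt0.
have dcirc y : rderiv (fun y => circ c r y - z) y (r%:C%C * ('i * cis y)).
  have := rderivD (rderivD (rderiv_cst c y) (rderivM (rderiv_cst r%:C%C y) (rderiv_cis y)))
     (rderiv_cst (- z) y).
  by rewrite mul0r !add0r addr0.
have ccirc a b : cont_itv a b (fun y => circ c r y - z).
  by move=> y _; exact: rderiv_continuous (dcirc y).
have cGy x' a b : cont_itv a b (Gy x').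
  apply: (@cont_itvZ R a b x'%:C%C (fun y => r%:C%C * ('i * cis y))).
  apply: (@cont_itvZ R a b r%:C%C (fun y => 'i * cis y)).
  by apply: (@cont_itvZ R a b 'i (@cis R)) => y _; exact: continuous_cis.
have Gin x' y : 0 <= x' <= 1 -> cmod (G x' y - c) <= r.
  move=> /andP[x'0 x'1]; have -> : G x' y - c = (1 - x')%:C%C * (z - c) + x'%:C%C * (circ c r y - c).
    by rewrite /G rmorphB rmorph1; ring.
  rewrite (le_trans (cmodD _ _))// !cmodM !cmod_real cmod_circ ?(ltW r0)//.
  rewrite (ger0_norm x'0) ger0_norm ?subr_ge0//.
  have : (1 - x') * cmod (z - c) <= (1 - x') * r by rewrite ler_wpM2l ?subr_ge0// ltW.
  lra.
have circM y : cmod (circ c r y - z) <= 2 * r.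
  have -> : circ c r y - z = (circ c r y - c) - (z - c) by ring.
  by rewrite (le_trans (cmodB _ _))// cmod_circ ?(ltW r0)//; lra.
have i1 : cmod ('i : C) = 1 by rewrite /cmod /= expr0n expr1n add0r sqrtr1.
have GyE x' y : cmod (Gy x' y) = `|x'| * r.
  by rewrite !cmodM !cmod_real i1 cmod_cis !mulr1 (gtr0_norm r0).
have := @goursat R G Gx Gy F (x, 1) (0, 2 * pi) (2 * r) x1 pi2.
have h1 : forall x0 y : R, (x, 1 : R).1 <= x0 <= (x, 1 : R).2 ->
      (0 : R, 2 * pi : R).1 <= y <= (0 : R, 2 * pi : R).2 -> rderiv (G^~ y) x0 (Gx x0 y).
  move=> x' y _ _.
  have := rderivD (rderiv_cst z x') (rderivM (rderiv_real x') (rderiv_cst (circ c r y - z) x')).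
  by rewrite mul1r mulr0 addr0 add0r.
move=> /(_ h1) {h1}.
have h2 : forall x0 y : R, (x, 1 : R).1 <= x0 <= (x, 1 : R).2 ->
      (0 : R, 2 * pi : R).1 <= y <= (0 : R, 2 * pi : R).2 -> rderiv (G x0) y (Gy x0 y).
  move=> x' y _ _.
  have := rderivD (rderiv_cst z y) (rderivM (rderiv_cst x'%:C%C y) (dcirc y)).
  by rewrite mul0r !add0r.
move=> /(_ h2) {h2}.
have h3 : forall y : R, (0 : R, 2 * pi : R).1 <= y <= (0 : R, 2 * pi : R).2 ->
    cont_itv (x, 1 : R).1 (x, 1 : R).2 (Gx^~ y).
  by move=> y _; exact: (@cont_itv_cst R C).
move=> /(_ h3) {h3}.
move=> /(_ (fun x' _ => cGy x' 0 (2 * pi))).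
have h4 : forall x0 y : R, (x, 1 : R).1 <= x0 <= (x, 1 : R).2 ->
      (0 : R, 2 * pi : R).1 <= y <= (0 : R, 2 * pi : R).2 -> cmod (Gx x0 y) <= 2 * r.
  by move=> x' y _ _; exact: circM.
move=> /(_ h4) {h4}.
have h5 : forall x0 y : R, (x, 1 : R).1 <= x0 <= (x, 1 : R).2 ->
      (0 : R, 2 * pi : R).1 <= y <= (0 : R, 2 * pi : R).2 -> cmod (Gy x0 y) <= 2 * r.
  move=> x' y /andP[xx' x'1] _; rewrite GyE; move: xx' x'1 => /= xx' x'1.
  rewrite ger0_norm ?(le_trans (ltW x0) xx')//.
  by have : x' * r <= 1 * r by [rewrite ler_pM2r|]; lra.
move=> /(_ h5) {h5}.
have h6 : forall x0 y x' y' : R, (x, 1 : R).1 <= x0 <= (x, 1 : R).2 ->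
   (0 : R, 2 * pi : R).1 <= y <= (0 : R, 2 * pi : R).2 -> (x, 1 : R).1 <= x' <= (x, 1 : R).2 ->
   (0 : R, 2 * pi : R).1 <= y' <= (0 : R, 2 * pi : R).2 ->
   cmod (G x0 y - G x' y') <= 2 * r * (`|x0 - x'| + `|y - y'|).
  move=> x1' y x' y' /= _ _ /andP[xx' x'1] _.
  have -> : G x1' y - G x' y' = (x1' - x')%:C%C * (circ c r y - z) +
     x'%:C%C * (r%:C%C * (cis y - cis y')).
    by rewrite /G /circ rmorphB; ring.
  rewrite (le_trans (cmodD _ _))// !cmodM !cmod_real mulrDr lerD//.
    by rewrite mulrC ler_wpM2r// circM.
  rewrite (gtr0_norm r0) (ger0_norm (le_trans (ltW x0) xx')) mulrA ler_pM ?cmod_ge0 ?cmod_cisB//.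
    by rewrite mulr_ge0// ?ltW// (lt_le_trans x0).
  by rewrite ler_pM2r// (le_trans x'1)// ler1n.
move=> /(_ h6) {h6}.
have G0 x' y : 0 < x' -> G x' y - z != 0.
  move=> x'0; rewrite /G addrC addKr mulf_neq0//; last by rewrite circ_neq// ltW.
  by rewrite -cmod_gt0 cmod_real normr_gt0 gt_eqF.
have h7 : forall x0 y : R, (x, 1 : R).1 <= x0 <= (x, 1 : R).2 ->
   (0 : R, 2 * pi : R).1 <= y <= (0 : R, 2 * pi : R).2 -> exists d, cderiv F (G x0 y) d.
  move=> x' y /= /andP[xx' x'1] _.
  apply: cderivableM.
    by apply: dp; rewrite Gin// x'1 (le_trans _ xx')// ltW.
  apply: (@cderivableV (fun w => w - z)); last by apply: G0; exact: lt_le_trans xx'.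
  by apply: cderivableD; [exact: cderivable_id|exact: cderivable_cst].
move=> /(_ h7) {h7} /=.
have -> : cint x 1 (fun x0 : R => F (G x0 (2 * pi)) * Gx x0 (2 * pi)) =
          cint x 1 (fun x0 : R => F (G x0 0) * Gx x0 0).
  by apply: eq_cint => x' _; rewrite /G /Gx circ2pi.
rewrite subrr => /eqP; rewrite subr_eq0 => /eqP GE.
have VE x' : 0 < x' <= 1 -> cint 0 (2 * pi) (fun y => F (G x' y) * Gy x' y) =
   'i * cint 0 (2 * pi) (fun y => p (G x' y) * kern c r z y).
  move=> /andP[x'0 x'1].
  rewrite -cintZ; last first.
    suff cp : cont_itv 0 (2 * pi) (fun y => p (G x' y)).
      exact: (cont_itvM cp (@cont_kern c r z 0 (2 * pi) (ltW r0) zr)).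
    apply: (@cont_itv_comp R C C _ _ (G x') p) => y _.
      by apply: cderivable_continuous; apply: dp; rewrite Gin// ltW.
    by apply: (@cont_contract c r z x' y y) => //; rewrite lexx.
  apply: eq_cint => y _; have := G0 x' y x'0.
  rewrite /F /G /Gy /kern addrC addKr => /[dup] + h.
  rewrite mulf_eq0 negb_or => /andP[h1 h2].
  by field; rewrite h1 h2.
move: GE; rewrite !VE ?x0//; last by rewrite ltr01 lexx.
move=> /(mulfI i_neq0) <-; apply: eq_cint => t _.
by rewrite /G rmorph1 mul1r addrC subrK.
Qed.

(** In the contracted integrals [p] tends uniformly to [p z]; what remains is the
    integral of the kernel, which is kept as a factor. *)
Lemma cauchy_formula (p : C -> C) (c : C) (r : R) (z : C) : 0 < r ->
  cmod (z - c) < r -> (forall w, cmod (w - c) <= r -> cderivable p w) ->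
  p z * cint 0 (2 * pi) (kern c r z) =
  cint 0 (2 * pi) (fun t => p (circ c r t) * kern c r z t).
Proof.
move=> r0 zr dp; have pi2 : 0 <= 2 * pi :> R by rewrite ltW// twopi_gt0.
have ck := @cont_kern c r z 0 (2 * pi) (ltW r0) zr.
pose K := r / (r - cmod (z - c)).
have K0 : 0 <= K by rewrite divr_ge0 ?ltW// subr_gt0.
apply/eqP; rewrite -subr_eq0; apply/eqP; apply: (@small_eq0 _ (K * (2 * pi))) => e e0.
have cpz : {for z, continuous p} by apply: cderivable_continuous; apply: dp; exact: ltW.
have [d d0 dP] := (@nbhs_cmodP R z _).1 ((@cvg_cmodP R _ _ _ p (p z)).1 cpz e e0).
have rr : 0 < 2 * r by lra.
pose x := Num.min 1 (d / (2 * (2 * r))).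
have x0 : 0 < x by rewrite lt_min ltr01 divr_gt0//; lra.
have x1 : x <= 1 by rewrite ge_min lexx.
have xd : x * (2 * r) < d.
  have : x <= d / (2 * (2 * r)) by rewrite ge_min lexx orbT.
  by rewrite ler_pdivlMr; [nra|lra].
rewrite -(cauchy_homotopy r0 zr dp x0 x1) -cintZ//.
have near t : cmod (z + x%:C%C * (circ c r t - z) - z) < d.
  rewrite addrC addKr cmodM cmod_real gtr0_norm// (le_lt_trans _ xd)// ler_pM2l//.
  have -> : circ c r t - z = (circ c r t - c) - (z - c) by ring.
  by rewrite (le_trans (cmodB _ _))// cmod_circ ?(ltW r0)//; lra.
have inr t : cmod (z + x%:C%C * (circ c r t - z) - c) <= r.
  have -> : z + x%:C%C * (circ c r t - z) - c = (1 - x)%:C%C * (z - c) + x%:C%C * (circ c r t - c).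
    by rewrite rmorphB rmorph1; ring.
  rewrite (le_trans (cmodD _ _))// !cmodM !cmod_real cmod_circ ?(ltW r0)//.
  rewrite (gtr0_norm x0) ger0_norm ?subr_ge0//.
  have : (1 - x) * cmod (z - c) <= (1 - x) * r by rewrite ler_wpM2l ?subr_ge0// ltW.
  lra.
have cp : cont_itv 0 (2 * pi) (fun t => p (z + x%:C%C * (circ c r t - z)) * kern c r z t).
  suff cp : cont_itv 0 (2 * pi) (fun t => p (z + x%:C%C * (circ c r t - z))).
    exact: (cont_itvM cp ck).
  apply: (@cont_itv_comp R C C _ _ (fun t => z + x%:C%C * (circ c r t - z)) p) => t _.
    by apply: cderivable_continuous; apply: dp; exact: inr.
  by apply: (@cont_contract c r z x t t) => //; rewrite lexx.
have cz := cont_itvZ (c := p z) ck.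
rewrite -(cintB cz cp).
apply: (@le_trans _ _ (e * K * (2 * pi - 0))); last by rewrite subr0 !mulrA.
apply: (cmod_cint_le pi2 (cont_itvB cz cp)) => t _.
rewrite -mulrBl cmodM ler_pM ?cmod_ge0//; last exact: cmod_kern_le.
by rewrite cmodBC ltW// dP.
Qed.

Lemma mean_value (p : C -> C) (c : C) (r : R) : 0 < r ->
  (forall w, cmod (w - c) <= r -> cderivable p w) ->
  cint 0 (2 * pi) (fun t => p (circ c r t)) = p c * (2 * pi)%:C%C.
Proof.
move=> r0 dp; have cc : cmod (c - c) < r by rewrite subrr cmod0.
have := cauchy_formula r0 cc dp.
rewrite (_ : cint _ _ (kern c r c) = (2 * pi)%:C%C); last first.
  rewrite (@eq_cint R _ _ (kern c r c) (fun=> 1)); last first.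
    by move=> t _; exact: kern_center.
  by rewrite cint_cst ?subr0 ?mulr1 ?ltW ?twopi_gt0.
by move=> ->; apply: eq_cint => t _; rewrite kern_center// mulr1.
Qed.

(** Differentiation under the integral sign, for a quadratic remainder that is
    uniform in the parameter. *)
Lemma cderiv_cint (a b : R) (f : R -> C -> C) (df : R -> C) (z : C) (K d : R) :
  a <= b -> 0 < d -> (forall w, cmod (w - z) < d -> cont_itv a b (f^~ w)) ->
  cont_itv a b df ->
  (forall t h, a <= t <= b -> cmod h < d ->
    cmod (f t (z + h) - f t z - df t * h) <= K * cmod h ^+ 2) ->
  cderiv (fun w => cint a b (f^~ w)) z (cint a b df).
Proof.
move=> ab d0 cf cdf fK e e0.
pose B := (`|K| + 1) * (b - a + 1).
have ba : 0 < b - a + 1 by lra.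
have B0 : 0 < B by rewrite mulr_gt0// ltr_wpDl.
exists (Num.min d (e / B)); first by rewrite lt_min d0 divr_gt0.
move=> h; rewrite lt_min => /andP[hd he].
have cz : cont_itv a b (f^~ z) by apply: cf; rewrite subrr cmod0.
have czh : cont_itv a b (f^~ (z + h)) by apply: cf; rewrite addrC addKr.
have cdh := cont_itvZ (c := h) cdf.
rewrite (mulrC (cint _ _ _)) -(cintB czh cz) -(cintZ _ cdf).
have cB := cont_itvB czh cz.
rewrite -(cintB cB cdh).
have K1 : K <= `|K| + 1 by rewrite (le_trans (ler_norm _))// lerDl.
apply: (@le_trans _ _ ((`|K| + 1) * cmod h ^+ 2 * (b - a))).
  apply: (cmod_cint_le ab (cont_itvB cB cdh)) => t tab.
  by rewrite (mulrC h) (le_trans (fK _ _ tab hd))// ler_wpM2r// sqr_ge0.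
have hB : cmod h * B <= e by rewrite -ler_pdivlMr// ltW.
have h0 := cmod_ge0 h.
apply: (@le_trans _ _ (cmod h * B * cmod h)); last by rewrite ler_wpM2r.
rewrite /B expr2 -!mulrA; set k := `|K| + 1.
have k0 : 0 <= k by rewrite /k addr_ge0.
have -> : k * (cmod h * (cmod h * (b - a))) = (cmod h * (k * cmod h)) * (b - a) by ring.
have -> : cmod h * (k * ((b - a + 1) * cmod h)) = (cmod h * (k * cmod h)) * (b - a + 1) by ring.
by rewrite ler_wpM2l ?mulr_ge0// lerDl.
Qed.

(** The Cauchy integral depends differentiably on [z]; so does the integral of
    the kernel alone, which is nonzero at the centre and can be divided out. *)
Lemma cauchy_integral_cderivable (f : C -> C) (c : C) (r s : R) : 0 < r -> 0 < s -> s <= r ->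
  cont_itv 0 (2 * pi) (fun t => f (circ c r t)) ->
  (forall z, cmod (z - c) < s -> f z * cint 0 (2 * pi) (kern c r z) =
    cint 0 (2 * pi) (fun t => f (circ c r t) * kern c r z t)) ->
  cderivable f c.
Proof.
move=> r0 s0 sr cf fE.
have pi2 : 0 <= 2 * pi :> R by rewrite ltW// twopi_gt0.
have ccis a b : cont_itv a b (fun t => r%:C%C * cis t : C).
  by apply: (@cont_itvZ R a b r%:C%C (@cis R)) => t _; exact: continuous_cis.
have u0 t : r%:C%C * cis t != 0 :> C.
  by rewrite -cmod_gt0 cmodM cmod_cis mulr1 cmod_real normr_gt0 gt_eqF.
have um t : cmod (r%:C%C * cis t : C) = r by rewrite cmodM cmod_cis mulr1 cmod_real gtr0_norm.
suff der (g : R -> C) : cont_itv 0 (2 * pi) g ->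
    cderivable (fun z => cint 0 (2 * pi) (fun t => g t * kern c r z t)) c.
  have k0 : cint 0 (2 * pi) (fun t => 1 * kern c r c t) != 0.
    rewrite (@eq_cint R _ _ _ (fun=> 1)); last first.
      by move=> t _; rewrite kern_center// mulr1.
    by rewrite cint_cst// subr0 mulr1 -cmod_gt0 cmod_real normr_gt0 gt_eqF// twopi_gt0.
  have d1 := der _ (@cont_itv_cst R C 0 (2 * pi) 1).
  apply: cderivable_near (cderivableM (der _ cf) (cderivableV d1 k0)).
  have cs : cmod (c - c) < s by rewrite subrr cmod0.
  have k1 : \forall w \near c, cint 0 (2 * pi) (fun t => 1 * kern c r w t) != 0.
    have := (@cvg_cmodP R _ _ _ _ _).1 (cderivable_continuous d1).
    rewrite -cmod_gt0 in k0; move=> /(_ _ _ k0); apply: filterS => w.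
    apply: contraTneq => ->; rewrite sub0r cmodN -leNgt//.
  have sc : \forall w \near c, cmod (w - c) < s by apply/nbhs_cmodP; exists s.
  apply: filterS2 k1 sc => w k1 /fE h; rewrite -h.
  rewrite (@eq_cint R _ _ (fun t => 1 * kern c r w t) (kern c r w)) in k1 *.
    by rewrite mulfK.
  by move=> t _; rewrite mul1r.
move=> cg; have [N NP] : exists N, forall t, 0 <= t <= 2 * pi -> cmod (g t) <= N.
  have := @EVT_max R (fun t => cmod (g t)) 0 (2 * pi) pi2.
  move=> /(_ (cont_itv_within (cont_itv_cmod cg)))[x _ xP].
  by exists (cmod (g x)) => t t2; apply: xP; rewrite in_itv.
exists (cint 0 (2 * pi) (fun t => g t * (r%:C%C * cis t)^-1)).
apply: (@cderiv_cint 0 (2 * pi) (fun t z => g t * kern c r z t)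
  (fun t => g t * (r%:C%C * cis t)^-1) c (`|N| * (2 / r ^+ 2)) (r / 2)).
- exact: pi2.
- by rewrite divr_gt0.
- move=> w wr; apply: (cont_itvM cg); apply: cont_kern; first exact: ltW.
  by rewrite (lt_trans wr)//; lra.
- exact: (cont_itvM cg (cont_itvV (ccis _ _) (fun t _ => u0 t))).
move=> t h /NP gN hr.
have hu : cmod (r%:C%C * cis t - h) >= r / 2.
  by have := ler_cmodD_dist (r%:C%C * cis t) h; rewrite um; lra.
have h0 : r%:C%C * cis t - h != 0 by rewrite -cmod_gt0 (lt_le_trans _ hu)// divr_gt0.
have -> : g t * kern c r (c + h) t - g t * kern c r c t - g t * (r%:C%C * cis t)^-1 * h =
   g t * (h ^+ 2 / (r%:C%C * cis t * (r%:C%C * cis t - h))).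
  rewrite kern_center// /kern /circ.
  have -> : c + r%:C%C * cis t - (c + h) = r%:C%C * cis t - h by ring.
  have := u0 t; set u := _ * _ => ut; field.
  by rewrite ut h0.
rewrite [cmod (g t * _)]cmodM [cmod (_ / _)]cmodM cmodV cmodX [cmod (_ * (_ - h))]cmodM um.
rewrite -(mulrA `|N|) ler_pM ?cmod_ge0//.
- by rewrite mulr_ge0 ?exprn_ge0 ?cmod_ge0// invr_ge0 mulr_ge0 ?cmod_ge0// ltW.
- exact: le_trans (ler_norm _).
rewrite mulrC ler_wpM2r ?exprn_ge0 ?cmod_ge0//.
have -> : 2 / r ^+ 2 = (r * (r / 2))^-1 by field; rewrite gt_eqF.
by rewrite lef_pV2 ?posrE ?mulr_gt0 ?cmod_gt0// ?divr_gt0// ler_pM2l.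
Qed.

(** The principal logarithm on the right half plane: the integral of [1 / w]
    along the segment from [1]. *)
Definition clog (w : C) : C :=
  cint 0 1 (fun t => (w - 1) / (1 + t%:C%C * (w - 1))).

Lemma Re_seg (w : C) (t : R) : 0 < complex.Re w -> 0 <= t <= 1 ->
  Num.min 1 (complex.Re w) <= cmod (1 + t%:C%C * (w - 1)).
Proof.
move=> w0 /andP[t0 t1]; apply: le_trans (ler_Re_cmod _); apply: le_trans (ler_norm _).
have -> : complex.Re (1 + t%:C%C * (w - 1)) = (1 - t) * 1 + t * complex.Re w.
  by case: w w0 => x y /= _; ring.
have : Num.min 1 (complex.Re w) <= 1 by rewrite ge_min lexx.
have : Num.min 1 (complex.Re w) <= complex.Re w by rewrite ge_min lexx orbT.
set m := Num.min _ _ => h1 h2.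
have -> : m = (1 - t) * m + t * m by ring.
by rewrite lerD// ler_wpM2l// subr_ge0.
Qed.

Lemma seg_neq0 (w : C) (t : R) : 0 < complex.Re w -> 0 <= t <= 1 -> 1 + t%:C%C * (w - 1) != 0.
Proof.
move=> w0 t1; rewrite -cmod_gt0 (lt_le_trans _ (Re_seg w0 t1))//.
by rewrite lt_min ltr01.
Qed.

Lemma cont_seg (w : C) : cont_itv 0 1 (fun t => 1 + t%:C%C * (w - 1) : C).
Proof.
have ct : cont_itv 0 1 (fun t : R => t%:C%C : C) by move=> t _; exact: continuous_real_complex.
exact: (cont_itvD (@cont_itv_cst R C 0 1 1) (cont_itvM ct (@cont_itv_cst R C 0 1 (w - 1)))).
Qed.

Lemma cont_clog (w : C) : 0 < complex.Re w ->
  cont_itv 0 1 (fun t => (w - 1) / (1 + t%:C%C * (w - 1))).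
Proof.
move=> w0; exact: (cont_itvZ (c := w - 1) (cont_itvV (@cont_seg w) (fun t => seg_neq0 w0))).
Qed.

Lemma Re_div (u v : C) : complex.Re (u / v) =
  (complex.Re u * complex.Re v + complex.Im u * complex.Im v) / cmod v ^+ 2.
Proof. by rewrite cmod_sqr; case: u v => a b [x y] /=; ring. Qed.

Lemma clog1 : clog 1 = 0.
Proof.
rewrite /clog (@eq_cint R _ _ _ (fun=> 0)); first by rewrite cint_cst// mulr0.
by move=> t _; rewrite subrr mul0r.
Qed.

Lemma Re_clog (w : C) : 0 < complex.Re w -> complex.Re (clog w) = ln (cmod w).
Proof.
move=> w0; have cw := cont_itv_Re (cont_clog w0).
pose n (t : R) := (1 + t * (complex.Re w - 1)) ^+ 2 + (t * complex.Im w) ^+ 2.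
have nE t : n t = cmod (1 + t%:C%C * (w - 1)) ^+ 2.
  by rewrite cmod_sqr /n; case: (w) => x y /=; congr (_ ^+ 2 + _ ^+ 2); ring.
have n0 t : 0 <= t <= 1 -> 0 < n t by move=> t1; rewrite nE exprn_gt0// cmod_gt0 seg_neq0.
rewrite /clog /= (@rint_FTC R 0 1 (fun t => 2^-1 * ln (n t)) _ _ _ cw)//.
  rewrite !nE !mul1r !mul0r addr0 cmod1 expr1n ln1 mulr0 subr0.
  rewrite [1 + _]addrC subrK expr2 lnM ?posrE; last 2 first.
    by rewrite cmod_gt0; apply: contraTneq w0 => ->; rewrite ltxx.
    by rewrite cmod_gt0; apply: contraTneq w0 => ->; rewrite ltxx.
  by field.
move=> t t1; have nt := n0 t t1.
have dn : is_derive t 1 n (2 * (1 + t * (complex.Re w - 1)) * (complex.Re w - 1) +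
     2 * (t * complex.Im w) * complex.Im w).
  rewrite /n; apply: is_derive_eq; rewrite /GRing.scale /=; ring.
have dl := is_derive1_ln nt.
have d2 : is_derive (n t) 1 (fun x => 2^-1 * ln x) (2^-1 * (n t)^-1).
  by apply: is_derive_eq; rewrite /GRing.scale/=; ring.
have dc := is_derive1_comp d2 dn.
rewrite (_ : complex.Re _ = 2^-1 * (n t)^-1 * (2 * (1 + t * (complex.Re w - 1)) * (complex.Re w - 1) +
     2 * (t * complex.Im w) * complex.Im w)); first exact: dc.
rewrite Re_div -nE.
have -> : complex.Re (1 + t%:C%C * (w - 1)) = 1 + t * (complex.Re w - 1).
  by case: (w) => x y /=; ring.
have -> : complex.Im (1 + t%:C%C * (w - 1)) = t * complex.Im w.
  by case: (w) => x y /=; ring.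
have -> : complex.Re (w - 1) = complex.Re w - 1 by case: (w).
have -> : complex.Im (w - 1) = complex.Im w by case: (w) => x y /=; rewrite subr0.
by field; rewrite gt_eqF.
Qed.

Lemma clog_cderivable (w : C) : 0 < complex.Re w -> cderivable clog w.
Proof.
move=> w0; set m := Num.min 1 (complex.Re w).
have m0 : 0 < m by rewrite lt_min ltr01.
have cseg := @cont_seg w.
have cs2 := cont_itvM cseg cseg.
have s20 t : 0 <= t <= 1 -> (1 + t%:C%C * (w - 1)) * (1 + t%:C%C * (w - 1)) != 0.
  by move=> t1; rewrite mulf_neq0// seg_neq0.
exists (cint 0 1 (fun t => ((1 + t%:C%C * (w - 1)) * (1 + t%:C%C * (w - 1)))^-1)).
apply: (@cderiv_cint 0 1 (fun t w => (w - 1) / (1 + t%:C%C * (w - 1))) _ w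
   (2 / m ^+ 3) (m / 2)).
- exact: ler01.
- by rewrite divr_gt0.
- move=> v vw; apply: cont_clog.
  have := ler_Re_cmod (w - v); rewrite raddfB /= => /(le_trans (ler_norm _)).
  rewrite cmodBC; have : m <= complex.Re w by rewrite ge_min lexx orbT.
  lra.
- exact: (cont_itvV cs2 s20).
move=> t h t1 hm; have [t0 t1'] := andP t1.
set D := 1 + t%:C%C * (w - 1); have D0 : D != 0 by exact: seg_neq0.
have Dm : m <= cmod D by exact: Re_seg.
have EE : w + h - 1 = w - 1 + h by ring.
have hD : m / 2 <= cmod (D + t%:C%C * h).
  have : cmod D - cmod (- (t%:C%C * h)) <= cmod (D + t%:C%C * h).
    by have := ler_cmodD_dist D (- (t%:C%C * h)); rewrite opprK.
  have : t * cmod h <= 1 * cmod h by rewrite ler_wpM2r// cmod_ge0.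
  rewrite cmodN cmodM cmod_real ger0_norm//; lra.
have hD0 : D + t%:C%C * h != 0 by rewrite -cmod_gt0 (lt_le_trans _ hD)// divr_gt0.
rewrite EE (_ : 1 + t%:C%C * (w - 1 + h) = D + t%:C%C * h); last by rewrite /D; ring.
have -> : (w - 1 + h) / (D + t%:C%C * h) - (w - 1) / D - (D * D)^-1 * h =
   - (t%:C%C * h ^+ 2 / (D * D * (D + t%:C%C * h))).
  have Dw : t%:C%C * (w - 1) = D - 1 by rewrite /D; ring.
  have -> : (w - 1 + h) / (D + t%:C%C * h) - (w - 1) / D =
     (h * (D - t%:C%C * (w - 1))) / (D * (D + t%:C%C * h)).
    by field; rewrite D0 hD0.
  by rewrite Dw; field; rewrite D0 hD0.
rewrite cmodN [cmod (_ / _)]cmodM cmodV [cmod (t%:C%C * _)]cmodM cmodX.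
rewrite [cmod (D * D * _)]cmodM [cmod (D * D)]cmodM cmod_real ger0_norm//.
have h2 := exprn_ge0 2 (cmod_ge0 h).
have DD : m * m * (m / 2) <= cmod D * cmod D * cmod (D + t%:C%C * h).
  by rewrite !ler_pM// ?mulr_ge0// ltW// divr_gt0.
have mm : 0 < m * m * (m / 2) by rewrite !mulr_gt0// invr_gt0.
have -> : 2 / m ^+ 3 = (m * m * (m / 2))^-1 by field; rewrite gt_eqF.
rewrite mulrC ler_pM ?mulr_ge0 ?invr_ge0 ?cmod_ge0//.
  by rewrite !mulr_ge0 ?cmod_ge0.
  by rewrite lef_pV2// posrE (lt_le_trans mm).
by rewrite -[leRHS]mul1r ler_wpM2r.
Qed.

Lemma rint_eq0 (f : R -> R) (b : R) : 0 < b -> cont_itv 0 b f ->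
  (forall t, 0 <= t <= b -> 0 <= f t) -> \int[mu]_(x in `[0, b]) f x <= 0 -> f 0 = 0.
Proof.
move=> b0 cf f0 If; have b00 : 0 <= (0 : R) <= b by rewrite lexx ltW.
apply/eqP; rewrite eq_le f0// andbT leNgt; apply/negP => f00.
have f2 : 0 < f 0 / 2 by rewrite divr_gt0.
have [d /= d0 dP] := (nbhs_ballP _ _).1 ((@cvgrPdist_lt _ _ _ _ _ f (f 0)).1 (cf 0 b00) _ f2).
pose e := Num.min (d / 2) b.
have e0 : 0 < e by rewrite lt_min b0 divr_gt0.
have eb : e <= b by rewrite ge_min lexx orbT.
have ed : e < d by rewrite gt_min ltr_pdivrMr// ltr_pMr// ltr1n.
move: If; rewrite (rint_split (ltW e0) eb cf); apply/negP; rewrite -ltNge.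
apply: ltr_pwDl; last first.
  by apply: Rintegral_ge0 => x /=; rewrite in_itv/= => /andP[ex xb]; apply: f0; lra.
apply: (@lt_le_trans _ _ (f 0 / 2 * (e - 0))); first by rewrite subr0 mulr_gt0.
rewrite -(@rint_cst R 0 e _ (ltW e0)); apply: le_rint.
- exact: (@cont_itv_cst R R).
- exact: cont_itv_sub (lexx 0) eb cf.
move=> x /andP[x0 xe]; have : ball 0 d x.
  by rewrite /ball/= sub0r normrN ger0_norm// (le_lt_trans xe).
by move=> /dP /=; rewrite ltr_norml => /andP[_]; lra.
Qed.

(** [ln (cmod (g w))] is the real part of the holomorphic function
    [clog (g w)], hence has the mean value property. *)
Lemma Re_mean_ln (g : C -> C) (c : C) (r : R) : 0 < r ->
  (forall w, cmod (w - c) <= r -> cderivable g w) ->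
  (forall w, cmod (w - c) <= r -> 0 < complex.Re (g w)) -> g c = 1 ->
  \int[mu]_(t in `[0, 2 * pi]) ln (cmod (g (circ c r t))) = 0.
Proof.
move=> r0 dg g0 gc.
have cr t : cmod (circ c r t - c) <= r by rewrite cmod_circ// ltW.
have dcg w : cmod (w - c) <= r -> cderivable (fun w => clog (g w)) w.
  by move=> wr; apply: (@cderivable_comp g); [exact: dg|exact/clog_cderivable/g0].
have := congr1 (@complex.Re R) (mean_value r0 dcg).
rewrite gc clog1 mul0r => h; rewrite -[RHS]h.
by apply: eq_Rintegral => t _; rewrite Re_clog// g0.
Qed.

(** The function [1 - Re (p / p c)] is nonnegative on circles and has zero mean,
    hence vanishes; the bound on the modulus then forces [p = p c]. *)
Lemma max_modulus (p : C -> C) (c : C) (r : R) :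
  (forall w, cmod (w - c) <= r -> cderivable p w) ->
  (forall w, cmod (w - c) <= r -> cmod (p w) <= cmod (p c)) ->
  forall w, cmod (w - c) <= r -> p w = p c.
Proof.
move=> dp pM w wr; have [pc0|pc0] := eqVneq (p c) 0.
  by apply/eqP; rewrite pc0 -cmod_eq0 eq_le cmod_ge0 andbT -(cmod0 R) -pc0 pM.
(* rescale so that [w] is the point of parameter [0] on the unit circle *)
pose q v := p (c + v * (w - c)) / p c.
have inr v : cmod (v - 0) <= 1 -> cmod (c + v * (w - c) - c) <= r.
  rewrite subr0 => v1; rewrite addrC addKr cmodM (le_trans _ wr)//.
  by rewrite ler_piMl ?cmod_ge0.
have dq v : cmod (v - 0) <= 1 -> cderivable q v.
  move=> v1; apply: cderivableM (cderivable_cst _ _).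
  apply: (@cderivable_comp (fun v => c + v * (w - c))); last exact/dp/inr.
  apply: cderivableD (cderivable_cst _ _) _.
  exact: cderivableM (cderivable_id _) (cderivable_cst _ _).
have q1 v : cmod (v - 0) <= 1 -> cmod (q v) <= 1.
  move=> v1; rewrite cmodM cmodV ler_pdivrMr ?cmod_gt0// mul1r.
  exact/pM/inr.
have q0 : q 0 = 1 by rewrite /q mul0r addr0 divff.
have c1 t : cmod (circ 0 1 t - 0) <= 1 by rewrite cmod_circ.
have cq : cont_itv 0 (2 * pi) (fun t => q (circ 0 1 t)).
  move=> t _; apply: (@continuous_comp _ _ _ (circ 0 1) q); first exact: continuous_circ.
  exact/cderivable_continuous/dq/c1.
have cRq := cont_itv_Re cq.
have c1q : cont_itv 0 (2 * pi) (fun t => 1 - complex.Re (q (circ 0 1 t))).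
  by move=> t t2; apply: continuousB; [exact: cvg_cst|exact: cRq].
have := @rint_eq0 _ _ twopi_gt0 c1q.
rewrite RintegralB//; last 2 first.
- by apply: (@cont_itv_integrable R 0 (2 * pi) (fun=> 1)); exact: cont_itv_cst.
- exact: cont_itv_integrable cRq.
have := congr1 (@complex.Re R) (mean_value ltr01 dq); rewrite q0 mul1r /cint /= => ->.
rewrite (@rint_cst R 0 (2 * pi) 1 (ltW twopi_gt0)) subr0 mul1r subrr => /(_ _ (lexx 0)) h.
have q11 : complex.Re (q (circ 0 1 0)) = 1.
  apply/eqP; rewrite eq_sym -subr_eq0; apply/eqP; apply: h => t _.
  rewrite subr_ge0 (le_trans (ler_norm _))// (le_trans (ler_Re_cmod _))//.
  exact/q1/c1.
have := q1 _ (c1 0).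
have : q (circ 0 1 0) = p w / p c.
  by rewrite /q /circ cis0 mulr1 add0r rmorph1 mul1r addrC subrK.
move=> qw; rewrite qw in q11 *.
rewrite -(@ler_pXn2r _ 2) ?nnegrE ?cmod_ge0// cmod_sqr q11 expr1n -{2}(addr0 1) lerD2l => im0.
have {}im0 : complex.Im (p w / p c) = 0.
  by apply/eqP; rewrite -sqrf_eq0 eq_le im0 sqr_ge0.
have : p w / p c = 1 by apply/eqP; rewrite eq_complex q11 im0 /= !eqxx.
by move=> /(congr1 ( *%R^~ (p c))); rewrite mulfVK// mul1r.
Qed.

End Cauchy.

(** * Measurability and affine changes of variables in real coordinates *)

Section Borel.
Variable R : realType.
Local Notation C := (Cplx R).

(** [e : T -> X] is generated by measurable sets when [T] has countably many
    measurable sets forming a base of the topology pulled back from [X]. *)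
Definition mbase (d : measure_display) (T : measurableType d) (X : topologicalType)
    (e : T -> X) := exists (I : countType) (b : I -> set T),
  (forall i, measurable (b i)) /\
  forall U, open U -> forall x, U (e x) -> exists i, b i x /\ b i `<=` e @^-1` U.

Lemma mbase_measurable d (T : measurableType d) (X : topologicalType) (e : T -> X) (U : set X) :
  mbase e -> open U -> measurable (e @^-1` U).
Proof.
move=> [I [b [mb bP]]] oU.
have -> : e @^-1` U = \bigcup_i (if `[< b i `<=` e @^-1` U >] then b i else set0).
  apply/seteqP; split=> [x /(bP _ oU)[i [bix biU]]|x [i _]].
    by exists i => //; rewrite asboolT.
  by case: ifPn => // /asboolP h /h.
apply: countable_bigcupT_measurable => // i.
by case: ifPn.
Qed.

Lemma mbaseR : mbase (id : mR R -> R).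
Proof.
exists (rat * rat)%type, (fun p => `]ratr p.1, ratr p.2[%classic); split=> // U oU x Ux.
have [e /= e0 eU] := (nbhs_ballP _ _).1 (open_nbhs_nbhs (conj oU Ux)).
have xe1 : x - e < x by rewrite gtrBl.
have xe2 : x < x + e by rewrite ltrDl.
have [p] := rat_in_itvoo xe1; rewrite in_itv/= => /andP[p1 p2].
have [q] := rat_in_itvoo xe2; rewrite in_itv/= => /andP[q1 q2].
exists (p, q); split; first by rewrite /= in_itv/= p2 q1.
move=> y /=; rewrite in_itv/= => /andP[y1 y2]; apply: eU.
by rewrite /ball/= ltr_norml; lra.
Qed.

Lemma mbase_prod d1 d2 (T1 : measurableType d1) (T2 : measurableType d2)
    (X1 X2 : topologicalType) (e1 : T1 -> X1) (e2 : T2 -> X2) :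
  mbase e1 -> mbase e2 -> mbase (fun p : T1 * T2 => (e1 p.1, e2 p.2)).
Proof.
move=> [I [b [mb bP]]] [J [c [mc cP]]].
exists (I * J)%type, (fun k => b k.1 `*` c k.2); split=> [k|U oU [x y] /= Uxy].
  exact: measurableX.
have [[V W] [/= Vx Wy] VW] := open_nbhs_nbhs (conj oU Uxy).
have [i [bix biV]] := bP _ (open_interior V) x Vx.
have [j [cjy cjW]] := cP _ (open_interior W) y Wy.
exists (i, j); split=> // -[x' y'] [/= /biV x'V /cjW y'W].
by apply: VW; split; exact: interior_subset.
Qed.

Lemma mbase_comp d (T : measurableType d) (X Y : topologicalType) (e : T -> X) (g : X -> Y) :
  continuous g -> mbase e -> mbase (g \o e).
Proof.
move=> /continuousP cg [I [b [mb bP]]]; exists I, b; split=> // U oU x Ux.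
exact: bP (cg _ oU) x Ux.
Qed.

Lemma mbase_toC2 : mbase (@toC2 R).
Proof.
have mbaseC : mbase (fun p : mR R * mR R => (p.1 +i* p.2)%C : C).
  apply: (@mbase_comp _ _ (R * R)%type C (fun p => (p.1, p.2)) (fun p => (p.1 +i* p.2)%C)).
    move=> p; apply: cvg_complex => /=; [exact: cvg_fst|exact: cvg_snd].
  exact: mbase_prod mbaseR mbaseR.
exact: (mbase_prod mbaseC mbaseC).
Qed.

Lemma mbase_mfun d (T : measurableType d) (X : topologicalType) (e : T -> X)
    (U : set X) (g : X -> R) : mbase e -> open U ->
  (forall x, U x -> {for x, continuous g}) ->
  measurable_fun (e @^-1` U) (fun t => g (e t)).
Proof.
move=> be oU cg; apply: (measurability _ (measurable_realfun.RGenOInfty.measurableE R)).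
move=> _ [_ [a ->] <-].
have -> : e @^-1` U `&` (fun t => g (e t)) @^-1` `]a, +oo[%classic =
    e @^-1` (U `&` g @^-1` `]a, +oo[%classic) by [].
apply: mbase_measurable => //; rewrite openE => x [Ux]; rewrite /= in_itv/= andbT => gx.
apply: (@filterI _ (nbhs x)); first exact: open_nbhs_nbhs.
have ga : nbhs (g x) `]a, +oo[%classic.
  by apply: open_nbhs_nbhs; split; [exact: interval_open|rewrite /= in_itv/= gx].
exact: (cg x Ux _ ga).
Qed.

Lemma mbase_mfun_cond d (T : measurableType d) (X : topologicalType) (e : T -> X)
    (U : set X) (g : X -> R) : mbase e -> open U ->
  (forall x, U x -> {for x, continuous g}) ->
  measurable_fun [set: T] (fun t => (g \_ U) (e t)).
Proof.
move=> be oU cg; rewrite (_ : (fun t => _) = (fun t => g (e t)) \_ (e @^-1` U)).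
  by apply/(measurable_restrictT _ (mbase_measurable be oU)); exact: mbase_mfun.
by apply/funext => t; rewrite /patch.
Qed.

End Borel.

Section AffineChange.
Variable R : realType.
Local Notation C := (Cplx R).
Local Open Scope ereal_scope.

Lemma affine1_measurable (a b : R) : measurable_fun [set: mR R] (fun x : mR R => (a * x + b)%R : mR R).
Proof.
by apply: measurable_funD => //; apply: measurable_funM.
Qed.

(** Both sides are measures that agree on intervals. *)
Lemma affine1_pushforward (a b : R) (X : set (mR R)) : (a != 0)%R -> measurable X ->
  lebesgue_measure X = (`|a|%R)%:E * lebesgue_measure ((fun x : mR R => (a * x + b)%R) @^-1` X).
Proof.
move=> a0 mX; have ma := affine1_measurable a b.
pose m := mscale (NngNum (normr_ge0 a)) (pushforward lebesgue_measure (fun x : mR R => (a * x + b)%R : mR R)).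
transitivity (m ma X); last by [].
apply: lebesgue_measure_unique => // _ [[c d] /= _ <-].
rewrite /mscale /= /pushforward lebesgue_measure_itv /= lte_fin.
have [a1|a1] := ltP 0%R a.
  have -> : (fun x : mR R => (a * x + b)%R) @^-1` `]c, d] = `]((c - b) / a)%R, ((d - b) / a)%R]%classic.
    apply/seteqP; split => x /=; rewrite !in_itv/= ltr_pdivrMr// ler_pdivlMr// (mulrC x);
      by move=> /andP[? ?]; apply/andP; split; lra.
  rewrite lebesgue_measure_itv /= lte_fin ltr_pM2r ?invr_gt0// ltrD2r.
  case: ifPn => cd; last by rewrite mule0.
  by rewrite -!EFinB -EFinM gtr0_norm//; congr EFin; field.
have {}a1 : (a < 0)%R by rewrite lt_def eq_sym a0.
have -> : (fun x : mR R => (a * x + b)%R) @^-1` `]c, d] = `[((d - b) / a)%R, ((c - b) / a)%R[%classic.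
  apply/seteqP; split => x /=; rewrite !in_itv/= ltr_ndivlMr// ler_ndivrMr// (mulrC x);
      by move=> /andP[? ?]; apply/andP; split; lra.
rewrite lebesgue_measure_itv /= lte_fin ltr_nM2r ?invr_lt0// ltrD2r.
case: ifPn => cd; last by rewrite mule0.
by rewrite -!EFinB -EFinM ltr0_norm//; congr EFin; field.
Qed.

Lemma affine1_integral (a b : R) (F : mR R -> \bar R) : (a != 0)%R ->
  measurable_fun setT F -> (forall x, 0 <= F x) ->
  \int[leb1 R]_x F x = (`|a|%R)%:E * \int[leb1 R]_x F (a * x + b)%R.
Proof.
move=> a0 mF F0; have ma := affine1_measurable a b.
pose p : {measure set (mR R) -> \bar R} :=
  measure_function_pushforward__canonical__measure_function_Measure (leb1 R) ma.
transitivity (\int[mscale (NngNum (normr_ge0 a)) p]_x F x).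
  by apply: eq_measure_integral => X mX _; exact: affine1_pushforward.
rewrite ge0_integral_mscale//; congr (_ * _).
by rewrite ge0_integral_pushforward.
Qed.

(** The map [z -> al * z + be] in real coordinates. *)
Definition caff (al be : C) (p : mR R * mR R) : mR R * mR R :=
  ((complex.Re al * p.1 - complex.Im al * p.2 + complex.Re be)%R,
   (complex.Im al * p.1 + complex.Re al * p.2 + complex.Im be)%R).

Lemma caff_measurable al be : measurable_fun setT (caff al be).
Proof.
apply: measurable_fun_pair.
- apply: measurable_funD => //; apply: measurable_funB; apply: measurable_funM => //.
- apply: measurable_funD => //; apply: measurable_funD; apply: measurable_funM => //.
Qed.

Lemma leb2_tonelli (F : mR R * mR R -> \bar R) : measurable_fun setT F -> (forall x, 0 <= F x) ->
  \int[@leb2 R]_p F p = \int[leb1 R]_x \int[leb1 R]_y F (x, y).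
Proof. by move=> mF F0; rewrite /leb2 fubini_tonelli1. Qed.

Lemma leb2_tonelliC (F : mR R * mR R -> \bar R) : measurable_fun setT F -> (forall x, 0 <= F x) ->
  \int[@leb2 R]_p F p = \int[leb1 R]_y \int[leb1 R]_x F (x, y).
Proof. by move=> mF F0; rewrite (leb2_tonelli mF F0) fubini_tonelli. Qed.

Lemma integral_sec_measurable d1 d2 (T1 : measurableType d1) (T2 : measurableType d2)
    (m2 : {sigma_finite_measure set T2 -> \bar R}) (F : T1 * T2 -> \bar R) :
  measurable_fun setT F -> (forall p, 0 <= F p) ->
  measurable_fun setT (fun x => \int[m2]_y F (x, y)).
Proof. by move=> mF F0; exact: measurable_fun_fubini_tonelli_F. Qed.

(** Multiplication by [al] is a composite of maps that change one real coordinate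
    at a time and, when [al] is imaginary, of the exchange of the coordinates; under
    Tonelli's theorem the former are affine changes of one variable. *)
Lemma caff_integral (al be : C) (F : mR R * mR R -> \bar R) : (al != 0)%R ->
  measurable_fun setT F -> (forall p, 0 <= F p) ->
  \int[@leb2 R]_p F p = ((cmod al ^+ 2)%R)%:E * \int[@leb2 R]_p F (caff al be p).
Proof.
move=> al0 mF F0; have mFc := measurableT_comp mF (caff_measurable al be).
rewrite cmod_sqr; set u := complex.Re al; set v := complex.Im al.
have uv0 : (u != 0)%R || (v != 0)%R by move: al0; rewrite eq_complex negb_and.
have sec1 x (H : mR R * mR R -> \bar R) : measurable_fun setT H -> measurable_fun setT (fun y => H (x, y)).
  by move=> mH; exact: measurableT_comp.
have sec2 y (H : mR R * mR R -> \bar R) : measurable_fun setT H -> measurable_fun setT (fun x => H (x, y)).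
  by move=> mH; exact: measurableT_comp.
(* when [al] is imaginary the coordinates are exchanged; otherwise the two steps
   are shears composed with scalings by [s] and [u] *)
have [u0|u0] := eqVneq u 0%R.
  have v0 : (v != 0)%R by move: uv0; rewrite u0 eqxx.
  have mG : measurable_fun setT (fun p : mR R * mR R => F (p.1, v * p.2 + complex.Im be)%R).
    apply: measurableT_comp => //; apply: measurable_fun_pair => //.
    by apply: measurable_funD => //; apply: measurable_funM.
  rewrite leb2_tonelli//.
  under eq_integral => x _ do rewrite (affine1_integral (complex.Im be) v0 (sec1 x _ mF))//.
  rewrite ge0_integralZl//=; last 2 first.
    by apply: (@integral_sec_measurable _ _ _ _ (leb1 R) _ mG).
    by move=> x _; exact: integral_ge0.
  rewrite (@fubini_tonelli _ _ _ _ _ (leb1 R) (leb1 R) _ mG)//.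
  have v0' : (- v != 0)%R by rewrite oppr_eq0.
  have mH : measurable_fun setT (fun p : mR R * mR R => F (- v * p.2 + complex.Re be, v * p.1 + complex.Im be)%R).
    apply: measurableT_comp => //; apply: measurable_fun_pair => //.
      by apply: measurable_funD => //; apply: measurable_funM.
    by apply: measurable_funD => //; apply: measurable_funM.
  under eq_integral => x _ do rewrite (affine1_integral (complex.Re be) v0' (sec2 x _ mG))//.
  rewrite ge0_integralZl//=; last 2 first.
    by apply: (@integral_sec_measurable _ _ _ _ (leb1 R) _ mH).
    by move=> x _; exact: integral_ge0.
  rewrite muleA -EFinM normrN -normrM u0 expr0n add0r -expr2 ger0_norm ?sqr_ge0//.
  congr (_ * _); rewrite (leb2_tonelli mFc (fun p => F0 _)); apply: eq_integral => x _.
  apply: eq_integral => y _; by rewrite /caff /= -/u -/v u0 !mul0r sub0r addr0 mulNr.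
pose s := (v ^+ 2 / u + u)%R; pose t := (v / u)%R; pose k := (complex.Im be - v * complex.Re be / u)%R.
have us : (`|u| * `|s| = u ^+ 2 + v ^+ 2)%R.
  rewrite -normrM ger0_norm; first by rewrite /s; field.
  have -> : (u * s = u ^+ 2 + v ^+ 2)%R by rewrite /s; field.
  by rewrite addr_ge0 ?sqr_ge0.
have s0 : (s != 0)%R.
  apply/eqP => s0; move: us; rewrite s0 normr0 mulr0 => /esym/eqP.
  by rewrite paddr_eq0 ?sqr_ge0// !sqrf_eq0 (negbTE u0).
have mG : measurable_fun setT (fun p : mR R * mR R => F (p.1, s * p.2 + (t * p.1 + k))%R).
  apply: measurableT_comp => //; apply: measurable_fun_pair => //.
  apply: measurable_funD; first by apply: measurable_funM.
  by apply: measurable_funD => //; apply: measurable_funM.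
rewrite leb2_tonelli//.
under eq_integral => x _ do rewrite (affine1_integral (t * x + k)%R s0 (sec1 x _ mF))//.
rewrite ge0_integralZl//=; last 2 first.
  by apply: (@integral_sec_measurable _ _ _ _ (leb1 R) _ mG).
  by move=> x _; exact: integral_ge0.
rewrite (@fubini_tonelli _ _ _ _ _ (leb1 R) (leb1 R) _ mG)//.
under eq_integral => y _ do rewrite (affine1_integral (complex.Re be - v * y)%R u0 (sec2 y _ mG))//.
have FE (x y : mR R) : F ((u * x + (complex.Re be - v * y))%R,
     (s * y + (t * (u * x + (complex.Re be - v * y)) + k))%R) = F (caff al be (x, y)).
  congr F; congr pair; rewrite /= -/u -/v; first by ring.
  by rewrite /s /t /k; field.
under eq_integral => y _.
  rewrite /=; under eq_integral => x _ do rewrite FE.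
  over.
rewrite ge0_integralZl//=; last 2 first.
  exact: (@measurable_fun_fubini_tonelli_G _ _ _ _ _ (leb1 R) _ mFc (fun p => F0 _)).
  by move=> y _; exact: integral_ge0.
by rewrite muleA -EFinM mulrC us leb2_tonelliC.
Qed.

Definition daff (a1 b1 a2 b2 : C) (p : R4 R) : R4 R := (caff a1 b1 p.1, caff a2 b2 p.2).

Lemma daff_measurable a1 b1 a2 b2 : measurable_fun setT (daff a1 b1 a2 b2).
Proof.
apply: measurable_fun_pair.
- apply: (measurableT_comp (caff_measurable a1 b1)); exact: measurable_fst.
- apply: (measurableT_comp (caff_measurable a2 b2)); exact: measurable_snd.
Qed.

Lemma toC2_daff a1 b1 a2 b2 p :
  toC2 (daff a1 b1 a2 b2 p) = ((a1 * (toC2 p).1 + b1)%R, (a2 * (toC2 p).2 + b2)%R).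
Proof.
by case: a1 b1 a2 b2 p => [? ?] [? ?] [? ?] [? ?] [[? ?] [? ?]];
  rewrite /daff /caff /toC2 /=; congr (_, _); apply/eqP; rewrite eq_complex /=;
  apply/andP; split; apply/eqP; ring.
Qed.

Lemma daff_integral a1 b1 a2 b2 (F : R4 R -> \bar R) : (a1 != 0)%R -> (a2 != 0)%R ->
  measurable_fun setT F -> (forall p, 0 <= F p) ->
  \int[@leb4 R]_p F p =
  ((cmod a1 ^+ 2 * cmod a2 ^+ 2)%R)%:E * \int[@leb4 R]_p F (daff a1 b1 a2 b2 p).
Proof.
move=> a10 a20 mF F0.
have mD := measurableT_comp mF (daff_measurable a1 b1 a2 b2).
have mG : measurable_fun setT (fun p : R4 R => F (p.1, caff a2 b2 p.2)).
  apply: measurableT_comp => //; apply: measurable_fun_pair => //.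
  by apply: (measurableT_comp (caff_measurable a2 b2)).
have sec1 x (H : R4 R -> \bar R) : measurable_fun setT H -> measurable_fun setT (fun y => H (x, y)).
  by move=> mH; exact: measurableT_comp.
rewrite /leb4 !(@fubini_tonelli1 _ _ _ _ _ (@leb2 R) (@leb2 R))// /fubini_F.
under eq_integral => x _ do rewrite (caff_integral b2 a20 (sec1 x _ mF))//.
rewrite ge0_integralZl//=; last 3 first.
- by apply: (@integral_sec_measurable _ _ _ _ (@leb2 R) _ mG).
- by move=> x _; exact: integral_ge0.
- by rewrite lee_fin sqr_ge0.
rewrite (caff_integral b1 a10 (@integral_sec_measurable _ _ _ _ (@leb2 R) _ mG (fun p => F0 _))); last first.
  by move=> x; exact: integral_ge0.
by rewrite muleA -EFinM mulrC.
Qed.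

End AffineChange.

(** * Integrals of nonnegative functions over open subsets of C^2 *)

Section Mass.
Variable R : realType.
Local Notation C := (Cplx R).
Implicit Types (D E : set (C2 R)) (F G : C2 R -> R).

(** Functions are extended by zero outside [D], so that all integrals are over the
    whole space, where Tonelli's theorem and changes of variables are stated. *)
Definition mfunD D F := measurable_fun [set: R4 R] (fun p : R4 R => (F \_ D) (toC2 p)).

Definition mass D F : \bar R := (\int[@leb4 R]_p ((F \_ D) (toC2 p))%:E)%E.

Lemma mfunD_open D F : open D -> (forall z, D z -> {for z, continuous F}) -> mfunD D F.
Proof. by move=> oD cF; apply: mbase_mfun_cond => //; exact: mbase_toC2. Qed.

Lemma patch_in D F z : D z -> (F \_ D) z = F z.
Proof. by move=> Dz; rewrite /patch mem_set. Qed.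

Lemma patch_out D F z : ~ D z -> (F \_ D) z = 0.
Proof. by move=> Dz; rewrite /patch memNset. Qed.

Lemma patch_ge0 D F z : (forall z, D z -> 0 <= F z) -> 0 <= (F \_ D) z.
Proof.
by move=> F0; have [Dz|Dz] := pselect (D z); [rewrite patch_in// F0|rewrite patch_out].
Qed.

Lemma patch_le D E F G z : D `<=` E -> (forall z, D z -> F z <= G z) ->
  (forall z, E z -> 0 <= G z) -> (F \_ D) z <= (G \_ E) z.
Proof.
move=> DE FG G0; have [Dz|Dz] := pselect (D z).
  by rewrite !patch_in ?FG//; exact: DE.
by rewrite patch_out//; exact: patch_ge0.
Qed.

Lemma mass_ge0 D F : (forall z, D z -> 0 <= F z) -> (0 <= mass D F)%E.
Proof. by move=> F0; apply: integral_ge0 => p _; rewrite lee_fin patch_ge0. Qed.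

Lemma mass_le D E F G : mfunD D F -> mfunD E G -> D `<=` E ->
  (forall z, D z -> 0 <= F z) -> (forall z, D z -> F z <= G z) ->
  (forall z, E z -> 0 <= G z) -> (mass D F <= mass E G)%E.
Proof.
move=> mF mG DE F0 FG G0; apply: ge0_le_integral => //.
- by move=> p _; rewrite lee_fin patch_ge0.
- exact/measurable_EFinP.
- exact/measurable_EFinP.
- by move=> p _; rewrite lee_fin; exact: patch_le.
Qed.

Lemma massD D F G : mfunD D F -> mfunD D G -> (forall z, D z -> 0 <= F z) ->
  (forall z, D z -> 0 <= G z) -> mass D (fun z => F z + G z) = (mass D F + mass D G)%E.
Proof.
move=> mF mG F0 G0; rewrite /mass -ge0_integralD//.
- apply: eq_integral => p _; rewrite -EFinD; congr EFin.
  have [Dz|Dz] := pselect (D (toC2 p)); first by rewrite !patch_in.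
  by rewrite !patch_out// addr0.
- by move=> p _; rewrite lee_fin patch_ge0.
- exact/measurable_EFinP.
- by move=> p _; rewrite lee_fin patch_ge0.
- exact/measurable_EFinP.
Qed.

Lemma massZ D F k : 0 <= k -> mfunD D F -> (forall z, D z -> 0 <= F z) ->
  mass D (fun z => k * F z) = (k%:E * mass D F)%E.
Proof.
move=> k0 mF F0; rewrite /mass -ge0_integralZl//.
- apply: eq_integral => p _; rewrite -EFinM; congr EFin.
  have [Dz|Dz] := pselect (D (toC2 p)); first by rewrite !patch_in.
  by rewrite !patch_out// mulr0.
- exact/measurable_EFinP.
- by move=> p _; rewrite lee_fin patch_ge0.
Qed.

Lemma mass_cst D c : open D -> 0 <= c -> mass D (fun=> c) = (c%:E * @leb4 R (@toC2 R @^-1` D))%E.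
Proof.
move=> oD c0; have mD := mbase_measurable (@mbase_toC2 R) oD.
rewrite /mass -(integral_cst (@leb4 R) mD c%:E) integral_mkcond.
apply: eq_integral => p _; rewrite /patch /=.
by rewrite !(fun_if EFin); congr (if _ then _ else _).
Qed.

Let itv_lt0 (a b : R) : a < b -> (0 < @leb1 R `]a, b[%classic)%E.
Proof. by move=> ab; rewrite /leb1 /= lebesgue_measure_itv/= lte_fin ab -EFinD lte_fin subr_gt0. Qed.

Lemma leb4_box (A B A' B' : set (mR R)) : measurable A -> measurable B ->
  measurable A' -> measurable B' -> @leb4 R ((A `*` B) `*` (A' `*` B')) =
  (leb1 R A * leb1 R B * (leb1 R A' * leb1 R B'))%E.
Proof.
move=> mA mB mA' mB'; rewrite /leb4 product_measure1E; last 2 first.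
  exact: measurableX.
  exact: measurableX.
have e (X Y : set (mR R)) : measurable X -> measurable Y ->
    @leb2 R (X `*` Y) = (leb1 R X * leb1 R Y)%E by exact: product_measure1E.
by rewrite -(e _ _ mA mB) -(e _ _ mA' mB').
Qed.

Lemma leb4_open_gt0 D : open D -> D !=set0 -> (0 < @leb4 R (@toC2 R @^-1` D))%E.
Proof.
move=> oD [z Dz]; have mD := mbase_measurable (@mbase_toC2 R) oD.
have [r r0 rD] := (@nbhs_C2P R z _).1 (open_nbhs_nbhs (conj oD Dz)).
pose J (x : R) := `]x - r / 2, x + r / 2[%classic : set (mR R).
have J0 x : (0 < leb1 R (J x))%E by apply: itv_lt0; lra.
pose B := (J (complex.Re z.1) `*` J (complex.Im z.1)) `*` (J (complex.Re z.2) `*` J (complex.Im z.2)).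
have mJ x : measurable (J x) by exact: measurable_itv.
have mB : measurable B by apply: measurableX; apply: measurableX.
apply: (@lt_le_trans _ _ (@leb4 R B)).
  by rewrite /B leb4_box ?mule_gt0//; exact: measurable_itv.
apply: le_measure; rewrite ?inE//.
have close (w v : C) : J (complex.Re v) (complex.Re w) -> J (complex.Im v) (complex.Im w) ->
    cmod (w - v) < r.
  rewrite /J /= !in_itv/= => h1 h2; rewrite (le_lt_trans (cmod_le_ReIm _))// (splitr r).
  by rewrite !raddfB /= ltrD// ltr_norml; lra.
by move=> p [[/= h1 h2] [h3 h4]]; apply: rD; apply: close.
Qed.

Definition bounded2 D (M : R) := forall z, D z -> cmod z.1 <= M /\ cmod z.2 <= M.

Lemma bounded_setP D : bounded_set D -> exists2 M : R, 0 < M & bounded2 D M.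
Proof.
move=> /ex_strict_bound_gt0[M M0 DM]; have [m m0 Mm] := cpos_real M0.
exists m => // z /DM /=; rewrite prod_normE Mm !cmodE /Num.max ltcR.
by case: ifPn; rewrite -?leNgt => h; rewrite ltcR => k; split; lra.
Qed.

Lemma leb4_bounded D M : open D -> bounded2 D M -> (@leb4 R (@toC2 R @^-1` D) < +oo)%E.
Proof.
move=> oD DM; have mD := mbase_measurable (@mbase_toC2 R) oD.
pose J := `](- (M + 1)), M + 1[%classic : set (mR R).
have Jf : (leb1 R J < +oo)%E.
  by rewrite /leb1 /= lebesgue_measure_itv/=; case: ifP => // _; rewrite -EFinD ltry.
have mJ : measurable J by exact: measurable_itv.
apply: (@le_lt_trans _ _ (@leb4 R ((J `*` J) `*` (J `*` J)))).
  apply: le_measure; rewrite ?inE//.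
    by apply: measurableX; exact: measurableX.
  move=> [[a b] [c d]] /DM /= [h1 h2].
  have inJ (w : C) : cmod w <= M -> J (complex.Re w) /\ J (complex.Im w).
    move=> wM; rewrite /J /= !in_itv/= -!ltr_norml.
    by split; apply: le_lt_trans (_ : M < _); rewrite ?ltrDl// (le_trans _ wM)// ?ler_Re_cmod ?ler_Im_cmod.
  by have [? ?] := inJ (a +i* b)%C h1; have [? ?] := inJ (c +i* d)%C h2.
by rewrite leb4_box// !lte_mul_pinfty// ?mule_ge0// ge0_fin_numE// ?mule_ge0// lte_mul_pinfty// ge0_fin_numE.
Qed.

Lemma mass_bounded D M F K : open D -> bounded2 D M -> mfunD D F ->
  (forall z, D z -> 0 <= F z <= K) -> (mass D F < +oo)%E.
Proof.
move=> oD DM mF FK.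
have K0 : 0 <= `|K| by [].
apply: (@le_lt_trans _ _ (mass D (fun=> `|K|))).
  apply: mass_le => //.
  - by apply: mfunD_open => // z _; exact: cvg_cst.
  - by move=> z /FK/andP[].
  - by move=> z /FK/andP[_ h]; rewrite (le_trans h)// ler_norm.
by rewrite mass_cst// lte_mul_pinfty// (leb4_bounded oD DM).
Qed.

Definition taff (a1 b1 a2 b2 : C) (z : C2 R) : C2 R := (a1 * z.1 + b1, a2 * z.2 + b2).

(** Only an inequality, because [D] may be mapped to a part of [E]. *)
Lemma mass_taff D E F a1 b1 a2 b2 : a1 != 0 -> a2 != 0 -> mfunD E F ->
  mfunD D (fun z => F (taff a1 b1 a2 b2 z)) ->
  (forall z, E z -> 0 <= F z) -> (forall z, D z -> E (taff a1 b1 a2 b2 z)) ->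
  ((cmod a1 ^+ 2 * cmod a2 ^+ 2)%:E * mass D (fun z => F (taff a1 b1 a2 b2 z)) <= mass E F)%E.
Proof.
move=> a10 a20 mF mFT F0 DE; rewrite /mass.
rewrite (@daff_integral R a1 b1 a2 b2 (fun p => ((F \_ E) (toC2 p))%:E))//; last 2 first.
  exact/measurable_EFinP.
  by move=> p; rewrite lee_fin patch_ge0.
apply: lee_pmul => //.
- by rewrite lee_fin mulr_ge0// sqr_ge0.
- by apply: integral_ge0 => p _; rewrite lee_fin patch_ge0// => z /DE/F0.
apply: ge0_le_integral => //.
- by move=> p _; rewrite lee_fin patch_ge0// => z /DE/F0.
- exact/measurable_EFinP.
- apply/measurable_EFinP.
  exact: (measurableT_comp mF (daff_measurable a1 b1 a2 b2)).
move=> p _; rewrite lee_fin toC2_daff -/(taff a1 b1 a2 b2 (toC2 p)).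
have [Dz|Dz] := pselect (D (toC2 p)); last by rewrite patch_out// patch_ge0.
by rewrite !patch_in//; exact: DE.
Qed.

Definition sqmass D (f : C2 R -> C) : \bar R := mass D (fun z => cmod (f z) ^+ 2).

Lemma L2norm_sqr D (f : C2 R -> C) : (L2norm D f `^ 2 = sqmass D f)%E.
Proof.
rewrite /L2norm poweR_Lnorm//; apply: eq_integral => p _.
rewrite /patch /=; have -> : (p \in @toC2 R @^-1` D) = (toC2 p \in D).
  by apply/idP/idP; rewrite !inE.
case: ifPn => _; last by rewrite abse0 poweR0r.
by rewrite gee0_abs ?lee_fin ?cmod_ge0// poweR_EFin powR_mulrn ?cmod_ge0.
Qed.

Lemma L2norm_le D (f : C2 R -> C) (M : R) : 0 <= M ->
  (sqmass D f <= (M ^+ 2)%:E)%E -> (L2norm D f <= M%:E)%E.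
Proof.
move=> M0 h; rewrite leNgt; apply/negP => Mf.
have : (M%:E `^ 2 < L2norm D f `^ 2)%E.
  move: Mf; have := @Lnorm_ge0 _ _ _ (@leb4 R) 2%:E ((fun p => (Normc.normc (f (toC2 p)))%:E) \_ (@toC2 R @^-1` D))%E.
  rewrite -/(L2norm D f); case: (L2norm D f) => [r| |]//=.
    rewrite lee_fin !lte_fin => r0 Mr; rewrite !powR_mulrn//.
    by rewrite ltr_pXn2r ?nnegrE.
  by move=> _ _; rewrite pnatr_eq0/= ltry.
by rewrite L2norm_sqr poweR_EFin powR_mulrn// ltNge h.
Qed.

Lemma L2norm_near0 D (f : nat -> C2 R -> C) :
  (fun k => L2norm D (f k)) @ \oo --> 0%E ->
  forall e : R, 0 < e -> \forall k \near \oo,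
    (sqmass D (f k) <= e%:E)%E.
Proof.
move=> /fine_cvgP[ff /cvgrPdist_lt f0] e e0.
have s0 : 0 < Num.sqrt e by rewrite sqrtr_gt0.
near=> k; have fk : L2norm D (f k) \is a fin_num by near: k.
rewrite -L2norm_sqr -(fineK fk) poweR_EFin lee_fin.
have fk0 : 0 <= fine (L2norm D (f k)) by rewrite fine_ge0// Lnorm_ge0.
rewrite powR_mulrn// -(sqr_sqrtr (ltW e0)) ler_pXn2r ?nnegrE ?sqrtr_ge0//.
have : `|0 - fine (L2norm D (f k))| < Num.sqrt e by near: k; exact: f0.
by rewrite sub0r normrN ger0_norm// => /ltW.
Unshelve. all: by end_near. Qed.

End Mass.

(** * Compactness of the Hankel operator *)

Section PatchedMeasurable.
Variables (R : realType) (D : set (C2 R)).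

Lemma mfunDD (F G : C2 R -> R) : mfunD D F -> mfunD D G -> mfunD D (fun z => F z + G z).
Proof.
move=> mF mG; have := measurable_funD mF mG; congr measurable_fun.
by apply/funext => q /=; rewrite /patch; case: ifPn => // _; rewrite addr0.
Qed.

Lemma mfunDZ (k : R) (F : C2 R -> R) : mfunD D F -> mfunD D (fun z => k * F z).
Proof.
move=> mF; have : measurable_fun [set: R4 R] (fun p : R4 R => k * (F \_ D) (toC2 p)).
  by apply: measurable_funM => //; exact: measurable_cst.
congr measurable_fun.
by apply/funext => q /=; rewrite /patch; case: ifPn => // _; rewrite mulr0.
Qed.

End PatchedMeasurable.

Section HankelCauchy.
Variable R : realType.
Local Notation C := (Cplx R).
Variables (Omega : set (C2 R)) (phi : C2 R -> C) (M0 : R).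
Hypotheses (oO : open Omega) (bO : bounded2 Omega M0).

Lemma holomorphic_continuous (p : C2 R -> C) z : holomorphic_on Omega p ->
  Omega z -> {for z, continuous p}.
Proof. by move=> hp Oz; apply: differentiable_continuous; exact: hp. Qed.

Lemma mfunD_on (F : C2 R -> R) :
  measurable_fun (@toC2 R @^-1` Omega) (fun p : R4 R => F (toC2 p)) -> mfunD Omega F.
Proof.
move=> mF; have mO := mbase_measurable (@mbase_toC2 R) oO.
rewrite /mfunD (_ : (fun p => _) = (fun p : R4 R => F (toC2 p)) \_ (@toC2 R @^-1` Omega)).
  by apply/(measurable_restrictT _ mO).
by apply/funext => p; rewrite /patch.
Qed.

Lemma continuous_sqmod (f : C2 R -> C) z : {for z, continuous f} ->
  {for z, continuous (fun z => cmod (f z) ^+ 2)}.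
Proof.
move=> cf; rewrite (_ : (fun z => _) = (fun z => cmod (f z) * cmod (f z))); last first.
  by apply/funext => w; rewrite expr2.
have cc : {for z, continuous (fun z => cmod (f z))}.
  by apply: continuous_comp; [exact: cf|exact: continuous_cmod].
exact: (@continuousM R _ _ _ _ cc cc).
Qed.

Lemma sqmass_fun (f : C2 R -> C) : (forall z, Omega z -> {for z, continuous f}) ->
  mfunD Omega (fun z => cmod (f z) ^+ 2).
Proof. by move=> cf; apply: mfunD_open => // z Oz; exact/continuous_sqmod/cf. Qed.

Lemma L2_of_continuous (f : C2 R -> C) (M : R) :
  (forall z, Omega z -> {for z, continuous f}) -> (sqmass Omega f <= M%:E)%E ->
  L2 Omega f.
Proof.
move=> cf fM; split.
- apply: (@mbase_mfun R _ _ _ _ Omega (fun z => complex.Re (f z)) (@mbase_toC2 R) oO) => z Oz.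
  by apply: continuous_comp; [exact: cf|exact: continuous_Re].
- apply: (@mbase_mfun R _ _ _ _ Omega (fun z => complex.Im (f z)) (@mbase_toC2 R) oO) => z Oz.
  by apply: continuous_comp; [exact: cf|exact: continuous_Im].
apply: (@le_lt_trans _ _ (1 + `|M|)%:E); last by rewrite ltry.
apply: L2norm_le; first by rewrite addr_ge0.
rewrite (le_trans fM)// lee_fin (le_trans (ler_norm _))// -[leLHS]mulr1.
by rewrite sqrrD expr1n; have := normr_ge0 M; nra.
Qed.

(** When no projection exists, [get] returns its default value, a constant
    function. *)
Lemma bergman_proj_holomorphic (f : C2 R -> C) : holomorphic_on Omega (bergman_proj Omega f).
Proof.
rewrite /bergman_proj; set P := [set p | _].
have [[p Pp]|nP] := pselect (exists p, P p).
  by have [[]] := getPex (ex_intro P p Pp).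
rewrite getPN => [z _|p Pp]; last by apply: nP; exists p.
exact: differentiable_cst.
Qed.

Hypothesis cphi : forall z, Omega z -> {for z, continuous phi}.

Lemma cmodB_ReIm (a b : C) : cmod (a - b) ^+ 2 =
  (complex.Re a - complex.Re b) ^+ 2 + (complex.Im a - complex.Im b) ^+ 2.
Proof. by rewrite cmod_sqr; case: a b => ? ? []. Qed.

Lemma cmodB_sqr (a b : C) : cmod (a - b) ^+ 2 <= 2 * cmod a ^+ 2 + 2 * cmod b ^+ 2.
Proof.
have := cmodB a b; have := cmod_ge0 (a - b); have := cmod_ge0 a; have := cmod_ge0 b.
set x := cmod (a - b); set y := cmod a; set w := cmod b => b0 a0 ab0 h.
have : x ^+ 2 <= (y + w) ^+ 2 by rewrite ler_pXn2r ?nnegrE ?addr_ge0.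
have := sqr_ge0 (y - w); rewrite !expr2; lra.
Qed.

(** The images of [g n] converge along a subsequence, so they form a Cauchy
    sequence there; [p k] is the projection of [phi * g (s k)]. *)
Lemma hankel_cauchy (g : nat -> C2 R -> C) :
  compact_operator Omega (hankel Omega phi) ->
  (forall n, holomorphic_on Omega (g n)) ->
  (exists M : R, forall n, (sqmass Omega (g n) <= M%:E)%E) ->
  exists2 s : nat -> nat, {homo s : m n / (m < n)%N} &
  exists2 p : nat -> C2 R -> C, (forall k, holomorphic_on Omega (p k)) &
  forall e : R, 0 < e -> exists N, forall k l, (N <= k)%N -> (N <= l)%N ->
   (sqmass Omega (fun z => phi z * (g (s k) z - g (s l) z) - (p k z - p l z))%R <= e%:E)%E.
Proof.
move=> HC hg [M gM].
have cg n z : Omega z -> {for z, continuous (g n)} by exact: holomorphic_continuous.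
have Ag n : A2 Omega (g n).
  exact: (conj (hg n) (L2_of_continuous (cg n) (gM n))).
have M1 : 0 <= 1 + `|M| by rewrite addr_ge0.
have [|s [sinc [h [h2 sh]]]] := HC g Ag.
  exists (1 + `|M|) => n; apply: L2norm_le => //.
  rewrite (le_trans (gM n))// lee_fin (le_trans (ler_norm _))//.
  by rewrite sqrrD expr1n; have := normr_ge0 M; nra.
exists s => //; pose p k := bergman_proj Omega (phi \* g (s k)).
exists p => [k|e e0]; first exact: bergman_proj_holomorphic.
have cp k z : Omega z -> {for z, continuous (p k)}.
  by apply: holomorphic_continuous; exact: bergman_proj_holomorphic.
pose H k z := phi z * g (s k) z - p k z.
have cH k z : Omega z -> {for z, continuous (H k)}.
  move=> Oz; apply: continuousB; last exact: cp.
  by apply: continuousM; [exact: cphi|exact: cg].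
have e4 : 0 < e / 4 by rewrite divr_gt0.
have [N _ NP] := L2norm_near0 sh e4.
exists N => k l Nk Nl.
have mh k' : mfunD Omega (fun z => cmod (H k' z - h z) ^+ 2).
  apply: mfunD_on.
  case: h2 => hr hi _.
  have mr : measurable_fun (@toC2 R @^-1` Omega) (fun p : R4 R => complex.Re (H k' (toC2 p))).
    apply: (@mbase_mfun R _ _ _ _ Omega (fun z => complex.Re (H k' z)) (@mbase_toC2 R) oO) => z Oz.
    by apply: continuous_comp; [exact: cH|exact: continuous_Re].
  have mi : measurable_fun (@toC2 R @^-1` Omega) (fun p : R4 R => complex.Im (H k' (toC2 p))).
    apply: (@mbase_mfun R _ _ _ _ Omega (fun z => complex.Im (H k' z)) (@mbase_toC2 R) oO) => z Oz.
    by apply: continuous_comp; [exact: cH|exact: continuous_Im].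
  have := measurable_funD (measurable_funX 2 (measurable_funB mr hr)) (measurable_funX 2 (measurable_funB mi hi)).
  by congr measurable_fun; apply/funext => q; rewrite cmodB_ReIm.
have mh2 k' : mfunD Omega (fun z => 2 * cmod (H k' z - h z) ^+ 2).
  exact: mfunDZ (mh k').
have sq0 k' z : 0 <= 2 * cmod (H k' z - h z) ^+ 2 by rewrite mulr_ge0 ?sqr_ge0.
apply: (@le_trans _ _ (mass Omega (fun z => 2 * cmod (H k z - h z) ^+ 2 + 2 * cmod (H l z - h z) ^+ 2))).
  apply: mass_le => //.
  - apply: sqmass_fun => z Oz.
    rewrite (_ : (fun z => _) = (fun z => H k z - H l z)); last first.
      by apply/funext => w; rewrite /H; ring.
    by apply: continuousB; exact: cH.
  - exact: mfunDD (mh2 k) (mh2 l).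
  - by move=> z _; exact: sqr_ge0.
  - move=> z _; rewrite (_ : _ - _ = (H k z - h z) - (H l z - h z)); first exact: cmodB_sqr.
    by rewrite /H; ring.
  - by move=> z _; rewrite addr_ge0.
rewrite (massD (mh2 k) (mh2 l) (fun z _ => sq0 k z) (fun z _ => sq0 l z)).
have Z2 k' : mass Omega (fun z => 2 * cmod (H k' z - h z) ^+ 2)%R =
    (2%:E * mass Omega (fun z => cmod (H k' z - h z) ^+ 2)%R)%E.
  by apply: massZ; [|exact: mh|move=> z _; exact: sqr_ge0].
rewrite !Z2.
have bnd k' : (N <= k')%N -> (2%:E * mass Omega (fun z => cmod (H k' z - h z) ^+ 2)%R <= (e / 2)%:E)%E.
  move=> /NP /= hk; apply: (@le_trans _ _ (2%:E * (e / 4)%:E)%E).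
    by rewrite lee_pmul2l.
  by rewrite -EFinM lee_fin; lra.
rewrite [in leRHS](splitr e) EFinD; exact: leeD (bnd _ Nk) (bnd _ Nl).
Qed.

End HankelCauchy.

(** * Compact sets and parameter integrals in C^2 *)

Section TopologyC2.
Variable R : realType.
Local Notation C := (Cplx R).

Definition near2 (q : C2 R) (r : R) : set (C2 R) :=
  [set z | cmod (z.1 - q.1) < r /\ cmod (z.2 - q.2) < r].

Lemma near2_open q r : open (near2 q r).
Proof.
rewrite openE => z [z1 z2]; apply/nbhs_C2P.
exists (Num.min (r - cmod (z.1 - q.1)) (r - cmod (z.2 - q.2))).
  by rewrite lt_min !subr_gt0 z1.
move=> w; rewrite !lt_min => /andP[w1 _] /andP[_ w2].
split.
- have := cmodD (w.1 - z.1) (z.1 - q.1); rewrite addrA subrK; lra.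
- have := cmodD (w.2 - z.2) (z.2 - q.2); rewrite addrA subrK; lra.
Qed.

Lemma near2_refl q r : 0 < r -> near2 q r q.
Proof. by move=> r0; split; rewrite subrr cmod0. Qed.

Lemma nbhs_near2 (q : C2 R) r : 0 < r -> nbhs q (near2 q r).
Proof. by move=> r0; apply/nbhs_C2P; exists r. Qed.

Lemma toC2_continuous : continuous (fun p : (R * R) * (R * R) => toC2 p : C2 R).
Proof.
move=> p; have h (a b : ((R * R) * (R * R)) -> R) : {for p, continuous a} -> {for p, continuous b} ->
    {for p, continuous (fun p => (a p +i* b p)%C : C)}.
  by move=> ca cb; apply: cvg_complex.
apply: (@cvg_pair _ _ _ _ (nbhs (toC2 p).1) (nbhs (toC2 p).2)).
- apply: (h (fun p => p.1.1) (fun p => p.1.2)).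
    by apply: (@continuous_comp _ _ _ fst fst); [exact: cvg_fst|exact: cvg_fst].
  by apply: (@continuous_comp _ _ _ fst snd); [exact: cvg_fst|exact: cvg_snd].
- apply: (h (fun p => p.2.1) (fun p => p.2.2)).
    by apply: (@continuous_comp _ _ _ snd fst); [exact: cvg_snd|exact: cvg_fst].
  by apply: (@continuous_comp _ _ _ snd snd); [exact: cvg_snd|exact: cvg_snd].
Qed.

Lemma compact_C2 (D : set (C2 R)) (M : R) : bounded2 D M -> closed D -> compact D.
Proof.
move=> DM cD; pose J : set R := `[- M, M]%classic.
have cJ : compact J by exact: segment_compact.
have cB : compact ((fun p : (R * R) * (R * R) => toC2 p : C2 R) @` ((J `*` J) `*` (J `*` J))).
  apply: continuous_compact; first exact/continuous_subspaceT/toC2_continuous.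
  by apply: compact_setX; exact: compact_setX.
apply: (subclosed_compact cD cB) => z /DM[z1 z2].
exists ((complex.Re z.1, complex.Im z.1), (complex.Re z.2, complex.Im z.2)).
  have inJ (w : C) : cmod w <= M -> J (complex.Re w) /\ J (complex.Im w).
    move=> wM; rewrite /J /= !in_itv/= -!ler_norml.
    by split; rewrite (le_trans _ wM)// ?ler_Re_cmod ?ler_Im_cmod.
  by have [? ?] := inJ _ z1; have [? ?] := inJ _ z2.
by case: z {z1 z2} => [[? ?] [? ?]].
Qed.

Lemma bounded2_closure (D : set (C2 R)) (M : R) : bounded2 D M -> bounded2 (closure D) M.
Proof.
move=> DM z Dz; suff h e : 0 < e -> cmod z.1 <= M + e /\ cmod z.2 <= M + e.
  by split; apply/ler_addgt0Pr => e /h[].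
move=> e0; have [w [Dw [w1 w2]]] : D `&` near2 z e !=set0.
  by apply: Dz; exact: nbhs_near2.
have [h1 h2] := DM _ Dw.
by split; [have := ler_cmodD_dist z.1 w.1; rewrite cmodBC|have := ler_cmodD_dist z.2 w.2; rewrite cmodBC]; lra.
Qed.

Lemma within_cmodP (D : set (C2 R)) (f : C2 R -> C) z e : {within D, continuous f} ->
  D z -> 0 < e -> exists2 r, 0 < r & forall w, D w -> near2 z r w -> cmod (f w - f z) < e.
Proof.
move=> /subspace_continuousP cf Dz e0.
have := cf z Dz [set y | cmod (y - f z) < e].
have nf : nbhs (f z) [set y | cmod (y - f z) < e] by apply/nbhs_cmodP; exists e.
move=> /(_ nf); rewrite /= nbhs_simpl /within /= => /nbhs_C2P[r r0 rP].
by exists r => // w Dw [w1 w2]; exact: rP.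
Qed.

(** By the near-covering form of compactness, radii that work around each point
    can be made uniform. *)
Lemma uniform_continuity (K : set (C2 R)) (f : C2 R -> C) : compact K ->
  {within K, continuous f} -> forall e : R, 0 < e -> exists2 d, 0 < d &
  forall z w, K z -> K w -> near2 z d w -> cmod (f w - f z) < e.
Proof.
move=> /compact_near_coveringP cK cf e e0.
have := cK R 0^'+ (fun d z => K z -> forall w, K w -> near2 z d w -> cmod (f w - f z) < e) _.
case.
- move=> z Kz; have e20 : 0 < e / 2 by rewrite divr_gt0.
  have [r r0 rP] := within_cmodP cf Kz e20.
  have r2 : 0 < r / 2 by rewrite divr_gt0.
  exists (near2 z (r / 2), [set d | d < r / 2]) => /=.
    split; first exact: nbhs_near2.
    exact: nbhs_right_lt.
  move=> [z' d] [/= [z1 z2] dr] Kz' w Kw [w1 w2].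
  have hz : cmod (f z' - f z) < e / 2 by apply: rP => //; split; lra.
  have hw : cmod (f w - f z) < e / 2.
    apply: rP => //; split.
      have := cmodD (w.1 - z'.1) (z'.1 - z.1); rewrite addrA subrK; lra.
    have := cmodD (w.2 - z'.2) (z'.2 - z.2); rewrite addrA subrK; lra.
  rewrite (_ : f w - f z' = (f w - f z) - (f z' - f z)); last by ring.
  by rewrite (le_lt_trans (cmodB _ _))//; lra.
move=> r /= r0 rP; exists (r / 2); first by rewrite divr_gt0.
move=> z w Kz Kw zw; apply: (rP (r / 2)) => //=.
  by rewrite sub0r normrN gtr0_norm ?divr_gt0// ltr_pdivrMr// ltr_pMr// ltr1n.
by rewrite divr_gt0.
Qed.

End TopologyC2.

Section Tonelli.
Variable R : realType.
Local Notation C := (Cplx R).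
Local Notation mu := (@lebesgue_measure R).

(** Tonelli's theorem for a parameter in an interval; joint continuity gives the
    measurability. *)
Lemma mass_rint (B : set (C2 R)) (F : R -> C2 R -> R) (K : R) : open B -> 0 <= K ->
  (forall t z, B z -> {for (t, z), continuous (fun p : R * C2 R => F p.1 p.2)}) ->
  (forall t z, B z -> 0 <= F t z) ->
  (forall t, 0 <= t <= 2 * pi -> (mass B (F t) <= K%:E)%E) ->
  mfunD B (fun z => \int[mu]_(t in `[0, 2 * pi]) F t z) /\
  (mass B (fun z => \int[mu]_(t in `[0, 2 * pi]) F t z)%R <= (2 * pi * K)%:E)%E.
Proof.
move=> oB K0 cF F0 FK.
have pi2 : 0 < 2 * pi :> R := twopi_gt0 R.
pose U : set (R * C2 R) := setT `*` B.
have oU : open U.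
  by rewrite openE => -[t z] [_ Bz]; exists (setT, B) => //=; split; [exact: filterT|exact: (open_nbhs_nbhs (conj oB Bz))].
have mb : mbase (fun p : mR R * R4 R => (p.1 : R, toC2 p.2)).
  exact: (mbase_prod (mbaseR R) (@mbase_toC2 R)).
have mF : measurable_fun [set: mR R * R4 R] (fun p : mR R * R4 R =>
    ((fun p : R * C2 R => F p.1 p.2) \_ U) (p.1 : R, toC2 p.2)).
  by apply: (@mbase_mfun_cond R _ _ _ _ _ _ mb oU) => -[t z] [_ Bz]; exact: cF.
pose I : set (mR R) := `[0, 2 * pi]%classic.
have mI : measurable I by exact: measurable_itv.
pose f (p : mR R * R4 R) : \bar R := (\1_I p.1 * ((fun p : R * C2 R => F p.1 p.2) \_ U) (p.1 : R, toC2 p.2))%:E.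
have fE t q : f (t, q) = (if t \in I then ((F t \_ B) (toC2 q))%:E else 0)%E.
  rewrite /f /= indicE; case: ifPn => _; last by rewrite mul0r.
  rewrite mul1r; congr EFin; rewrite /patch /=.
  have -> // : ((t, toC2 q) \in U) = (toC2 q \in B).
  by apply/idP/idP; rewrite !inE => // -[].
have f0 p : (0 <= f p)%E.
  case: p => t q; rewrite fE; case: ifPn => // _; rewrite lee_fin.
  by apply: patch_ge0 => z Bz; exact: F0.
have mf : measurable_fun setT f.
  apply/measurable_EFinP; apply: measurable_funM => //.
  by apply: (measurableT_comp (measurable_indic mI)); exact: measurable_fst.
have cFz z : B z -> cont_itv 0 (2 * pi) (fun t => F t z).
  move=> Bz t _; apply: (@continuous_comp _ _ _ (fun t : R => (t, z)) (fun p : R * C2 R => F p.1 p.2)).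
    by apply: (@cvg_pair _ _ _ _ (nbhs t) (nbhs z)); [exact: cvg_id|exact: cvg_cst].
  exact: cF.
have key q : (\int[leb1 R]_t f (t, q))%E =
    (((fun z => \int[mu]_(t in `[0, 2 * pi]) F t z) \_ B) (toC2 q))%:E.
  have [Bq|Bq] := pselect (B (toC2 q)).
    rewrite patch_in// /Rintegral fineK.
      rewrite [RHS]integral_mkcond; apply: eq_integral => t _; rewrite fE.
      by rewrite patch_in.
    apply: integrable_fin_num => //; exact: cont_itv_integrable (cFz _ Bq).
  rewrite patch_out// integral0_eq// => t _; rewrite fE patch_out//.
  by case: ifP.
split.
  apply/measurable_EFinP.
  have := @measurable_fun_fubini_tonelli_G _ _ _ _ _ (leb1 R) _ mf f0.
  by congr measurable_fun; apply/funext => q; exact: key.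
rewrite /mass; under eq_integral => q _ do rewrite -key.
rewrite -(@fubini_tonelli _ _ _ _ _ (leb1 R) (@leb4 R) _ mf f0).
apply: (@le_trans _ _ (\int[leb1 R]_t (K * \1_I t)%:E)%E).
  apply: ge0_le_integral => //.
  - by move=> t _; exact: integral_ge0.
  - exact: (@measurable_fun_fubini_tonelli_F _ _ _ _ _ (@leb4 R) _ mf f0).
  - apply/measurable_EFinP; apply: measurable_funM => //.
  move=> t _; rewrite indicE; have [tI|tI] := boolP (t \in I).
    rewrite mulr1; apply: le_trans (FK t _); last by have : I t by [rewrite inE in tI]; rewrite /I /= in_itv.
    by rewrite le_eqVlt; apply/orP; left; apply/eqP; apply: eq_integral => q _; rewrite fE tI.
  by rewrite mulr0 integral0_eq// => q _; rewrite fE (negbTE tI).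
under eq_integral do rewrite EFinM.
rewrite ge0_integralZl//; last by apply/measurable_EFinP.
rewrite integral_indic// setIT /leb1 /I /= lebesgue_measure_itv/= lte_fin pi2 sube0.
by rewrite -EFinM lee_fin mulrC.
Qed.

End Tonelli.

(** * Concentration of the powers of a peak function *)

(** Compactness as an induction principle: a property of sets that is stable
    under finite unions and holds locally holds for a set covering [K]. *)
Lemma compact_ind (T : topologicalType) (K : set T) (good : set T -> Prop) :
  compact K -> good set0 -> (forall U V, good U -> good V -> good (U `|` V)) ->
  (forall y, K y -> exists2 U, good U & nbhs y U) -> exists2 U, good U & K `<=` U.
Proof.
move=> cK g0 gU gl; apply: contrapT => nc.
pose F : set_system T := [set A | exists2 U, good U & K `\` U `<=` A].
have FF : ProperFilter F.
  split.
    move=> [U gU' h]; apply: nc; exists U => // z Kz; apply: contrapT => Uz.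
    by apply: (h z); split.
  split.
  - by exists set0.
  - move=> A B [U gU' UA] [V gV VB]; exists (U `|` V); first exact: gU.
    by move=> z [Kz /not_orP[Uz Vz]]; split; [exact: UA|exact: VB].
  - by move=> A B AB [U gU' UA]; exists U => //; exact: subset_trans AB.
have FK : F K by exists set0 => // z [].
have [y [Ky cy]] := cK F FF FK.
have [U gU' yU] := gl y Ky.
have FU : F (~` U) by exists U => // z [].
by have [z []] := cy _ _ FU yU.
Qed.

Section MassCompare.
Variable R : realType.
Local Notation C := (Cplx R).

Lemma mass_setU (A B : set (C2 R)) (F : C2 R -> R) : mfunD A F -> mfunD B F ->
  mfunD (A `|` B) F -> (forall z, (A `|` B) z -> 0 <= F z) ->
  (mass (A `|` B) F <= mass A F + mass B F)%E.
Proof.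
move=> mA mB mAB F0.
have FA z : A z -> 0 <= F z by move=> Az; apply: F0; left.
have FB z : B z -> 0 <= F z by move=> Bz; apply: F0; right.
rewrite /mass -ge0_integralD//.
- apply: ge0_le_integral => //.
  + by move=> p _; rewrite lee_fin patch_ge0.
  + exact/measurable_EFinP.
  + apply: emeasurable_funD; exact/measurable_EFinP.
  + move=> p _; rewrite -EFinD lee_fin.
    have [[h|h]|h] := pselect ((A `|` B) (toC2 p)).
    * by rewrite patch_in; [rewrite (patch_in F h) lerDl patch_ge0|left].
    * by rewrite patch_in; [rewrite (patch_in F h) lerDr patch_ge0|right].
    * by rewrite (patch_out F h) addr_ge0// patch_ge0.
- by move=> p _; rewrite lee_fin patch_ge0.
- exact/measurable_EFinP.
- by move=> p _; rewrite lee_fin patch_ge0.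
- exact/measurable_EFinP.
Qed.

Lemma taff_continuous (a1 b1 a2 b2 : C) : continuous (taff a1 b1 a2 b2).
Proof.
move=> z; apply: (@cvg_pair _ _ _ _ (nbhs (a1 * z.1 + b1)) (nbhs (a2 * z.2 + b2))).
- apply: (@continuousD C C _ (fun z : C2 R => a1 * z.1) (fun=> b1)); last exact: cvg_cst.
  by apply: (@continuousM C _ (fun=> a1) fst); [exact: cvg_cst|exact: cvg_fst].
- apply: (@continuousD C C _ (fun z : C2 R => a2 * z.2) (fun=> b2)); last exact: cvg_cst.
  by apply: (@continuousM C _ (fun=> a2) snd); [exact: cvg_cst|exact: cvg_snd].
Qed.

Lemma sublevel_open (lam : C2 R -> R) (t : R) : continuous lam -> open [set z | lam z < t].
Proof. by move=> cl; apply: (@open_comp _ _ lam [set x | x < t]) ; [move=> x _; exact: cl|exact: open_lt]. Qed.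

Lemma superlevel_open (lam : C2 R -> R) (t : R) : continuous lam -> open [set z | t < lam z].
Proof. by move=> cl; apply: (@open_comp _ _ lam [set x | t < x]) ; [move=> x _; exact: cl|exact: open_gt]. Qed.

Variables (Omega : set (C2 R)) (M0 : R) (lam : C2 R -> R) (q : C2 R) (rho0 : R).
Hypotheses (oO : open Omega) (bO : bounded2 Omega M0).
Hypotheses (clam : continuous lam) (lam0 : forall z, 0 <= lam z).
Hypotheses (qO : closure Omega q) (lamq : lam q = 1).
Hypothesis lamO : forall z, Omega z -> lam z < 1.
Hypothesis nearO : forall z, near2 q rho0 z -> lam z < 1 -> Omega z.
Hypothesis mover : forall y, closure Omega y -> lam y = 1 -> exists a1 b1 a2 b2,
  [/\ a1 != 0, a2 != 0, taff a1 b1 a2 b2 y = q & forall z, lam (taff a1 b1 a2 b2 z) = lam z].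

(** The part of a polydisc around [q] below level [t] of [lam]. *)
Definition slab (rho t : R) : set (C2 R) := near2 q rho `&` [set z | lam z < t].

Lemma slab_open rho t : open (slab rho t).
Proof. by apply: openI; [exact: near2_open|exact: sublevel_open]. Qed.

Lemma slab_sub rho t : rho <= rho0 -> t <= 1 -> slab rho t `<=` Omega.
Proof.
by move=> r t1 z [[z1 z2] zt]; apply: nearO; [split; exact: lt_le_trans r|exact: lt_le_trans t1].
Qed.

Lemma lam_pow_mfun (D : set (C2 R)) n : open D -> mfunD D (fun z => lam z ^+ n).
Proof.
move=> oD; apply: mfunD_open => // z _.
by apply: (@continuous_comp _ _ _ lam (fun x => x ^+ n)); [exact: clam|exact: exprn_continuous].
Qed.

Lemma lam_pow_ge0 n z : 0 <= lam z ^+ n.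
Proof. exact/exprn_ge0/lam0. Qed.

Lemma leb4_Omega_fin : (@leb4 R (@toC2 R @^-1` Omega) < +oo)%E.
Proof. exact: leb4_bounded bO. Qed.

(** The level [1] is attained at [q], which is a limit of points of [Omega]; so
    the mass near [q] decays more slowly than every geometric rate below [1]. *)
Lemma slab_lower rho t : 0 < rho -> rho <= rho0 -> 0 <= t -> t < 1 ->
  exists2 v : R, 0 < v & forall n, ((v * t ^+ n)%:E <= mass (slab rho 1) (fun z => lam z ^+ n)%R)%E.
Proof.
move=> r0 rr t0 t1; pose D := slab rho 1 `&` [set z | t < lam z].
have oD : open D by apply: openI; [exact: slab_open|exact: superlevel_open].
have DO : D `<=` Omega by move=> z [/(slab_sub rr (lexx 1))].
have D0 : D !=set0.
  have nq : nbhs q (near2 q rho `&` [set z | t < lam z]).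
    apply: filterI; first exact: nbhs_near2.
    by apply: open_nbhs_nbhs; split; [exact: superlevel_open|rewrite /= lamq].
  by have [z [Oz [zr zt]]] := qO nq; exists z; split => //; split => //; exact: lamO.
have lD0 := leb4_open_gt0 oD D0.
have lDf : @leb4 R (@toC2 R @^-1` D) \is a fin_num.
  rewrite ge0_fin_numE//; apply: le_lt_trans leb4_Omega_fin.
  by apply: le_measure; rewrite ?inE//; [exact: mbase_measurable (@mbase_toC2 R) _..|move=> z /DO].
exists (fine (@leb4 R (@toC2 R @^-1` D))); first by rewrite fine_gt0// lD0 ltey_eq lDf.
move=> n; rewrite mulrC EFinM fineK// -mass_cst ?exprn_ge0//.
apply: mass_le.
- by apply: mfunD_open => // z _; exact: cvg_cst.
- by apply: lam_pow_mfun; exact: slab_open.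
- by move=> z [].
- by move=> z _; exact: exprn_ge0.
- by move=> z [_ /= /ltW tz]; rewrite lerXn2r ?nnegrE.
- by move=> z _; exact: lam_pow_ge0.
Qed.

(** A fixed proportion of the mass of [lam ^+ n] lies near [q]: the points of
    the boundary where [lam] is maximal can all be moved to [q], and everywhere
    else the mass decays geometrically. *)
Lemma mass_compare rho : 0 < rho -> rho <= rho0 -> exists2 K : R, 0 < K &
  forall n, (mass Omega (fun z => lam z ^+ n)%R <= K%:E * mass (slab rho 1) (fun z => lam z ^+ n)%R)%E.
Proof.
move=> r0 rr; set B := slab rho 1.
have oB : open B by exact: slab_open.
have mB0 n : (0 <= mass B (fun z => lam z ^+ n)%R)%E.
  by apply: mass_ge0 => z _; exact: lam_pow_ge0.
pose good (U : set (C2 R)) := open U /\ exists2 K : R, 0 <= K & forall n,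
  (mass (U `&` Omega) (fun z => lam z ^+ n)%R <= K%:E * mass B (fun z => lam z ^+ n)%R)%E.
have goodU U V : good U -> good V -> good (U `|` V).
  move=> [oU [K K0 UK]] [oV [L L0 VL]]; split; first exact: openU.
  exists (K + L) => [|n]; first by rewrite addr_ge0.
  rewrite setIUl EFinD ge0_muleDl ?lee_fin//.
  apply: le_trans (leeD (UK n) (VL n)); apply: mass_setU.
  - by apply: lam_pow_mfun; exact: openI.
  - by apply: lam_pow_mfun; exact: openI.
  - by apply: lam_pow_mfun; apply: openU; exact: openI.
  - by move=> z _; exact: lam_pow_ge0.
have goodx y : closure Omega y -> exists U, good U /\ U y.
  move=> Oy; have [ly|ly] := ltP (lam y) 1.
    pose t := (1 + lam y) / 2; have := lam0 y => y0.
    have t0 : 0 <= t by rewrite /t; lra.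
    have t1 : t < 1 by rewrite /t; lra.
    have [v v0 vP] := slab_lower r0 rr t0 t1.
    exists [set z | lam z < t]; split; last by rewrite /= /t; lra.
    split; first exact: sublevel_open.
    have Of : @leb4 R (@toC2 R @^-1` Omega) \is a fin_num by rewrite ge0_fin_numE// leb4_Omega_fin.
    set l := fine (@leb4 R (@toC2 R @^-1` Omega)); have l0 : 0 <= l by exact: fine_ge0.
    exists (l / v) => [|n]; first by rewrite divr_ge0// ltW.
    apply: (@le_trans _ _ ((l / v)%:E * (v * t ^+ n)%:E)%E); last first.
      by apply: lee_wpmul2l => //; rewrite lee_fin divr_ge0// ltW.
    rewrite -EFinM mulrA divfK ?gt_eqF// mulrC EFinM fineK// -mass_cst ?exprn_ge0//.
    apply: mass_le.
    + by apply: lam_pow_mfun; apply: openI => //; exact: sublevel_open.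
    + by apply: mfunD_open => // z _; exact: cvg_cst.
    + by move=> z [].
    + by move=> z _; exact: lam_pow_ge0.
    + by move=> z [/= /ltW zt _]; rewrite lerXn2r ?nnegrE.
    + by move=> z _; exact: exprn_ge0.
  have {}ly : lam y = 1.
    apply/eqP; rewrite eq_le ly andbT leNgt; apply/negP => ly1.
    have ny : nbhs y [set z | 1 < lam z] by apply: open_nbhs_nbhs; split; [exact: superlevel_open|].
    by have [z [Oz /=]] := Oy _ ny; rewrite ltNge ltW// lamO.
  have [a1 [b1 [a2 [b2 [a10 a20 Ty lT]]]]] := mover Oy ly.
  pose U := taff a1 b1 a2 b2 @^-1` near2 q rho.
  have oU : open U.
    by apply: (@open_comp _ _ _ (near2 q rho)) => [x _|]; [exact: taff_continuous|exact: near2_open].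
  exists U; split; last by rewrite /U /= Ty; exact: near2_refl.
  split=> //; set J := cmod a1 ^+ 2 * cmod a2 ^+ 2.
  have J0 : 0 < J by rewrite mulr_gt0// exprn_gt0// cmod_gt0.
  exists J^-1 => [|n]; first by rewrite invr_ge0 ltW.
  have TE : (fun z => lam (taff a1 b1 a2 b2 z) ^+ n) = (fun z => lam z ^+ n).
    by apply/funext => z; rewrite lT.
  have := @mass_taff R (U `&` Omega) B (fun z => lam z ^+ n) a1 b1 a2 b2 a10 a20.
  rewrite TE -/J => /(_ (lam_pow_mfun n oB) (lam_pow_mfun n (openI oU oO))).
  move=> /(_ (fun z _ => lam_pow_ge0 n z)) h; rewrite muleC lee_pdivlMr//.
  by rewrite muleC; apply: h => z [Uz Oz]; split=> //; rewrite /= lT lamO.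
have cO : compact (closure Omega) := compact_C2 (bounded2_closure bO) (@closed_closure _ Omega).
have good0 : good set0.
  split; first exact: open0.
  exists 0 => // n; rewrite mul0e set0I /mass integral0_eq// => p _.
  by rewrite patch_out.
have [|U [_ [K K0 KP]] OU] := compact_ind cO good0 goodU.
  move=> y /goodx[U [gU Uy]]; exists U => //.
  by apply: open_nbhs_nbhs; split=> //; case: gU.
exists (K + 1); first by rewrite ltr_wpDl.
move=> n; apply: (@le_trans _ _ (K%:E * mass B (fun z => lam z ^+ n)%R)%E); last first.
  by apply: lee_wpmul2r => //; rewrite lee_fin lerDl.
apply: le_trans (KP n); rewrite (_ : _ `&` Omega = Omega)//.
by apply/setIidPr => z /subset_closure/OU.
Qed.

Lemma slab_fin rho t n : rho <= rho0 -> t <= 1 ->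
  mass (slab rho t) (fun z => lam z ^+ n)%R \is a fin_num.
Proof.
move=> r1 t1; rewrite ge0_fin_numE; last by apply: mass_ge0 => z _; exact: lam_pow_ge0.
have sO := slab_sub r1 t1.
apply: (@mass_bounded R (slab rho t) M0 _ 1); first exact: slab_open.
- by move=> z /sO/bO.
- by apply: lam_pow_mfun; exact: slab_open.
by move=> z /sO/lamO/ltW lz; rewrite lam_pow_ge0 exprn_ile1.
Qed.

(** Monotone convergence as [t] tends to [1]. *)
Lemma slab_exhaust rho n : 0 < rho -> rho <= rho0 -> exists2 t : R, 0 < t < 1 &
  (mass (slab rho 1) (fun z => lam z ^+ n)%R <= 2%:E * mass (slab rho t) (fun z => lam z ^+ n)%R)%E.
Proof.
move=> r0 rr; pose t j : R := 1 - j.+2%:R^-1.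
have t01 j : 0 < t j < 1.
  have j0 : (0 : R) < j.+2%:R^-1 by rewrite invr_gt0 ltr0n.
  have j1 : (j.+2%:R^-1 : R) < 1 by rewrite invf_lt1 ?ltr1n ?ltr0n.
  by rewrite /t subr_gt0 j1 ltrBlDr ltrDl j0.
pose S j := @toC2 R @^-1` slab rho (t j).
have mS j : measurable (S j) by apply: mbase_measurable (@mbase_toC2 R) _; exact: slab_open.
have massE D : mass D (fun z => lam z ^+ n)%R = (\int[@leb4 R]_(p in @toC2 R @^-1` D) (lam (toC2 p) ^+ n)%:E)%E.
  rewrite [RHS]integral_mkcond; apply: eq_integral => p _; rewrite /patch /=.
  by have -> : (p \in @toC2 R @^-1` D) = (toC2 p \in D) by []; case: ifP.
have US : \bigcup_j S j = @toC2 R @^-1` slab rho 1.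
  apply/seteqP; split => [p [j _ [h1 h2]]|p [h1 h2]].
    by split=> //; rewrite /= (lt_trans h2)//; have /andP[] := t01 j.
  have l1 : 0 < 1 - lam (toC2 p) by rewrite subr_gt0.
  have [j jP] := ltr_add_invr (y := 0) (x := 1 - lam (toC2 p)) l1.
  exists j => //; split => //=; rewrite /t.
  have : (j.+2%:R^-1 : R) < j.+1%:R^-1 by rewrite ltf_pV2 ?posrE ?ltr0n// ltr_nat.
  move: jP; rewrite add0r => jP j2; rewrite ltrBrDr addrC -ltrBrDr.
  exact: lt_trans jP.
have ndS : {homo S : i j / (i <= j)%N >-> (i <= j)%O}.
  move=> i j ij; apply/subsetPset => p [h1 h2]; split=> //=; rewrite (lt_le_trans h2)// /t.
  by rewrite lerD2l lerN2 lef_pV2 ?posrE ?ltr0n// ler_nat !ltnS.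
have mf D : open D -> measurable_fun (@toC2 R @^-1` D) (fun p : R4 R => (lam (toC2 p) ^+ n)%:E).
  move=> oD; apply/measurable_EFinP; apply: (@mbase_mfun R _ _ _ _ D (fun z => lam z ^+ n) (@mbase_toC2 R) oD) => z _.
  by apply: (@continuous_comp _ _ _ lam (fun x => x ^+ n)); [exact: clam|exact: exprn_continuous].
have := @ge0_nondecreasing_set_cvg_integral _ _ R S (fun p : R4 R => (lam (toC2 p) ^+ n)%:E) (@leb4 R) ndS mS.
move=> /(_ (fun i => mf _ (@slab_open rho (t i)))) /(_ (fun i p _ => lam_pow_ge0 n (toC2 p))).
rewrite US -massE => cv.
have fin1 := slab_fin n rr (lexx 1).
have [m0|m0] := leP (mass (slab rho 1) (fun z => lam z ^+ n)%R) 0%E.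
  exists (t 0); first exact: t01.
  by apply: (le_trans m0); rewrite mule_ge0//; apply: mass_ge0 => z _; exact: lam_pow_ge0.
rewrite -(fineK fin1) in cv m0 *; set m := fine _ in cv m0 *.
have /fine_cvgP[_ /cvgrPdist_lt cv'] := cv.
have m20 : 0 < m / 2 by move: m0; rewrite lte_fin => ?; rewrite divr_gt0.
have [N _ /(_ N (leqnn N)) /=] := cv' _ m20.
rewrite -massE => h; exists (t N); first exact: t01.
have finN : mass (slab rho (t N)) (fun z => lam z ^+ n)%R \is a fin_num.
  by apply: slab_fin => //; have /andP[_ /ltW] := t01 N.
rewrite -(fineK finN) -EFinM lee_fin.
by move: h; rewrite ltr_norml => /andP[_]; lra.
Qed.

(** Below level [t] the power is at most [t ^+ n], while the mass of [Omega] decays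
    no faster than [s ^+ n] for a rate [s] between [t] and [1]. *)
Lemma slab_tail rho t e : 0 < rho -> rho <= rho0 -> 0 < t < 1 -> 0 < e -> exists N, forall n, (N <= n)%N ->
  (mass (slab rho t) (fun z => lam z ^+ n)%R <= e%:E * mass Omega (fun z => lam z ^+ n)%R)%E.
Proof.
move=> r0 rr /andP[t0 t1] e0; pose s := (1 + t) / 2.
have s0 : 0 < s by rewrite /s; lra.
have s1 : s < 1 by rewrite /s; lra.
have [v v0 vP] := slab_lower r0 rr (ltW s0) s1.
have Of : @leb4 R (@toC2 R @^-1` Omega) \is a fin_num by rewrite ge0_fin_numE// leb4_Omega_fin.
set l := fine (@leb4 R (@toC2 R @^-1` Omega)); have l0 : 0 <= l by exact: fine_ge0.
have ts : `|t / s| < 1.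
  rewrite ger0_norm; last by rewrite divr_ge0// ltW.
  by rewrite ltr_pdivrMr// mul1r /s; lra.
have ev0 : 0 < e * v / (l + 1) by rewrite divr_gt0 ?mulr_gt0//; lra.
have [N _ NP] := (@cvgrPdist_lt _ _ _ _ _ _ _).1 (cvg_expr ts) _ ev0.
exists N => n /NP /=; rewrite sub0r normrN ger0_norm; last by rewrite exprn_ge0// divr_ge0// ltW.
rewrite expr_div_n ltr_pdivlMr; last by lra.
move=> h; have sn0 : 0 < s ^+ n by exact: exprn_gt0.
have h2 : t ^+ n * l <= e * v * s ^+ n.
  move: h; rewrite mulrAC ltr_pdivrMr// => /ltW; apply: le_trans.
  by rewrite ler_wpM2l ?exprn_ge0 ?ltW// ltrDl.
apply: (@le_trans _ _ (t ^+ n * l)%:E).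
  rewrite EFinM fineK// -mass_cst ?exprn_ge0 ?(ltW t0)//; apply: mass_le.
  - by apply: lam_pow_mfun; exact: slab_open.
  - by apply: mfunD_open => // z _; exact: cvg_cst.
  - by apply: slab_sub => //; exact: ltW.
  - by move=> z _; exact: lam_pow_ge0.
  - by move=> z [_ /= /ltW zt]; rewrite lerXn2r ?nnegrE// ltW.
  - by move=> z _; rewrite exprn_ge0// ltW.
apply: (@le_trans _ _ (e%:E * (v * s ^+ n)%:E)%E); first by rewrite -EFinM lee_fin mulrA.
apply: lee_wpmul2l; first by rewrite lee_fin ltW.
apply: (le_trans (vP n)); apply: mass_le.
- by apply: lam_pow_mfun; exact: slab_open.
- exact: lam_pow_mfun.
- exact: slab_sub.
- by move=> z _; exact: lam_pow_ge0.
- by [].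
- by move=> z _; exact: lam_pow_ge0.
Qed.

End MassCompare.

(** * Cauchy's formula up to an error *)

Section CauchyDefect.
Variable R : realType.
Local Notation C := (Cplx R).
Local Notation mu := (@lebesgue_measure R).

Lemma cmod_kern_int (c : C) (r : R) (z : C) : 0 < r -> cmod (z - c) < r ->
  cmod (cint 0 (2 * pi) (kern c r z)) <= r / (r - cmod (z - c)) * (2 * pi).
Proof.
move=> r0 zr; rewrite -[2 * pi in leRHS]subr0; apply: cmod_cint_le.
- by rewrite ltW// twopi_gt0.
- by apply: cont_kern => //; exact: ltW.
- by move=> t _; exact: cmod_kern_le.
Qed.

(** Cauchy's formula holds for [h], so the defect of [u] is governed by [u - h].
    That distance is known only against the weight [w] and will be integrated in
    square mean, hence the factor [w ^+ 2] and the splitting of [v * w] by the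
    arithmetic-geometric inequality with the free parameter [d]. *)
Lemma cauchy_defect (u h : C -> C) (v : C -> R) (c : C) (r : R) (z : C) (w D d : R) :
  0 < r -> cmod (z - c) < r ->
  (forall s, cmod (s - c) <= r -> cderivable h s) ->
  cont_itv 0 (2 * pi) (fun t => u (circ c r t)) ->
  cont_itv 0 (2 * pi) (fun t => v (circ c r t)) ->
  0 <= w -> 0 <= D -> 0 < d ->
  (forall s, cmod (s - c) <= r -> 0 <= v s) ->
  (forall s, cmod (s - c) <= r -> cmod (u s - h s) * w <= D * v s) ->
  cmod (u z * cint 0 (2 * pi) (kern c r z) -
        cint 0 (2 * pi) (fun t => u (circ c r t) * kern c r z t)) * w ^+ 2 <=
  r / (r - cmod (z - c)) * D *
  (d^-1 * (2 * pi * v z ^+ 2 + \int[mu]_(t in `[0, 2 * pi]) v (circ c r t) ^+ 2) +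
   4 * pi * d * w ^+ 2).
Proof.
move=> r0 zr dh cu cv w0 D0 d0 v0 uh; set K := r / _.
have pi2 : 0 <= 2 * pi :> R by rewrite ltW// twopi_gt0.
have K0 : 0 <= K by rewrite divr_ge0 ?ltW// subr_gt0.
have cr t : cmod (circ c r t - c) <= r by rewrite cmod_circ// ltW.
have ck := @cont_kern R c r z 0 (2 * pi) (ltW r0) zr.
have ch : cont_itv 0 (2 * pi) (fun t => h (circ c r t)).
  move=> t _; apply: (@continuous_comp _ _ _ (circ c r) h); first exact: continuous_circ.
  exact/cderivable_continuous/dh.
have cuk := cont_itvM cu ck; have chk := cont_itvM ch ck.
have cuh := cont_itvB cu ch; have cuhk := cont_itvM cuh ck.
have -> : u z * cint 0 (2 * pi) (kern c r z) -
    cint 0 (2 * pi) (fun t => u (circ c r t) * kern c r z t) =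
    (u z - h z) * cint 0 (2 * pi) (kern c r z) -
    cint 0 (2 * pi) (fun t => (u (circ c r t) - h (circ c r t)) * kern c r z t).
  rewrite [cint _ _ (fun t => (_ - _) * _)](_ : _ = cint 0 (2 * pi) (fun t => u (circ c r t) * kern c r z t) -
      cint 0 (2 * pi) (fun t => h (circ c r t) * kern c r z t)).
    by rewrite -(cauchy_formula r0 zr dh); ring.
  by rewrite -(cintB cuk chk); apply: eq_cint => t _; rewrite mulrBl.
have cv2 : cont_itv 0 (2 * pi) (fun t => v (circ c r t) ^+ 2).
  by apply: (@cont_itv_comp R R R _ _ _ (fun x => x ^+ 2)) cv => x _; exact: exprn_continuous.
(* weighted arithmetic-geometric mean *)
have am x : 0 <= x -> x * w <= d^-1 * x ^+ 2 + d * w ^+ 2.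
  move=> x0; rewrite -(ler_pM2l d0).
  have -> : d * (d^-1 * x ^+ 2 + d * w ^+ 2) = x ^+ 2 + (d * w) ^+ 2 by field; rewrite gt_eqF.
  have h3 := sqr_ge0 (x - d * w); have : 0 <= d * (x * w) by rewrite !mulr_ge0// ltW.
  rewrite !expr2 in h3 *; nra.
have zr' := ltW zr.
have B1 : cmod ((u z - h z) * cint 0 (2 * pi) (kern c r z)) * w ^+ 2 <=
    K * D * (2 * pi * (d^-1 * v z ^+ 2 + d * w ^+ 2)).
  rewrite cmodM expr2 mulrACA.
  have h1 := uh z zr'; have h2 := cmod_kern_int r0 zr.
  have -> : K * D * (2 * pi * (d^-1 * v z ^+ 2 + d * w ^+ 2)) =
     (D * (d^-1 * v z ^+ 2 + d * w ^+ 2)) * (K * (2 * pi)) by ring.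
  have -> : cmod (u z - h z) * w * (cmod (cint 0 (2 * pi) (kern c r z)) * w) =
     (cmod (u z - h z) * w * w) * cmod (cint 0 (2 * pi) (kern c r z)) by ring.
  apply: ler_pM; rewrite ?mulr_ge0 ?cmod_ge0//.
  apply: (@le_trans _ _ (D * v z * w)); first by rewrite ler_wpM2r.
  by rewrite -mulrA ler_wpM2l//; apply: am; exact: v0.
have B2 : cmod (cint 0 (2 * pi) (fun t => (u (circ c r t) - h (circ c r t)) * kern c r z t)) * w ^+ 2 <=
    K * D * (d^-1 * \int[mu]_(t in `[0, 2 * pi]) v (circ c r t) ^+ 2 + 2 * pi * (d * w ^+ 2)).
  have -> : cmod (cint 0 (2 * pi) (fun t => (u (circ c r t) - h (circ c r t)) * kern c r z t)) * w ^+ 2 =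
      cmod (cint 0 (2 * pi) (fun t => (w ^+ 2)%:C%C * ((u (circ c r t) - h (circ c r t)) * kern c r z t))).
    by rewrite (cintZ _ cuhk) cmodM cmod_real ger0_norm ?sqr_ge0// mulrC.
  apply: le_trans (cmod_cint (cont_itvZ (c := (w ^+ 2)%:C%C) cuhk)) _.
  have cR : cont_itv 0 (2 * pi) (fun t => K * D * (d^-1 * v (circ c r t) ^+ 2 + d * w ^+ 2)).
    apply: (@cont_itv_comp R R R _ _ (fun t => v (circ c r t) ^+ 2) (fun x => K * D * (d^-1 * x + d * w ^+ 2))) cv2 => x _.
    apply: (@continuousM R R (fun=> K * D) (fun x => d^-1 * x + d * w ^+ 2)); first exact: cvg_cst.
    apply: (@continuousD R R R (fun x => d^-1 * x) (fun=> d * w ^+ 2)); last exact: cvg_cst.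
    by apply: (@continuousM R R (fun=> d^-1) id); [exact: cvg_cst|exact: cvg_id].
  apply: (@le_trans _ _ (\int[mu]_(t in `[0, 2 * pi]) (K * D * (d^-1 * v (circ c r t) ^+ 2 + d * w ^+ 2)))).
    apply: le_rint.
    - exact: cont_itv_cmod (cont_itvZ (c := (w ^+ 2)%:C%C) cuhk).
    - exact: cR.
    move=> t _; rewrite cmodM cmod_real ger0_norm ?sqr_ge0// [cmod (_ * kern _ _ _ _)]cmodM.
    have h1 := uh _ (cr t); have h2 := cmod_kern_le t r0 zr.
    have -> : w ^+ 2 * (cmod (u (circ c r t) - h (circ c r t)) * cmod (kern c r z t)) =
      (cmod (u (circ c r t) - h (circ c r t)) * w * w) * cmod (kern c r z t) by ring.
    have -> : K * D * (d^-1 * v (circ c r t) ^+ 2 + d * w ^+ 2) =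
      (D * (d^-1 * v (circ c r t) ^+ 2 + d * w ^+ 2)) * K by ring.
    apply: ler_pM; rewrite ?mulr_ge0 ?cmod_ge0//.
    apply: (@le_trans _ _ (D * v (circ c r t) * w)); first by rewrite ler_wpM2r.
    by rewrite -mulrA ler_wpM2l//; apply: am; exact: v0.
  have -> : \int[mu]_(t in `[0, 2 * pi]) (K * D * (d^-1 * v (circ c r t) ^+ 2 + d * w ^+ 2)) =
      \int[mu]_(t in `[0, 2 * pi]) (K * D * (d * w ^+ 2) + K * D * d^-1 * v (circ c r t) ^+ 2 + 0 * v (circ c r t) ^+ 2).
    by apply: eq_Rintegral => t _; ring.
  by rewrite (rint_affine _ _ _ pi2 cv2 cv2) le_eqVlt; apply/orP; left; apply/eqP; ring.
apply: (@le_trans _ _ (K * D * (2 * pi * (d^-1 * v z ^+ 2 + d * w ^+ 2)) +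
   K * D * (d^-1 * \int[mu]_(t in `[0, 2 * pi]) v (circ c r t) ^+ 2 + 2 * pi * (d * w ^+ 2)))).
  apply: le_trans (lerD B1 B2); rewrite -mulrDl ler_wpM2r ?sqr_ge0//.
  exact: cmodB.
rewrite le_eqVlt; apply/orP; left; apply/eqP; ring.
Qed.

End CauchyDefect.

(** * Approximation by holomorphic functions near a peak point *)

(** Near [q] the function [phi] is a quotient [P / g] of holomorphic functions, up
    to an error [e] in the mean square against the weight [cmod (g z) ^+ 2]. The
    weights have total mass at least [K] near [q] independently of [e], do not
    vanish, and are comparable along the level sets of [lam]. *)
Definition asymptotically_holomorphic (R : realType) (Omega : set (C2 R))
    (phi : C2 R -> Cplx R) (lam : C2 R -> R) (q : C2 R) (rho0 D : R) : Prop :=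
  forall rho, 0 < rho -> rho <= rho0 -> exists2 K : R, 0 < K &
  forall e, 0 < e -> exists g : C2 R -> Cplx R, exists P : C2 R -> Cplx R, exists t : R,
  [/\ 0 < t < 1, forall z, differentiable g z /\ (Omega z -> differentiable P z),
   forall z w, near2 q rho0 z -> near2 q rho0 w -> lam z = lam w -> lam z < 1 ->
     g w != 0 /\ cmod (g z) <= D * cmod (g w),
   (K%:E <= sqmass (slab lam q rho t) g)%E &
   (sqmass (slab lam q rho0 t) (fun z => phi z * g z - P z)%R <= e%:E)%E].

Section Peaks.
Variable R : realType.
Local Notation C := (Cplx R).
Local Notation mu := (@lebesgue_measure R).

Variables (Omega : set (C2 R)) (M0 : R) (lam : C2 R -> R) (q : C2 R) (rho0 : R).
Hypotheses (oO : open Omega) (bO : bounded2 Omega M0) (rho00 : 0 < rho0).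
Hypotheses (clam : continuous lam) (lam0 : forall z, 0 <= lam z).
Hypotheses (qO : closure Omega q) (lamq : lam q = 1).
Hypothesis lamO : forall z, Omega z -> lam z < 1.
Hypothesis nearO : forall z, near2 q rho0 z -> lam z < 1 -> Omega z.
Hypothesis mover : forall y, closure Omega y -> lam y = 1 -> exists a1 b1 a2 b2,
  [/\ a1 != 0, a2 != 0, taff a1 b1 a2 b2 y = q & forall z, lam (taff a1 b1 a2 b2 z) = lam z].
Hypothesis lamN : forall z, near2 q rho0 z -> 0 < lam z.

Variables (G : nat -> C2 R -> C) (CG cG : R).
Hypotheses (CG0 : 0 < CG) (cG0 : 0 < cG).
Hypothesis hG : forall n z, differentiable (G n) z.
Hypothesis GCG : forall n z, Omega z -> cmod (G n z) <= CG * lam z ^+ n.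
Hypothesis GcG : forall n z, near2 q rho0 z -> cG * lam z ^+ n <= cmod (G n z).

Variable phi : C2 R -> C.
Hypothesis cphi : {within closure Omega, continuous phi}.
Hypothesis HC : compact_operator Omega (hankel Omega phi).

Lemma phi_cont z : Omega z -> {for z, continuous phi}.
Proof.
move=> Oz; have cO : {within Omega, continuous phi}.
  by apply: continuous_subspaceW cphi; exact: subset_closure.
by move: cO; rewrite (continuous_open_subspace phi oO) => /(_ z); apply; rewrite inE.
Qed.

Lemma phi_bound : exists2 K : R, 0 < K & forall z, closure Omega z -> cmod (phi z) <= K.
Proof.
have cO : compact (closure Omega) := compact_C2 (bounded2_closure bO) (@closed_closure _ Omega).
have [d d0 dP] := uniform_continuity cO cphi ltr01.
have [|||U [K K0 UK] OU] := @compact_ind _ (closure Omega) (fun U => exists2 K : R, 0 < K &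
  forall z, closure Omega z -> U z -> cmod (phi z) <= K) cO.
- by exists 1 => // z _ [].
- move=> U V [K K0 UK] [L L0 VL]; exists (Num.max K L); first by rewrite lt_max K0.
  by move=> z Oz [/(UK _ Oz) h|/(VL _ Oz) h]; rewrite le_max h// orbT.
- move=> y Oy; exists (near2 y d); last exact: nbhs_near2.
  exists (cmod (phi y) + 1); first by rewrite ltr_wpDl// cmod_ge0.
  move=> z Oz yz; have := dP y z Oy Oz yz; have := ler_cmodD_dist (phi z) (phi y); lra.
by exists K => // z Oz; apply: UK => //; exact: OU.
Qed.


Let Lm n := mass Omega (fun z => lam z ^+ n)%R.

Let slabO rho t : rho <= rho0 -> t <= 1 -> slab lam q rho t `<=` Omega.
Proof. by move=> h1 h2; exact: (slab_sub nearO h1 h2). Qed.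

Lemma mass_lam_fin n : Lm n \is a fin_num.
Proof.
rewrite ge0_fin_numE; last by apply: mass_ge0 => z _; exact: lam_pow_ge0.
apply: (@mass_bounded R _ M0 _ 1 oO bO (lam_pow_mfun clam n oO)) => z Oz.
by rewrite exprn_ge0//= exprn_ile1// ltW// lamO.
Qed.

Lemma mass_lam_gt0 n : (0 < Lm n)%E.
Proof.
have h : 0 <= 2^-1 :> R /\ 2^-1 < 1 :> R by split; lra.
have [v v0 vP] := slab_lower oO bO clam lam0 qO lamq lamO nearO rho00 (lexx _) h.1 h.2.
apply: (@lt_le_trans _ _ (v * 2^-1 ^+ n)%:E).
  by rewrite lte_fin mulr_gt0// exprn_gt0// invr_gt0.
apply: le_trans (vP n) _; apply: mass_le.
- by apply: lam_pow_mfun => //; exact: slab_open.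
- exact: lam_pow_mfun.
- exact: slabO.
- by move=> z _; exact: exprn_ge0.
- by move=> z _.
- by move=> z _; exact: exprn_ge0.
Qed.

Let m n : R := fine (Lm (n * 2)%N).

Let m0 n : 0 < m n.
Proof. by apply: fine_gt0; rewrite mass_lam_gt0/= ltey_eq mass_lam_fin. Qed.

Let mE n : Lm (n * 2)%N = (m n)%:E.
Proof. by rewrite fineK// mass_lam_fin. Qed.

Let g n (z : C2 R) : C := ((Num.sqrt (m n))^-1)%:C%C * G n z.

Let g_sqr n z : cmod (g n z) ^+ 2 = (m n)^-1 * cmod (G n z) ^+ 2.
Proof.
rewrite /g [cmod (_ * _)]cmodM cmod_real exprMn ger0_norm ?invr_ge0 ?sqrtr_ge0// exprVn.
by rewrite sqr_sqrtr// ltW.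
Qed.

Let dg n z : differentiable (g n) z.
Proof. by apply: differentiableM => //; exact: differentiable_cst. Qed.

Let cg n z : {for z, continuous (g n)}.
Proof. exact: differentiable_continuous (dg n z). Qed.

Let g_le n z : Omega z -> cmod (g n z) ^+ 2 <= CG ^+ 2 / m n * lam z ^+ (n * 2)%N.
Proof.
move=> Oz; rewrite g_sqr mulrAC mulrC ler_pM2r ?invr_gt0// exprM -exprMn.
by rewrite ler_pXn2r ?nnegrE ?cmod_ge0 ?GCG// mulr_ge0 ?exprn_ge0// ltW.
Qed.

Let g_ge n z : near2 q rho0 z -> cG ^+ 2 / m n * lam z ^+ (n * 2)%N <= cmod (g n z) ^+ 2.
Proof.
move=> Oz; rewrite g_sqr mulrAC mulrC ler_pM2l ?invr_gt0// exprM -exprMn.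
by rewrite ler_pXn2r ?nnegrE ?cmod_ge0 ?GcG// mulr_ge0 ?exprn_ge0// ltW.
Qed.

Lemma peak_sqmass n : (sqmass Omega (g n) <= (CG ^+ 2)%:E)%E.
Proof.
have h : 0 <= CG ^+ 2 / m n by rewrite divr_ge0 ?sqr_ge0// ltW.
apply: (@le_trans _ _ (mass Omega (fun z => CG ^+ 2 / m n * lam z ^+ (n * 2)%N))).
  apply: mass_le => //.
  - by apply: sqmass_fun.
  - by apply: mfunDZ; exact: lam_pow_mfun.
  - by move=> z _; exact: sqr_ge0.
  - by move=> z; exact: g_le.
  - by move=> z _; rewrite mulr_ge0// exprn_ge0.
rewrite massZ//; last 2 first.
- exact: lam_pow_mfun.
- by move=> z _; exact: exprn_ge0.
by rewrite -/(Lm _) mE -EFinM lee_fin divfK// gt_eqF.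
Qed.

(** The functions [G n] are normalised to [g n]. Compactness makes
    [phi * (g k - g l)] nearly holomorphic in mean square for large [k] and [l].
    For fixed [k], a level [t] is chosen that keeps half of the mass of [g k] near
    [q]; below that level [g l] becomes negligible when [l] grows, and what is left
    is [phi * g k]. *)
Lemma peaks_asymptotically_holomorphic :
  asymptotically_holomorphic Omega phi lam q rho0 (CG / cG).
Proof.
move=> rho r0 rr.
have [K K0 KP] := mass_compare oO bO clam lam0 qO lamq lamO nearO mover r0 rr.
exists (cG ^+ 2 / (2 * K)); first by rewrite divr_gt0 ?exprn_gt0 ?mulr_gt0.
move=> e e0.
have [L L0 LP] := phi_bound.
have hg n : holomorphic_on Omega (g n) by move=> z _.
have bg : exists M : R, forall n, (sqmass Omega (g n) <= M%:E)%E.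
  by exists (CG ^+ 2) => n; exact: peak_sqmass.
have [s sinc [p hp sp]] := hankel_cauchy oO phi_cont HC hg bg.
have e4 : 0 < e / 4 by rewrite divr_gt0.
have [N NP] := sp _ e4.
have [t t01 tP] := slab_exhaust bO clam lam0 lamO nearO (s N * 2) r0 rr.
have [t0 t1] := andP t01.
pose e' := e / (4 * L ^+ 2 * CG ^+ 2).
have LC : 0 < 4 * L ^+ 2 * CG ^+ 2 by rewrite !mulr_gt0 ?exprn_gt0.
have e'0 : 0 < e' by rewrite divr_gt0.
have [N' N'P] := slab_tail oO bO clam lam0 qO lamq lamO nearO rho00 (lexx _) t01 e'0.
pose l := maxn N N'.
have sl : (N' <= s l * 2)%N.
  have : (l <= s l)%N.
    elim: l => // l IH; exact: leq_ltn_trans IH (sinc _ _ (ltnSn l)).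
  move=> lsl; apply: leq_trans (leq_maxr N N') _; apply: leq_trans lsl _; exact: leq_pmulr.
exists (g (s N)), (fun z => p N z - p l z), t; split.
- exact: t01.
- move=> z; split=> [|Oz]; first exact: dg.
  exact: (differentiableB (hp N z Oz) (hp l z Oz)).
- move=> z w zq wq zw z1; set n := s N.
  have k0 : 0 < cmod ((Num.sqrt (m n))^-1)%:C%C.
    by rewrite cmod_real normr_gt0 invr_neq0// gt_eqF// sqrtr_gt0.
  split; first rewrite -cmod_gt0 /g [cmod (_ * _)]cmodM mulr_gt0//.
    by apply: lt_le_trans (GcG n wq); rewrite mulr_gt0// exprn_gt0// lamN.
  rewrite /g ![cmod (_ * _)]cmodM mulrCA ler_pM2l//.
  apply: le_trans (GCG n (nearO zq z1)) _; rewrite zw.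
  have := GcG n wq; rewrite -(ler_pM2l (divr_gt0 CG0 cG0)); apply: le_trans.
  by rewrite mulrA divfK ?gt_eqF.
- have h : 0 <= cG ^+ 2 / m (s N) by rewrite divr_ge0 ?sqr_ge0// ltW.
  apply: (@le_trans _ _ (mass (slab lam q rho t) (fun z => cG ^+ 2 / m (s N) * lam z ^+ (s N * 2)%N)%R)).
    rewrite massZ//; last 2 first.
    - by apply: lam_pow_mfun => //; exact: slab_open.
    - by move=> z _; exact: exprn_ge0.
    have f1 := slab_fin bO clam lam0 lamO nearO (s N * 2) rr (lexx 1).
    have f2 := slab_fin bO clam lam0 lamO nearO (s N * 2) rr (ltW t1).
    move: (KP (s N * 2)%N) tP; rewrite -/(Lm _) mE -(fineK f1) -(fineK f2) -!EFinM !lee_fin.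
    set x := fine _; set y := fine _ => mx xy.
    have mm : m (s N) <= 2 * K * y by have : K * x <= K * (2 * y) by [rewrite ler_pM2l]; lra.
    rewrite -[leRHS]mulrA ler_pM2l ?exprn_gt0// [leRHS]mulrC ler_pdivlMr// [leLHS]mulrC.
    by rewrite ler_pdivrMr ?mulr_gt0// [leRHS]mulrC.
  apply: mass_le => //.
  - by apply: mfunDZ; apply: lam_pow_mfun => //; exact: slab_open.
  - by apply: sqmass_fun; [exact: slab_open|move=> z _].
  - by move=> z _; rewrite mulr_ge0// exprn_ge0.
  - by move=> z [[z1 z2] _]; apply: g_ge; split; exact: lt_le_trans rr.
  - by move=> z _; exact: sqr_ge0.
- set S := slab lam q rho0 t.
  have SO : S `<=` Omega by apply: slabO => //; exact: ltW.
  have oS : open S by exact: slab_open.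
  pose U z := phi z * (g (s N) z - g (s l) z) - (p N z - p l z).
  have cp k z : Omega z -> {for z, continuous (p k)} by exact: holomorphic_continuous.
  have cU z : Omega z -> {for z, continuous U}.
    move=> Oz; apply: (@continuousB _ _ _ (fun z => phi z * (g (s N) z - g (s l) z)) (fun z => p N z - p l z)).
      have cgB : {for z, continuous (fun z => g (s N) z - g (s l) z)}.
        by apply: (@continuousB _ _ _ (g (s N)) (g (s l))); exact: cg.
      exact: (continuousM (phi_cont Oz) cgB).
    exact: (continuousB (cp N z Oz) (cp l z Oz)).
  have cV z : Omega z -> {for z, continuous (fun z => phi z * g (s N) z - (p N z - p l z))}.
    move=> Oz; apply: (@continuousB _ _ _ (fun z => phi z * g (s N) z) (fun z => p N z - p l z)).
      have cgN : {for z, continuous (g (s N))} by exact: cg.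
      exact: (continuousM (phi_cont Oz) cgN).
    exact: (continuousB (cp N z Oz) (cp l z Oz)).
  have Lg : 0 <= 2 * L ^+ 2 * (CG ^+ 2 / m (s l)) by rewrite !mulr_ge0// ?invr_ge0 ?sqr_ge0// ltW.
  have mU : mfunD S (fun z => 2 * cmod (U z) ^+ 2).
    by apply: mfunDZ; apply: sqmass_fun => // z /SO; exact: cU.
  have mL : mfunD S (fun z => 2 * L ^+ 2 * (CG ^+ 2 / m (s l)) * lam z ^+ (s l * 2)%N).
    by apply: mfunDZ; exact: lam_pow_mfun.
  apply: (@le_trans _ _ (mass S (fun z => 2 * cmod (U z) ^+ 2 + 2 * L ^+ 2 * (CG ^+ 2 / m (s l)) * lam z ^+ (s l * 2)%N)%R)).
    apply: mass_le => //.
    - by apply: sqmass_fun => // z /SO; exact: cV.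
    - exact: mfunDD mU mL.
    - by move=> z _; exact: sqr_ge0.
    - move=> z /SO Oz; rewrite (_ : _ - _ = U z - - (phi z * g (s l) z)); last by rewrite /U; ring.
      apply: le_trans (cmodB_sqr _ _) _; rewrite lerD2l -[2 * L ^+ 2 * _]mulrA -[leRHS]mulrA ler_pM2l// -[leRHS]mulrA.
      rewrite cmodN [cmod (_ * _)]cmodM exprMn ler_pM ?sqr_ge0//; last exact: g_le.
      have h := LP z (@subset_closure _ Omega z Oz).
      by rewrite !expr2 ler_pM ?cmod_ge0.
    - by move=> z _; apply: addr_ge0; [rewrite mulr_ge0 ?sqr_ge0|rewrite mulr_ge0// exprn_ge0].
  rewrite massD//; last 2 first.
  - by move=> z _; rewrite mulr_ge0 ?sqr_ge0.
  - by move=> z _; rewrite mulr_ge0// exprn_ge0.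
  rewrite !massZ//; last 4 first.
  - exact: lam_pow_mfun.
  - by move=> z _; exact: exprn_ge0.
  - by apply: sqmass_fun => // z /SO; exact: cU.
  - by move=> z _; exact: sqr_ge0.
  have -> : e%:E = ((e / 2)%:E + (e / 2)%:E)%E by rewrite -EFinD -splitr.
  apply: leeD.
    apply: (@le_trans _ _ (2%:E * (e / 4)%:E)%E); last by rewrite -EFinM lee_fin; lra.
    rewrite lee_pmul2l//; apply: le_trans (NP N l (leqnn _) (leq_maxl _ _)).
    apply: mass_le => //.
    - by apply: sqmass_fun => // z /SO; exact: cU.
    - exact: (sqmass_fun oO cU).
    - by move=> z _; exact: sqr_ge0.
    - by move=> z _; exact: sqr_ge0.
  have f2 := slab_fin bO clam lam0 lamO nearO (s l * 2) (lexx _) (ltW t1).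
  move: (N'P _ sl); rewrite -/S -/(Lm _) mE -(fineK f2) -!EFinM !lee_fin.
  set y := fine _ => yh.
  have := ler_wpM2l Lg yh; move=> h; apply: le_trans h _.
  rewrite /e' le_eqVlt; apply/orP; left; apply/eqP; field.
  by rewrite !gt_eqF ?m0.
Qed.


End Peaks.

(** * Transport of the approximation along a holomorphic family of affine maps *)

Section Flow.
Variable R : realType.
Local Notation C := (Cplx R).
Local Notation mu := (@lebesgue_measure R).

Variables (Omega : set (C2 R)) (M0 : R) (phi : C2 R -> C) (lam : C2 R -> R) (q : C2 R) (rho0 D : R).
Hypotheses (oO : open Omega) (bO : bounded2 Omega M0) (rho00 : 0 < rho0) (D0 : 0 < D).
Hypothesis cphi : {within closure Omega, continuous phi}.
Hypothesis clam : continuous lam.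
Hypothesis nearO : forall z, near2 q rho0 z -> lam z < 1 -> Omega z.
Hypothesis quasi : asymptotically_holomorphic Omega phi lam q rho0 D.

Variables (A1 B1 A2 B2 : C -> C) (f : C -> C2 R) (z0 : C) (r0 : R).
Hypothesis r00 : 0 < r0.
Let T (s : C) := taff (A1 s) (B1 s) (A2 s) (B2 s).
Hypothesis dA : forall s, cmod (s - z0) <= r0 ->
  [/\ cderivable A1 s, cderivable B1 s, cderivable A2 s & cderivable B2 s].
Hypothesis A0 : [/\ A1 z0 = 1, B1 z0 = 0, A2 z0 = 1 & B2 z0 = 0].
Hypothesis lamT : forall s z, cmod (s - z0) <= r0 -> lam (T s z) = lam z.
Hypothesis Tq : forall s, cmod (s - z0) <= r0 -> T s q = f s.
Hypothesis fO : forall s, cmod (s - z0) <= r0 -> closure Omega (f s).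

(** Near [z0] the maps are close to the identity: they move points little and
    distort volumes by bounded factors. *)
Let flow_near : exists2 r, 0 < r <= r0 & forall s, cmod (s - z0) <= r ->
  [/\ 2^-1 <= cmod (A1 s) <= 2, 2^-1 <= cmod (A2 s) <= 2 &
   forall z, near2 q (rho0 / 4) z -> near2 q rho0 (T s z)].
Proof.
have [A10 B10 A20 B20] := A0.
pose e := Num.min 2^-1 (rho0 / (2 * (cmod q.1 + cmod q.2 + 1))).
have q0 : 0 < cmod q.1 + cmod q.2 + 1 by rewrite ltr_wpDl// addr_ge0// cmod_ge0.
have e0 : 0 < e by rewrite lt_min invr_gt0 ltr0n/= divr_gt0// mulr_gt0.
have e2 : e <= 2^-1 by rewrite ge_min lexx.
have eq0 : e * (cmod q.1 + cmod q.2 + 1) <= rho0 / 2.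
  have : e <= rho0 / (2 * (cmod q.1 + cmod q.2 + 1)) by rewrite ge_min lexx orbT.
  rewrite ler_pdivlMr ?mulr_gt0//; lra.
have z00 : cmod (z0 - z0) <= r0 by rewrite subrr cmod0 ltW.
have [dA1 dB1 dA2 dB2] := dA z00.
have small g : cderivable g z0 -> exists2 d, 0 < d & forall s, cmod (s - z0) < d -> cmod (g s - g z0) < e.
  move=> /cderivable_continuous cg.
  exact: (@nbhs_cmodP R z0 _).1 ((@cvg_cmodP R _ _ _ g (g z0)).1 cg e e0).
have [d1 d10 h1] := small _ dA1; have [d2 d20 h2] := small _ dB1.
have [d3 d30 h3] := small _ dA2; have [d4 d40 h4] := small _ dB2.
exists (Num.min r0 (Num.min (Num.min d1 d2) (Num.min d3 d4) / 2)).
  by rewrite lt_min r00 ge_min lexx divr_gt0// !lt_min d10 d20 d30 d40.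
move=> s; rewrite le_min => /andP[sr0]; set m := Num.min _ _ => sm.
have m0 : 0 < m by rewrite !lt_min d10 d20 d30 d40.
have : cmod (s - z0) < m by lra.
rewrite !lt_min => /andP[/andP[s1 s2] /andP[s3 s4]].
have {h1} := h1 _ s1; have {h2} := h2 _ s2; have {h3} := h3 _ s3; have {h4} := h4 _ s4.
rewrite A10 B10 A20 B20 !subr0 => h4 h3 h2 h1.
have bd (a : C) : cmod (a - 1) < e -> 2^-1 <= cmod a <= 2.
  move=> ae; have := ler_cmodD_dist a 1; have := ler_cmodD_dist 1 a.
  by rewrite (cmodBC 1 a) cmod1 => ? ?; apply/andP; split; lra.
have ba1 := bd _ h1; have ba2 := bd _ h3.
split=> // z [z1 z2].
have mv (a b x y : C) (Q : R) : cmod (a - 1) < e -> cmod b < e -> cmod a <= 2 ->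
   cmod (x - y) < rho0 / 4 -> cmod y <= Q -> e * (Q + 1) <= rho0 / 2 -> cmod (a * x + b - y) < rho0.
  move=> ae be a2 xy yQ eQ.
  have -> : a * x + b - y = a * (x - y) + ((a - 1) * y + b) by ring.
  have := cmodD (a * (x - y)) ((a - 1) * y + b); have := cmodD ((a - 1) * y) b.
  rewrite !cmodM.
  have : cmod a * cmod (x - y) <= 2 * (rho0 / 4) by rewrite ler_pM ?cmod_ge0// ltW.
  have : cmod (a - 1) * cmod y <= e * Q by rewrite ler_pM ?cmod_ge0// ltW.
  lra.
have Q1 := cmod_ge0 q.1; have Q2 := cmod_ge0 q.2.
split; rewrite /T /taff /=.
- by apply: (mv _ _ _ _ (cmod q.1 + cmod q.2)) => //; [case/andP: ba1|lra].
- by apply: (mv _ _ _ _ (cmod q.1 + cmod q.2)) => //; [case/andP: ba2|lra].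
Qed.

Let T_cont s : cmod (s - z0) <= r0 -> forall z, {for (s, z), continuous (fun p : C * C2 R => T p.1 p.2)}.
Proof.
move=> sr z; have [dA1 dB1 dA2 dB2] := dA sr.
have cf (g : C -> C) : cderivable g s -> {for (s, z), continuous (fun p : C * C2 R => g p.1)}.
  by move=> /cderivable_continuous cg; apply: (@continuous_comp _ _ _ fst g); [exact: cvg_fst|exact: cg].
have c1 : {for (s, z), continuous (fun p : C * C2 R => p.2.1)}.
  by apply: (@continuous_comp _ _ _ snd fst); [exact: cvg_snd|exact: cvg_fst].
have c2 : {for (s, z), continuous (fun p : C * C2 R => p.2.2)}.
  by apply: (@continuous_comp _ _ _ snd snd); [exact: cvg_snd|exact: cvg_snd].
apply: (@cvg_pair _ _ _ _ (nbhs (A1 s * z.1 + B1 s)) (nbhs (A2 s * z.2 + B2 s))).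
- exact: (@continuousD C C _ _ _ _ (continuousM (cf _ dA1) c1) (cf _ dB1)).
- exact: (@continuousD C C _ _ _ _ (continuousM (cf _ dA2) c2) (cf _ dB2)).
Qed.

Let T_diff s z : cmod (s - z0) <= r0 -> differentiable (fun s => T s z) s.
Proof.
move=> sr; have [dA1 dB1 dA2 dB2] := dA sr.
apply: differentiable_pair.
- apply/cderivP; apply: cderivableD dB1; apply: cderivableM dA1 _; exact: cderivable_cst.
- apply/cderivP; apply: cderivableD dB2; apply: cderivableM dA2 _; exact: cderivable_cst.
Qed.

Let phi_path (g : R -> C2 R) : continuous g -> (forall t, closure Omega (g t)) ->
  forall t, {for t, continuous (fun t => phi (g t))}.
Proof.
move=> cg gO t; apply/cvg_cmodP => e e0.
have [d d0 dP] := within_cmodP cphi (gO t) e0.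
have h : nbhs t (g @^-1` near2 (g t) d) by exact: (cg t _ (nbhs_near2 (g t) d0)).
apply: (@filterS _ (nbhs t) _ _ _ _ h) => x /= gx; exact: dP.
Qed.

Let circ_near r s t : 0 <= r -> r <= r0 -> cmod (circ s r t - s) <= r0.
Proof. by move=> r1 r2; rewrite cmod_circ. Qed.

Let T_path r z : 0 <= r -> r <= r0 -> continuous (fun t => T (circ z0 r t) z).
Proof.
move=> r1 r2 t; have cT := T_cont (circ_near z0 t r1 r2) (z := z).
have cc : {for t, continuous (fun t => (circ z0 r t, z))}.
  apply: (@cvg_pair _ _ _ _ (nbhs (circ z0 r t)) (nbhs z)); first exact: continuous_circ.
  exact: cvg_cst.
exact: (continuous_comp cc cT).
Qed.

(** Let [W z] be the defect in Cauchy's formula of the function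
    [s -> phi (T s z)]. It is continuous at [q], so if [W q] were not zero,
    [cmod (W z)] would exceed some [e0] near [q]. But [s -> P (T s z) / g (T s z)]
    is holomorphic, since [T s] preserves the levels of [lam] on which [g] is
    controlled, and by [cauchy_defect] the mean square of [W] against the weight
    is at most a constant times [e]. Hence [W q = 0], which is Cauchy's formula for
    [s -> phi (f s)]. *)
Lemma flow_cderivable : cderivable (fun s => phi (f s)) z0.
Proof.
have [r /andP[r1 r2] rP] := flow_near; have r10 := ltW r1.
have zs s : cmod (s - z0) <= r -> cmod (s - z0) <= r0 by move=> h; apply: le_trans h r2.
have cs t : cmod (circ z0 r t - z0) <= r by rewrite cmod_circ.
pose rho1 := rho0 / 4; have rho10 : 0 < rho1 by rewrite divr_gt0.
have rho11 : rho1 <= rho0 by have := rho00; rewrite /rho1; lra.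
have phif t : {for t, continuous (fun t => phi (f (circ z0 r t)))}.
  have := @phi_path (fun t => T (circ z0 r t) q) (T_path r10 r2) _ t.
  have E t' : T (circ z0 r t') q = f (circ z0 r t') by rewrite Tq// zs.
  rewrite (_ : (fun t => phi (T _ _)) = (fun t => phi (f (circ z0 r t)))).
    by apply => t'; rewrite E; apply/fO/zs.
  by apply/funext => t'; rewrite E.
have TO s z : cmod (s - z0) <= r -> near2 q rho1 z -> lam z < 1 ->
    near2 q rho0 (T s z) /\ Omega (T s z).
  move=> sr zq z1; have [_ _ h] := rP s sr; have h' := h z zq.
  by split=> //; apply: nearO => //; rewrite lamT// zs.
apply: (cauchy_integral_cderivable r1 r1 (lexx r)) => [t _|s sr]; first exact: phif.
have srW := ltW sr.
set k := kern z0 r s; pose Kk : R := r / (r - cmod (s - z0)).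
have KkE : r / (r - cmod (s - z0)) = Kk by [].
have Kk0 : 0 < Kk by rewrite divr_gt0// subr_gt0.
clearbody Kk.
have ck : cont_itv 0 (2 * pi) k by apply: cont_kern.
have kK t : cmod (k t) <= Kk by rewrite -KkE; exact: cmod_kern_le.
have p0 := twopi_gt0 R.
have pi0 : 0 < pi :> R := pi_gt0 R.
pose W z := phi (T s z) * cint 0 (2 * pi) k - cint 0 (2 * pi) (fun t => phi (T (circ z0 r t) z) * k t).
suff Wq : W q = 0.
  move: Wq => /eqP; rewrite subr_eq0 Tq ?zs// => /eqP ->.
  by apply: eq_cint => t _; rewrite Tq// zs.
apply/eqP/negPn/negP => Wq; rewrite -cmod_gt0 in Wq.
pose e0 := cmod (W q) / 2; have e0E : cmod (W q) = 2 * e0 by rewrite /e0; field.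
have e00 : 0 < e0 by rewrite divr_gt0.
clearbody e0.
have Kn : Kk != 0 by rewrite gt_eqF.
have pin : pi != 0 :> R by rewrite gt_eqF.
have Dn : D != 0 by rewrite gt_eqF.
pose om := e0 / (2 * (2 * pi) * Kk).
have omE : om * (Kk * (2 * pi)) = e0 / 2.
  rewrite /om; move: (pi : R) pin => p pn; field; by rewrite ?Kn ?pn.
have om0 : 0 < om by rewrite divr_gt0// !mulr_gt0.
have cO : compact (closure Omega) := compact_C2 (bounded2_closure bO) (@closed_closure _ Omega).
have [d d0 dP] := uniform_continuity cO cphi om0.
pose rho := Num.min rho1 (d / 2).
have rho_0 : 0 < rho by rewrite lt_min rho10 divr_gt0.
have rhoL : rho <= rho1 by rewrite ge_min lexx.
have rhoD : 2 * rho <= d by have : rho <= d / 2 by [rewrite ge_min lexx orbT]; lra.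
have cphiT z : near2 q rho1 z -> lam z < 1 -> cont_itv 0 (2 * pi) (fun t => phi (T (circ z0 r t) z)).
  move=> zq z1 t _; apply: (@phi_path (fun t => T (circ z0 r t) z)); first exact: T_path.
  by move=> t'; have [_ h] := TO _ z (cs t') zq z1; exact: subset_closure h.
have cphiq : cont_itv 0 (2 * pi) (fun t => phi (T (circ z0 r t) q)).
  move=> t _; apply: (@phi_path (fun t => T (circ z0 r t) q)); first exact: T_path.
  by move=> t'; rewrite Tq ?zs//; exact/fO/zs.
have phi_close s' z : cmod (s' - z0) <= r -> near2 q rho z -> lam z < 1 ->
    cmod (phi (T s' z) - phi (T s' q)) <= om.
  move=> s'r [zq1 zq2] z1; have [/andP[_ a1] /andP[_ a2] _] := rP s' s'r.
  have [_ h] := TO s' z s'r (conj (lt_le_trans zq1 rhoL) (lt_le_trans zq2 rhoL)) z1.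
  apply/ltW/dP; [by rewrite Tq ?zs//; exact/fO/zs|exact: subset_closure h|].
  have mv (a b x y : C) : cmod a <= 2 -> cmod (x - y) < rho -> cmod (a * x + b - (a * y + b)) < d.
    move=> a2' xy; have -> : a * x + b - (a * y + b) = a * (x - y) by ring.
    rewrite cmodM; have : cmod a * cmod (x - y) <= 2 * cmod (x - y) by rewrite ler_wpM2r ?cmod_ge0.
    lra.
  by split; apply: mv.
have WW z : near2 q rho z -> lam z < 1 -> e0 <= cmod (W z).
  move=> zq z1; have zq1 : near2 q rho1 z by case: zq => h1 h2; split; exact: lt_le_trans rhoL.
  suff : cmod (W z - W q) <= e0.
    by have := ler_cmodD_dist (W q) (W z); rewrite (cmodBC (W q)) e0E; lra.
  have -> : W z - W q = (phi (T s z) - phi (T s q)) * cint 0 (2 * pi) k -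
      cint 0 (2 * pi) (fun t => (phi (T (circ z0 r t) z) - phi (T (circ z0 r t) q)) * k t).
    have -> : cint 0 (2 * pi) (fun t => (phi (T (circ z0 r t) z) - phi (T (circ z0 r t) q)) * k t) =
        cint 0 (2 * pi) (fun t => phi (T (circ z0 r t) z) * k t - phi (T (circ z0 r t) q) * k t).
      by apply: eq_cint => t _; rewrite mulrBl.
    by rewrite (cintB (cont_itvM (cphiT z zq1 z1) ck) (cont_itvM cphiq ck)) /W; ring.
  apply: le_trans (cmodB _ _) _.
  have h1 : cmod ((phi (T s z) - phi (T s q)) * cint 0 (2 * pi) k) <= om * (Kk * (2 * pi)).
    rewrite cmodM ler_pM ?cmod_ge0//; first exact: phi_close.
    by rewrite -KkE; exact: cmod_kern_int.
  have h2 : cmod (cint 0 (2 * pi) (fun t => (phi (T (circ z0 r t) z) - phi (T (circ z0 r t) q)) * k t)) <= om * Kk * (2 * pi).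
    rewrite -[2 * pi in leRHS]subr0; apply: cmod_cint_le; first exact: ltW.
      exact: (cont_itvM (cont_itvB (cphiT z zq1 z1) cphiq) ck).
    by move=> t _; rewrite cmodM ler_pM ?cmod_ge0//; exact: phi_close.
  by move: h2; rewrite -mulrA; lra.
have rho_le0 : rho <= rho0 := le_trans rhoL rho11.
have BO z : near2 q rho z -> near2 q rho1 z by case=> h1 h2; split; exact: lt_le_trans rhoL.
(* [dl] makes the second term of [cauchy_defect] half of the lower bound [e0], and
   [e] makes the first one too small for the mass [K] *)
pose dl := e0 / (8 * pi * Kk * D).
have dl0 : 0 < dl by rewrite divr_gt0 ?mulr_gt0.
have h4 : Kk * D * (4 * pi * dl) = e0 / 2 by rewrite /dl; move: (pi : R) pin => p pn; field; rewrite ?Kn ?pn ?Dn.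
clearbody dl.
have dln : dl != 0 by rewrite gt_eqF.
have [K K0 KP] := quasi rho_0 rho_le0.
pose e := e0 * K * dl / (256 * pi * Kk * D).
have e_0 : 0 < e by apply: divr_gt0; rewrite !mulr_gt0.
have [g [P [t [/andP[t0 t1] gP ratio lowK upE]]]] := KP e e_0.
pose V z := cmod (phi z * g z - P z).
pose B := slab lam q rho t; pose E := slab lam q rho0 t.
have oB : open B by exact: slab_open.
have oE : open E by exact: slab_open.
have V0 z : 0 <= V z ^+ 2 by exact: sqr_ge0.
have lt1 z : lam z < t -> lam z < 1 by move=> h; exact: lt_trans h t1.
have TB s' z : cmod (s' - z0) <= r -> B z -> E (T s' z) /\ Omega (T s' z).
  move=> s'r [zq zt]; have [h1 h2] := TO s' z s'r (BO z zq) (lt1 z zt).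
  by split=> //; split=> //=; rewrite lamT// zs.
have cV z : Omega z -> {for z, continuous (fun z => phi z * g z - P z)}.
  move=> Oz; have [dg dP'] := gP z.
  have cg : {for z, continuous g} := differentiable_continuous dg.
  have cP : {for z, continuous P} := differentiable_continuous (dP' Oz).
  exact: (continuousB (continuousM (phi_cont oO cphi Oz) cg) cP).
have cV2 z : Omega z -> {for z, continuous (fun z => V z ^+ 2)}.
  by move=> Oz; apply: continuous_sqmod; exact: cV.
have mVT s' : cmod (s' - z0) <= r -> mfunD B (fun z => V (T s' z) ^+ 2).
  move=> s'r; apply: mfunD_open => // z Bz; have [_ h] := TB s' z s'r Bz.
  exact: (continuous_comp (@taff_continuous R _ _ _ _ z) (cV2 _ h)).
have mVE : mfunD E (fun z => V z ^+ 2).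
  apply: mfunD_open => // z [zq zt]; apply: cV2; apply: nearO => //; exact: lt1.
have VT s' : cmod (s' - z0) <= r -> (mass B (fun z => V (T s' z) ^+ 2)%R <= (16 * e)%:E)%E.
  move=> s'r; have [/andP[a1 _] /andP[a2 _] _] := rP s' s'r.
  have n1 : A1 s' != 0 by rewrite -cmod_gt0; apply: lt_le_trans a1; rewrite invr_gt0.
  have n2 : A2 s' != 0 by rewrite -cmod_gt0; apply: lt_le_trans a2; rewrite invr_gt0.
  have h := mass_taff n1 n2 mVE (mVT s' s'r) (fun z _ => V0 z) (fun z Bz => (TB s' z s'r Bz).1).
  have h16 : 16^-1 <= cmod (A1 s') ^+ 2 * cmod (A2 s') ^+ 2.
    have -> : 16^-1 = 2^-1 * 2^-1 * (2^-1 * 2^-1) :> R by field.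
    by rewrite !expr2 !ler_pM// ?mulr_ge0// invr_ge0.
  have M0' : (0 <= mass B (fun z => V (T s' z) ^+ 2)%R)%E by apply: mass_ge0 => z _.
  have {h} : (16^-1%:E * mass B (fun z => V (T s' z) ^+ 2)%R <= e%:E)%E.
    apply: le_trans upE; apply: le_trans h; apply: lee_wpmul2r => //.
  have i16 : 0 < 16 :> R by [].
  move=> h; have := lee_wpmul2l (ltW i16 : (0 <= 16%:E)%E) h.
  by rewrite muleA -!EFinM divff// mul1e.
have cF t' z : B z -> {for (t', z), continuous (fun p : R * C2 R => V (T (circ z0 r p.1) p.2) ^+ 2)}.
  move=> Bz; have [_ h] := TB _ z (cs t') Bz.
  have cT := T_cont (zs _ (cs t')) (z := z).
  have cc : {for (t', z), continuous (fun p : R * C2 R => (circ z0 r p.1, p.2))}.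
    have c1 : {for (t', z), continuous (fun p : R * C2 R => circ z0 r p.1)}.
      apply: (@continuous_comp (R * C2 R)%type R C fst (circ z0 r)); first exact: cvg_fst.
      exact: continuous_circ.
    by apply: (@cvg_pair _ _ _ _ (nbhs (circ z0 r t')) (nbhs z)); [exact: c1|exact: cvg_snd].
  exact: (continuous_comp (continuous_comp cc cT) (cV2 _ h)).
have e16 : 0 <= 16 * e by rewrite mulr_ge0// ltW.
have [mI MI] := mass_rint oB e16 cF (fun t' z _ => V0 _) (fun t' _ => VT _ (cs t')).
set I := (fun z => \int[mu]_(t in `[0, 2 * pi]) _) in mI MI.
pose c := Kk * D / dl; have c0 : 0 < c by rewrite divr_gt0 ?mulr_gt0.
have I0 z : 0 <= I z by apply: Rintegral_ge0 => x _; exact: V0.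
have main z : B z -> e0 / 2 * cmod (g z) ^+ 2 <= c * (2 * pi) * V (T s z) ^+ 2 + c * I z.
  move=> Bz; have [zq zt] := Bz; have z1 := lt1 z zt.
  have zn : near2 q rho0 z by case: zq => h1 h2; split; exact: lt_le_trans rho_le0.
  have gn s' : cmod (s' - z0) <= r -> g (T s' z) != 0 /\ cmod (g z) <= D * cmod (g (T s' z)).
    by move=> s'r; have [[h _] _] := TB s' z s'r Bz; apply: ratio => //; rewrite lamT// zs.
  have dT s' : cmod (s' - z0) <= r -> differentiable (fun s' => T s' z) s'.
    by move=> s'r; apply: T_diff; exact: zs.
  have ch s' : cmod (s' - z0) <= r -> cderivable (fun s' => P (T s' z) * (g (T s' z))^-1) s'.
    move=> s'r; have [dg dP'] := gP (T s' z); have [_ h] := TB s' z s'r Bz.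
    apply: cderivableM; last apply: cderivableV.
    - apply/cderivP; exact: (differentiable_comp (dT s' s'r) (dP' h)).
    - apply/cderivP; exact: (differentiable_comp (dT s' s'r) dg).
    - by case: (gn s' s'r).
  have cv : cont_itv 0 (2 * pi) (fun t => V (T (circ z0 r t) z)).
    move=> t' _; have [_ h] := TB _ z (cs t') Bz.
    have := continuous_comp (continuous_comp (T_path r10 r2 (z := z) (x := t')) (cV _ h)) (@continuous_cmod R _).
    by [].
  have cd s' : cmod (s' - z0) <= r ->
      cmod (phi (T s' z) - P (T s' z) * (g (T s' z))^-1) * cmod (g z) <= D * V (T s' z).
    move=> s'r; have [gn0 gD] := gn s' s'r.
    have -> : phi (T s' z) - P (T s' z) * (g (T s' z))^-1 =
      (phi (T s' z) * g (T s' z) - P (T s' z)) / g (T s' z) by field.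
    rewrite cmodM cmodV -/(V _) mulrAC -mulrA mulrC [D * _]mulrC.
    by rewrite mulrC ler_wpM2l ?cmod_ge0// ler_pdivrMr ?cmod_gt0.
  have := cauchy_defect r1 sr ch (cphiT z (BO z zq) z1) cv (cmod_ge0 (g z)) (ltW D0) dl0 (fun _ _ => cmod_ge0 _) cd.
  have := WW z zq z1; rewrite /W -/k KkE => w1 w2.
  have : e0 * cmod (g z) ^+ 2 <= Kk * D * (dl^-1 * (2 * pi * V (T s z) ^+ 2 + I z) + 4 * pi * dl * cmod (g z) ^+ 2).
    by apply: le_trans w2; rewrite ler_wpM2r ?sqr_ge0.
  have -> : Kk * D * (dl^-1 * (2 * pi * V (T s z) ^+ 2 + I z) + 4 * pi * dl * cmod (g z) ^+ 2) =
     c * (2 * pi) * V (T s z) ^+ 2 + c * I z + Kk * D * (4 * pi * dl) * cmod (g z) ^+ 2.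
    by rewrite /c; ring.
  by rewrite h4; lra.
have cp0 : 0 <= c * (2 * pi) by rewrite mulr_ge0 ?ltW.
have e20 : 0 <= e0 / 2 by rewrite divr_ge0 ?ltW.
have mg : mfunD B (fun z => cmod (g z) ^+ 2).
  by apply: sqmass_fun => // z _; apply: differentiable_continuous; case: (gP z).
have M1 : ((e0 / 2)%:E * sqmass B g <= mass B (fun z => c * (2 * pi) * V (T s z) ^+ 2 + c * I z)%R)%E.
  rewrite -massZ//; last by move=> z _; exact: sqr_ge0.
  apply: mass_le => //.
  - exact: mfunDZ mg.
  - exact: mfunDD (mfunDZ _ (mVT s srW)) (mfunDZ _ mI).
  - by move=> z _; rewrite mulr_ge0// sqr_ge0.
  - by move=> z _; rewrite addr_ge0// mulr_ge0// ltW.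
have M2 : (mass B (fun z => c * (2 * pi) * V (T s z) ^+ 2 + c * I z)%R <= (c * (2 * pi) * (16 * e) + c * (2 * pi * (16 * e)))%:E)%E.
  rewrite massD; last 4 first.
  - exact: mfunDZ (mVT s srW).
  - exact: mfunDZ mI.
  - by move=> z _; rewrite mulr_ge0.
  - by move=> z _; rewrite mulr_ge0// ltW.
  rewrite massZ//; last exact: mVT.
  rewrite massZ//; last exact: ltW.
  rewrite EFinD !(EFinM (c * (2 * pi))) (EFinM c (2 * pi * (16 * e))); apply: leeD.
    by apply: lee_wpmul2l; [rewrite lee_fin|exact: VT].
  by apply: lee_wpmul2l; [rewrite lee_fin ltW|].
have := le_trans (lee_wpmul2l (e20 : (0 <= (e0 / 2)%:E)%E) lowK) (le_trans M1 M2).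
rewrite -EFinM lee_fin leNgt => /negP; apply.
have -> : c * (2 * pi) * (16 * e) + c * (2 * pi * (16 * e)) = e0 / 2 * K / 2.
  by rewrite /c /e; move: (pi : R) pin => p pn; field; rewrite ?Kn ?pn ?Dn ?dln.
have : 0 < e0 / 2 * K by rewrite mulr_gt0 ?divr_gt0.
lra.
Qed.

End Flow.

(** * Logarithmic convexity *)

Section LogarithmicBarrier.
Variable R : realType.
Local Notation C := (Cplx R).
Local Notation mu := (@lebesgue_measure R).

Lemma rint_cos : \int[mu]_(t in `[0, 2 * pi]) cos t = 0 :> R.
Proof.
rewrite (@rint_FTC R 0 (2 * pi) sin cos).
- by rewrite sin0 subr0 mulr_natl sin2pi.
- by rewrite ltW// twopi_gt0.
- by move=> t _; exact: continuous_cos.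
Qed.

(** From [ln (1 + x) <= x] applied to [cmod (1 + s) ^+ 2] and to its inverse. *)
Lemma ln_cmod_approx (s : C) : cmod s <= 4^-1 ->
  `|ln (cmod (1 + s)) - complex.Re s| <= 6 * cmod s ^+ 2.
Proof.
move=> s4; pose x := 2 * complex.Re s + cmod s ^+ 2.
have s0 := cmod_ge0 s; have := ler_Re_cmod s; rewrite ler_norml => /andP[sr1 sr2].
have E : cmod (1 + s) ^+ 2 = 1 + x.
  by rewrite cmod_sqr /x cmod_sqr; case: s {s4 x s0 sr1 sr2} => a b /=; rewrite add0r; ring.
set c := cmod s in s4 s0 sr1 sr2 *; set a := complex.Re s in sr1 sr2 *.
have c2 : c ^+ 2 <= c / 4 by rewrite expr2 ler_wpM2l//; lra.
have c20 : 0 <= c ^+ 2 := sqr_ge0 c.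
have x1 : x <= 9 / 4 * c by rewrite /x -/a -/c; lra.
have x2 : - (9 / 4 * c) <= x by rewrite /x -/a -/c; lra.
have xc : x = 2 * a + c ^+ 2 by [].
clearbody x.
have x0 : 7 / 16 <= 1 + x by lra.
have x00 : 0 < 1 + x by lra.
have lE : 2 * ln (cmod (1 + s)) = ln (1 + x).
  rewrite -E lnXn ?mulr_natl//; rewrite lt_neqAle cmod_ge0 andbT eq_sym.
  by apply/eqP => h; move: E; rewrite h expr0n /=; lra.
have up : ln (1 + x) <= x by apply: le_ln1Dx; lra.
pose y := (1 + x)^-1.
have y1 : y * (1 + x) = 1 by rewrite mulVf// gt_eqF.
have y0 : 0 < y by rewrite invr_gt0.
have y2 : y <= 16 / 7 by rewrite /y -[16 / 7]invrK lef_pV2 ?posrE ?invr_gt0 ?invf_div//; lra.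
have lo : - ln (1 + x) <= - x + x ^+ 2 * y.
  rewrite -lnV ?posrE// -/y.
  have yE : y = 1 + (- x + x ^+ 2 * y).
    have : (1 - x) * (y * (1 + x)) = 1 - x by rewrite y1 mulr1.
    lra.
  by rewrite [in leLHS]yE; apply: le_ln1Dx; lra.
have x2y : x ^+ 2 * y <= 12 * c ^+ 2.
  have h : x ^+ 2 <= 81 / 16 * c ^+ 2.
    have : (9 / 4 * c - x) * (9 / 4 * c + x) >= 0 by rewrite mulr_ge0//; lra.
    rewrite -subr_sqr; lra.
  have : x ^+ 2 * y <= 81 / 16 * c ^+ 2 * (16 / 7).
    by apply: ler_pM => //; [exact: sqr_ge0|exact: ltW].
  lra.
rewrite ler_norml; apply/andP; split; lra.
Qed.

(** On small circles of the disc in the direction [(d1 z1, d2 z2)], the increments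
    of the logarithmic barrier [l] have zero mean and are of second order, so
    [l ^+ 2] cannot compensate the strict subharmonicity of [|z|^2]. *)
Lemma psh_no_local_max (Omega : set (C2 R)) (u l : C2 R -> R) (z : C2 R)
    (d1 d2 c K e rho : R) :
  open Omega -> continuous_psh Omega u -> 0 < d2 -> 0 <= K -> 0 < e -> 0 < rho ->
  z.1 != 0 -> z.2 != 0 -> near2 z rho `<=` Omega ->
  (forall w, near2 z rho w -> l w = d1 * ln (cmod w.2) - d2 * ln (cmod w.1) - c) ->
  (forall w, near2 z rho w ->
    u w + e * (cmod w.1 ^+ 2 + cmod w.2 ^+ 2) - K * l w ^+ 2 <=
    u z + e * (cmod z.1 ^+ 2 + cmod z.2 ^+ 2) - K * l z ^+ 2) -> False.
Proof.
move=> oO [cu pu] d20 K0 e0 rho0 z1 z2 zO lE vz.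
pose E := d1 ^+ 2 * cmod z.1 ^+ 2 + d2 ^+ 2 * cmod z.2 ^+ 2.
pose F := d1 * cmod z.1 ^+ 2 + d2 * cmod z.2 ^+ 2.
have E0 : 0 < E.
  apply: ltr_wpDl; first by apply: mulr_ge0; exact: sqr_ge0.
  by apply: mulr_gt0; apply: exprn_gt0 => //; rewrite cmod_gt0.
pose L := 12 * `|d1| * `|d2| * (`|d1| + `|d2|) + 1.
have L0 : 0 < L by rewrite ltr_wpDl// !mulr_ge0 ?addr_ge0.
pose m : R := `|d1| + `|d2| + cmod z.1 + cmod z.2 + 1.
have [m0 [md1 md2] [mz1 mz2]] : [/\ 0 < m, `|d1| <= m /\ `|d2| <= m & cmod z.1 <= m /\ cmod z.2 <= m].
  have := normr_ge0 d1; have := normr_ge0 d2; have := cmod_ge0 z.1; have := cmod_ge0 z.2.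
  by rewrite /m => *; split; [lra|split; lra|split; lra].
have m2 : 0 < m * m by rewrite mulr_gt0.
pose r : R := Num.min 1 (Num.min ((4 * m)^-1) (Num.min (rho / (2 * (m * m))) (e * E / (2 * (K * L ^+ 2 + 1))))).
have KL : 0 <= K * L ^+ 2 by rewrite mulr_ge0// sqr_ge0.
have KL1 : 0 < K * L ^+ 2 + 1 by rewrite ltr_wpDl.
have r0 : 0 < r by rewrite !lt_min ltr01 invr_gt0 mulr_gt0//= !divr_gt0 ?mulr_gt0.
have [r1 r2 r3 r4] : [/\ r <= 1, r * m <= 4^-1, r * (m * m) < rho & K * L ^+ 2 * r < e * E].
  split.
  - by rewrite ge_min lexx.
  - have : r <= (4 * m)^-1 by rewrite !ge_min lexx !orbT.
    by rewrite invfM -ler_pdivlMr.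
  - have : r <= rho / (2 * (m * m)) by rewrite !ge_min lexx !orbT.
    rewrite ler_pdivlMr ?mulr_gt0// mulrCA; lra.
  - have : r <= e * E / (2 * (K * L ^+ 2 + 1)) by rewrite !ge_min lexx !orbT.
    rewrite ler_pdivlMr ?mulr_gt0//; have : 0 < e * E by rewrite mulr_gt0.
    lra.
clearbody r.
pose w : C2 R := ((r * d1)%:C%C * z.1, (r * d2)%:C%C * z.2).
have near t : cmod t <= 1 -> near2 z rho (z + t *: w).
  move=> t1; have h (d : R) (x : C) : `|d| <= m -> cmod x <= m -> cmod (x + t * ((r * d)%:C%C * x) - x) < rho.
    move=> dm xm; rewrite addrC addKr !cmodM cmod_real normrM (gtr0_norm r0).
    apply: le_lt_trans r3; rewrite -[leRHS]mul1r ler_pM ?mulr_ge0// ?cmod_ge0 ?(ltW r0)//.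
    by rewrite -mulrA ler_pM2l// ler_pM ?cmod_ge0.
  by split; apply: h.
pose s (d t : R) : C := (r * d)%:C%C * cis t.
have cs d t : cmod (s d t) = r * `|d|.
  by rewrite cmodM cmod_real cmod_cis mulr1 normrM (gtr0_norm r0).
have Rs d t : complex.Re (s d t) = r * d * cos t by rewrite /s /cis /= mul0r subr0.
have cs4 d t : `|d| <= m -> cmod (s d t) <= 4^-1.
  by move=> dm; rewrite cs; apply: le_trans r2; rewrite ler_pM2l.
have s1 d t : `|d| <= m -> 0 < cmod (1 + s d t).
  move=> dm; have := cs4 d t dm; have := ler_cmodD_dist 1 (- s d t).
  rewrite opprK cmodN cmod1; lra.
have ptE (x : C) d t : x + cis t * ((r * d)%:C%C * x) = x * (1 + s d t) by rewrite /s; ring.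
pose Dl t := d1 * ln (cmod (1 + s d2 t)) + - d2 * ln (cmod (1 + s d1 t)).
have nt t : near2 z rho (z + cis t *: w) by apply: near; rewrite cmod_cis.
have lpt t : l (z + cis t *: w) = l z + Dl t.
  rewrite lE//= lE; last exact: near2_refl.
  rewrite /= !ptE !cmodM !lnM ?posrE ?s1 ?cmod_gt0// /Dl; ring.
have sqE (x : C) d t : cmod (x * (1 + s d t)) ^+ 2 = cmod x ^+ 2 * (1 + 2 * (r * d * cos t) + r ^+ 2 * d ^+ 2).
  rewrite [cmod (x * _)]cmodM exprMn; congr (_ * _).
  have -> : cmod (1 + s d t) ^+ 2 = 1 + 2 * complex.Re (s d t) + cmod (s d t) ^+ 2.
    by rewrite !cmod_sqr; case: (s d t) => a b /=; rewrite add0r; ring.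
  by rewrite Rs cs exprMn real_normK ?num_real.
have Dl2 t : Dl t ^+ 2 <= L ^+ 2 * (r ^+ 2 * r ^+ 2).
  have h1 := ln_cmod_approx (cs4 d1 t md1); have h2 := ln_cmod_approx (cs4 d2 t md2).
  have D1 : `|Dl t| <= L * r ^+ 2.
    have -> : Dl t = d1 * (ln (cmod (1 + s d2 t)) - complex.Re (s d2 t)) - d2 * (ln (cmod (1 + s d1 t)) - complex.Re (s d1 t)).
      by rewrite /Dl !Rs; ring.
    apply: le_trans (ler_normB _ _) _; rewrite !normrM.
    have := ler_wpM2l (normr_ge0 d1) h2; have := ler_wpM2l (normr_ge0 d2) h1; rewrite !cs => k1 k2.
    apply: le_trans (lerD k2 k1) _.
    have -> : `|d1| * (6 * (r * `|d2|) ^+ 2) + `|d2| * (6 * (r * `|d1|) ^+ 2) =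
      6 * `|d1| * `|d2| * (`|d1| + `|d2|) * r ^+ 2 by ring.
    rewrite ler_pM2r ?exprn_gt0// /L.
    have : 0 <= `|d1| * `|d2| * (`|d1| + `|d2|) by rewrite !mulr_ge0// addr_ge0.
    lra.
  rewrite -(real_normK (num_real (Dl t))) (_ : L ^+ 2 * _ = (L * r ^+ 2) ^+ 2); last by ring.
  by rewrite !expr2 ler_pM.
have cpt t : {for t, continuous (fun t => z + cis t *: w)}.
  apply: (@cvg_pair _ _ _ _ (nbhs (z.1 + cis t * w.1)) (nbhs (z.2 + cis t * w.2))).
  - apply: (@continuousD C C R (fun=> z.1) (fun t => cis t * w.1)); first exact: cvg_cst.
    by apply: (@continuousM C R (@cis R) (fun=> w.1)); [exact: continuous_cis|exact: cvg_cst].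
  - apply: (@continuousD C C R (fun=> z.2) (fun t => cis t * w.2)); first exact: cvg_cst.
    by apply: (@continuousM C R (@cis R) (fun=> w.2)); [exact: continuous_cis|exact: cvg_cst].
have cs1 d t : {for t, continuous (fun t => 1 + s d t : C)}.
  apply: (@continuousD C C R (fun=> 1) (s d)); first exact: cvg_cst.
  by apply: (@continuousM C R (fun=> (r * d)%:C%C) (@cis R)); [exact: cvg_cst|exact: continuous_cis].
have cln d : `|d| <= m -> cont_itv 0 (2 * pi) (fun t => ln (cmod (1 + s d t))).
  move=> dm t _; apply: (@continuous_comp _ _ _ (fun t => cmod (1 + s d t)) (@ln R)).
    exact: (continuous_comp (cs1 d t) (@continuous_cmod R _)).
  by apply: continuous_ln; exact: s1.
have Iln d : `|d| <= m -> \int[mu]_(t in `[0, 2 * pi]) ln (cmod (1 + s d t)) = 0.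
  move=> dm; rewrite -[RHS](@Re_mean_ln R (fun w => 1 + d%:C%C * w) 0 r r0).
  - apply: eq_Rintegral => t _; rewrite /s /circ; congr (ln (cmod _)).
    by rewrite rmorphM /=; ring.
  - move=> w' _; apply: cderivableD; first exact: cderivable_cst.
    by apply: cderivableM; [exact: cderivable_cst|exact: cderivable_id].
  - move=> w'; rewrite subr0 => w'r.
    have : cmod (d%:C%C * w') <= 4^-1.
      rewrite cmodM cmod_real; apply: le_trans r2; rewrite mulrC ler_pM ?cmod_ge0//.
    have := ler_Re_cmod (d%:C%C * w'); rewrite ler_norml => /andP[h _].
    have -> : complex.Re (1 + d%:C%C * w') = 1 + complex.Re (d%:C%C * w') by case: w' {w'r h} => a b /=.
    lra.
  - by rewrite mulr0 addr0.
have cDl : cont_itv 0 (2 * pi) Dl.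
  have cM (a : R) (h : R -> R) t : {for t, continuous h} -> {for t, continuous (fun t => a * h t)}.
    by move=> ch; apply: (@continuousM _ _ (fun=> a) h); [exact: cvg_cst|exact: ch].
  move=> t tt; apply: (@continuousD R R R (fun t => d1 * ln (cmod (1 + s d2 t))) (fun t => - d2 * ln (cmod (1 + s d1 t)))).
  - by apply: cM; exact: cln.
  - by apply: cM; exact: cln.
have p0 := twopi_gt0 R.
have IDl : \int[mu]_(t in `[0, 2 * pi]) Dl t = 0.
  have := rint_affine 0 d1 (- d2) (ltW p0) (cln d2 md2) (cln d1 md1).
  rewrite !Iln// !mulr0 mul0r !addr0 => h; rewrite -[RHS]h.
  by apply: eq_Rintegral => t _; rewrite add0r.
pose a1 := u z - e * r ^+ 2 * E + K * (L ^+ 2 * (r ^+ 2 * r ^+ 2)).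
have bnd t : u (z + cis t *: w) <= a1 + - 2 * e * r * F * cos t + 2 * K * l z * Dl t.
  have := vz _ (nt t); rewrite lpt /= !ptE !sqE.
  have := ler_wpM2l K0 (Dl2 t).
  rewrite /a1 /E /F; move: (cos t) (Dl t) (cmod z.1) (cmod z.2) (u _) (u z) (l z) => ct D c1 c2 uw uz lz h1 h2.
  nra.
have cu' : cont_itv 0 (2 * pi) (fun t => u (z + cis t *: w)).
  move=> t _; apply: (@continuous_comp _ _ _ (fun t => z + cis t *: w) u); first exact: cpt.
  by move: cu; rewrite (continuous_open_subspace u oO) => /(_ (z + cis t *: w)); apply; rewrite inE; exact/zO.
have caff : cont_itv 0 (2 * pi) (fun t => a1 + - 2 * e * r * F * cos t + 2 * K * l z * Dl t).
  have cM (a : R) (h : R -> R) t : {for t, continuous h} -> {for t, continuous (fun t => a * h t)}.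
    by move=> ch; apply: (@continuousM _ _ (fun=> a) h); [exact: cvg_cst|exact: ch].
  move=> t tt; apply: (@continuousD R R R (fun t => a1 + - 2 * e * r * F * cos t) (fun t => 2 * K * l z * Dl t)).
    apply: (@continuousD R R R (fun=> a1) (fun t => - 2 * e * r * F * cos t)); first exact: cvg_cst.
    apply: cM; exact: continuous_cos.
  apply: cM; exact: cDl.
have ccos : cont_itv 0 (2 * pi) (@cos R) by move=> t _; exact: continuous_cos.
have I1 := rint_affine a1 (- 2 * e * r * F) (2 * K * l z) (ltW p0) ccos cDl.
rewrite rint_cos IDl !mulr0 !addr0 in I1.
have zw t : `|t| <= 1 -> Omega (z + t *: w).
  by move=> t1; apply/zO/near; move: t1; rewrite cmodE -(@rmorph1 _ _ (@real_complex R)) lecR.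
have := pu z w zw; have := le_rint cu' caff (fun t _ => bnd t); rewrite I1 => h1 h2.
have : u z <= a1.
  apply: le_trans h2 _; rewrite -(ler_pM2l p0) mulrA divff ?gt_eqF// mul1r.
  by rewrite [leRHS]mulrC.
rewrite /a1; have : r ^+ 2 * (K * L ^+ 2 * r ^+ 2) < r ^+ 2 * (e * E).
  rewrite ltr_pM2l ?exprn_gt0//; apply: le_lt_trans r4; rewrite ler_wpM2l// expr2.
  by rewrite -[leRHS]mulr1 ler_pM2l.
lra.
Qed.
End LogarithmicBarrier.

Section LogarithmicSegments.
Variable R : realType.
Local Notation C := (Cplx R).

(** A neighbourhood of the zero set of [l] in a compact set contains a sublevel
    set of [l]. *)
Lemma compact_shrink (T : topologicalType) (X O : set T) (l : T -> R) :
  compact X -> open O -> (forall z, X z -> {for z, continuous l}) -> (forall z, 0 <= l z) ->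
  (forall z, X z -> l z = 0 -> O z) ->
  exists2 d, 0 < d & forall z, X z -> l z <= d -> O z.
Proof.
move=> cX oO cl l0 XO.
have [|||U [d d0 Ud] XU] := @compact_ind T X (fun U => exists2 d, 0 < d &
    forall z, X z -> U z -> l z <= d -> O z) cX.
- by exists 1 => // z _ [].
- move=> U V [d d0 Ud] [e e0 Ve]; exists (Num.min d e); first by rewrite lt_min d0.
  by move=> z Xz; rewrite le_min => -[Uz|Vz] /andP[h1 h2]; [exact: Ud|exact: Ve].
- move=> y Xy; have [Oy|nOy] := pselect (O y).
    by exists O; [exists 1|exact: open_nbhs_nbhs].
  have ly : 0 < l y.
    by rewrite lt_neqAle l0 andbT eq_sym; apply/eqP => h; apply: nOy; exact: XO.
  exists [set z | l y / 2 < l z].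
    exists (l y / 2); first by rewrite divr_gt0.
    by move=> z _ /= h1 h2; move: (lt_le_trans h1 h2); rewrite ltxx.
  have h : l y / 2 < l y by lra.
  exact: (cl y Xy [set x | l y / 2 < x] (open_nbhs_nbhs (conj (@open_gt R (l y / 2)) h))).
by exists d => // z Xz; apply: Ud => //; exact: XU.
Qed.

Variable Omega : set (C2 R).
Hypothesis oO : open Omega.

(** The torus invariant set whose logarithmic image is the segment from [(x, y)]
    to [(x', y')]. *)
Definition log_segment (x y x' y' : R) : set (C2 R) := [set z | exists2 t : R, 0 <= t <= 1 &
  cmod z.1 = expR (x + t * (x' - x)) /\ cmod z.2 = expR (y + t * (y' - y))].

Section SegmentMax.
Variables (u : C2 R -> R) (x y x' y' M : R).
Hypotheses (pu : continuous_psh Omega u) (xx : x' < x) (yy : y < y').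
Let d1 := x' - x.
Let d2 := y' - y.
(* the logarithms are cut off away from the annuli that matter, so that [l], which
   vanishes on the segment, is continuous everywhere *)
Let lg (a : R) (z : C) := ln (Num.max (expR a) (cmod z)).
Let l (z : C2 R) := d1 * (lg (y - 1) z.2 - y) - d2 * (lg (x' - 2) z.1 - x).

Let ln_bounds (a b : R) (z : C) : (expR a <= cmod z <= expR b) = (0 < cmod z) && (a <= ln (cmod z) <= b).
Proof.
have [z0|z0] /= := ltrP 0 (cmod z).
  have -> : (expR a <= cmod z) = (a <= ln (cmod z)) by rewrite -[RHS]ler_expR lnK ?posrE.
  by congr (_ && _); rewrite -[RHS]ler_expR lnK ?posrE.
by apply/negbTE; rewrite negb_and -ltNge (le_lt_trans z0 (expR_gt0 a)).
Qed.

Let lgE a z : expR a <= cmod z -> lg a z = ln (cmod z).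
Proof. by move=> h; rewrite /lg max_r. Qed.

Let lg_cont a : continuous (lg a).
Proof.
move=> z; apply: (@continuous_comp _ _ _ (fun z : C => Num.max (expR a) (cmod z)) (@ln R)).
  apply/(@cvgrPdist_lt _ _ _ (nbhs z)) => e e0; apply/nbhs_cmodP; exists e => // w wz.
  apply: le_lt_trans wz; rewrite cmodBC; apply: le_trans (cmod_dist z w).
  move: (expR a) (cmod z) (cmod w) => A b c.
  have h1 := ler_norm (b - c); have h2 := ler_norm (c - b); rewrite distrC in h2.
  by case: (leP A b) => Ab; case: (leP A c) => Ac; rewrite ler_norml; apply/andP; split; lra.
by apply: continuous_ln; rewrite lt_max expR_gt0.
Qed.

Let l_cont : continuous l.
Proof.
have c1 (a b d : R) (p : C2 R -> C) : continuous p -> continuous (fun z => d * (lg a (p z) - b)).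
  move=> cp z; apply: (@continuousM _ _ (fun=> d) (fun z => lg a (p z) - b)); first exact: cvg_cst.
  apply: (@continuousB R R (C2 R) (fun z => lg a (p z)) (fun=> b)); last exact: cvg_cst.
  by apply: (@continuous_comp _ _ _ p (lg a)); [exact: cp|exact: lg_cont].
move=> z; apply: (@continuousB R R (C2 R) (fun z => d1 * (lg (y - 1) z.2 - y)) (fun z => d2 * (lg (x' - 2) z.1 - x))).
  by apply: c1 => w; exact: cvg_snd.
by apply: c1 => w; exact: cvg_fst.
Qed.

Let Y : set (C2 R) := [set z | expR (x' - 1) <= cmod z.1 <= expR (x + 1) /\ expR y <= cmod z.2 <= expR y'].

Let d20 : 0 < d2. Proof. by rewrite subr_gt0. Qed.

Let YE z : Y z -> [/\ 0 < cmod z.1, 0 < cmod z.2, x' - 1 <= ln (cmod z.1) <= x + 1,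
  y <= ln (cmod z.2) <= y' & l z = d1 * (ln (cmod z.2) - y) - d2 * (ln (cmod z.1) - x)].
Proof.
case=> h1 h2; have [z1 l1] := andP (etrans (esym (ln_bounds _ _ _)) h1).
have [z2 l2] := andP (etrans (esym (ln_bounds _ _ _)) h2); split=> //.
rewrite /l !lgE//.
- by case/andP: h1 => h1 _; apply: le_trans h1; rewrite ler_expR; lra.
- by case/andP: h2 => h2 _; apply: le_trans h2; rewrite ler_expR; lra.
Qed.

Let c1 : continuous (fun z : C2 R => cmod z.1).
Proof.
move=> z; have cf : {for z, continuous (fst : C2 R -> C)} by exact: cvg_fst.
exact: (continuous_comp cf (@continuous_cmod R _)).
Qed.

Let c2 : continuous (fun z : C2 R => cmod z.2).
Proof.
move=> z; have cf : {for z, continuous (snd : C2 R -> C)} by exact: cvg_snd.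
exact: (continuous_comp cf (@continuous_cmod R _)).
Qed.

Let closed_between (a b : R) (h : C2 R -> R) : continuous h -> closed [set z | a <= h z <= b].
Proof.
move=> ch; rewrite (_ : [set z | _] = h @^-1` [set t | a <= t] `&` h @^-1` [set t | t <= b]).
  by apply: closedI; apply: (@closed_comp _ _ h) => [? _|]; [exact: ch|exact: closed_ge|exact: ch|exact: closed_le].
by apply/seteqP; split=> z /=; [move=> /andP[]|case=> -> ->].
Qed.

Let cY : compact Y.
Proof.
apply: (@compact_C2 R _ (expR (x + 1) + expR y')).
  move=> z [/andP[_ h1] /andP[_ h2]]; have := expR_gt0 (x + 1); have := expR_gt0 y'; lra.
have -> : Y = [set z | expR (x' - 1) <= cmod z.1 <= expR (x + 1)] `&` [set z | expR y <= cmod z.2 <= expR y'] by [].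
apply: closedI; apply: closed_between; [exact: c1|exact: c2].
Qed.

Let segY z : log_segment x y x' y' z -> Y z /\ l z = 0.
Proof.
case=> t t01 [h1 h2]; have Yz : Y z.
  have tb (e : R) : 0 <= e -> 0 <= t * e <= e.
    by case/andP: t01 => t0 t1 e0; rewrite mulr_ge0//= ler_piMl.
  have : 0 <= t * (x - x') <= x - x' by apply: tb; have := xx; lra.
  have : 0 <= t * (y' - y) <= y' - y by apply: tb; have := yy; lra.
  by rewrite /Y /= h1 h2 !ler_expR => a b; split; lra.
by split=> //; have [_ _ _ _ ->] := YE Yz; rewrite h1 h2 !expRK /d1 /d2; ring.
Qed.

Let Yseg z : Y z -> l z = 0 -> log_segment x y x' y' z.
Proof.
move=> Yz lz; have [z1 z2 b1 b2 E] := YE Yz; rewrite lz in E.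
exists ((ln (cmod z.2) - y) / d2).
  by rewrite divr_ge0 ?ler_pdivrMr//=; [rewrite mul1r lerD2r; case/andP: b2|case/andP: b2; rewrite subr_ge0|exact: ltW].
have n2 : d2 != 0 by rewrite gt_eqF.
split; rewrite -[LHS]lnK ?posrE//; congr expR; rewrite -?/d1 -?/d2; last by field.
apply: (mulfI n2); rewrite mulrDr [_ * (_ / _ * _)](_ : _ = d1 * (ln (cmod z.2) - y)); last by field.
lra.
Qed.

(** Maximum principle along a segment of the logarithmic image. If [u] were larger
    inside than at the ends, then [u + e * |z|^2 - K * l ^+ 2], with [e] small and
    [K] large, would have an interior maximum on a thin neighbourhood of the
    segment, against [psh_no_local_max]. *)
Lemma segment_max : log_segment x y x' y' `<=` Omega ->
  (forall z, log_segment x y x' y' z -> cmod z.2 = expR y \/ cmod z.2 = expR y' -> u z < M) ->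
  forall z, log_segment x y x' y' z -> u z <= M.
Proof.
move=> segO endM p segp; rewrite leNgt; apply/negP => Mp.
have cu z : Omega z -> {for z, continuous u}.
  by move=> Oz; case: pu => cu _; move: cu; rewrite (continuous_open_subspace u oO) => /(_ z); apply; rewrite inE.
have cl z : {for z, continuous (fun z => `|l z|)}.
  by apply: (@continuous_comp _ _ _ l (fun t => `|t|)); [exact: l_cont|exact: norm_continuous].
have l0 z : 0 <= `|l z| by [].
have [e2 e20 Oe2] : exists2 d, 0 < d & forall z, Y z -> `|l z| <= d -> Omega z.
  apply: (compact_shrink cY oO (fun z _ => cl z) l0) => z Yz /normr0_eq0 lz.
  by apply/segO/Yseg.
pose Y' := Y `&` [set z | cmod z.2 = expR y \/ cmod z.2 = expR y'].
have cY' : compact Y'.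
  apply: (subclosed_compact _ cY); last by move=> z [].
  apply: closedI; first by apply: compact_closed => //.
  rewrite (_ : [set z | _] = (fun z : C2 R => cmod z.2) @^-1` [set t | t = expR y] `|` (fun z : C2 R => cmod z.2) @^-1` [set t | t = expR y']).
    by apply: closedU; apply: (@closed_comp _ _ (fun z : C2 R => cmod z.2)) => [? _|]; [exact: c2|exact: closed_eq|exact: c2|exact: closed_eq].
  by apply/seteqP; split.
have oM : open (Omega `&` [set z | u z < M]).
  rewrite openE => z [Oz uz]; apply: filterI; first by apply: open_nbhs_nbhs.
  exact: (cu z Oz [set t | t < M] (open_nbhs_nbhs (conj (@open_lt R M) uz))).
have [e1 e10 Oe1] : exists2 d, 0 < d & forall z, Y' z -> `|l z| <= d -> (Omega `&` [set z | u z < M]) z.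
  apply: (compact_shrink cY' oM (fun z _ => cl z) l0) => z [Yz ze] /normr0_eq0 lz.
  have sz := Yseg Yz lz; split; [exact: segO|exact: endM].
pose d := Num.min (Num.min e1 e2) (d2 / 2).
have [d_0 de1 de2 dd2] : [/\ 0 < d, d <= e1, d <= e2 & d <= d2 / 2].
  by rewrite !lt_min e10 e20 divr_gt0// !ge_min !lexx !orbT.
clearbody d.
pose X := Y `&` [set z | `|l z| <= d].
have XO z : X z -> Omega z by case=> Yz lz; apply: Oe2 => //; exact: le_trans de2.
have cX : compact X.
  apply: (subclosed_compact _ cY); last by move=> z [].
  apply: closedI; first by apply: compact_closed => //.
  apply: (@closed_comp _ _ (fun z => `|l z|) [set t | t <= d]) => [z _|]; [exact: cl|exact: closed_le].
have [Yp lp] := segY segp.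
have Xp : X p by split=> //=; rewrite lp normr0 ltW.
have X0 : X !=set0 by exists p.
have evt (h : C2 R -> R) : (forall z, X z -> {for z, continuous h}) -> exists2 z, X z & forall w, X w -> h w <= h z.
  move=> ch; have [|z zX hz] := compact_EVT_max X0 cX (f := h).
    by apply: continuous_in_subspaceT => z; rewrite inE; exact: ch.
  by exists z; [rewrite inE in zX|move=> w Xw; apply: hz; rewrite inE].
have [zu _ hu] := evt u (fun z Xz => cu z (XO z Xz)).
set U := u zu in hu; have UM : 0 < U - M by have := hu p Xp; lra.
pose K := (U - M) / d ^+ 2.
have K0 : 0 < K by rewrite divr_gt0// exprn_gt0.
have KE : K * d ^+ 2 = U - M by rewrite divfK// gt_eqF// exprn_gt0.
pose N (z : C2 R) := cmod z.1 ^+ 2 + cmod z.2 ^+ 2.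
pose B := expR (x + 1) ^+ 2 + expR y' ^+ 2.
have B0 : 0 < B by rewrite addr_gt0// exprn_gt0// expR_gt0.
have N0 z : 0 <= N z by rewrite addr_ge0// sqr_ge0.
have NB z : Y z -> N z <= B.
  by case=> /andP[_ h1] /andP[_ h2]; rewrite lerD// !expr2 ler_pM// cmod_ge0.
pose e := (u p - M) / (2 * B).
have e_0 : 0 < e by rewrite divr_gt0 ?mulr_gt0// subr_gt0.
have eB : e * B = (u p - M) / 2 by rewrite /e; field; rewrite gt_eqF.
clearbody K e.
pose v z := u z + e * N z - K * l z ^+ 2.
have cv z : X z -> {for z, continuous v}.
  move=> Xz.
  have sq (h : C2 R -> R) : continuous h -> continuous (fun z => h z ^+ 2).
    by move=> ch w; apply: (@continuous_comp _ _ _ h (fun t => t ^+ 2)); [exact: ch|exact: exprn_continuous].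
  have cM (a : R) (h : C2 R -> R) : continuous h -> continuous (fun z => a * h z).
    by move=> ch w; apply: (@continuousM _ _ (fun=> a) h); [exact: cvg_cst|exact: ch].
  have cN : continuous N by move=> w; apply: (@continuousD R R (C2 R) (fun z => cmod z.1 ^+ 2) (fun z => cmod z.2 ^+ 2)); exact: sq.
  apply: (@continuousB R R (C2 R) (fun z => u z + e * N z) (fun z => K * l z ^+ 2)); last exact: (cM _ _ (sq _ l_cont)).
  apply: (@continuousD R R (C2 R) u (fun z => e * N z)); first exact: cu (XO z Xz).
  exact: (cM _ _ cN).
have [z Xz hz] := evt v cv; have [Yz ld] := Xz; rewrite /= in ld.
have vp : u p <= v z.
  by apply: le_trans (hz p Xp); rewrite /v lp expr0n mulr0 subr0 lerDl mulr_ge0// ltW.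
have eN : e * N z <= (u p - M) / 2 by rewrite -eB ler_pM2l// NB.
have lK : 0 <= K * l z ^+ 2 by apply: mulr_ge0; [exact: ltW|exact: sqr_ge0].
have zend : ~ (cmod z.2 = expR y \/ cmod z.2 = expR y').
  move=> ze; have [_ /= uz] := Oe1 z (conj Yz ze) (le_trans ld de1).
  by move: vp uz Mp eN lK; rewrite /v; lra.
have {}ld : `|l z| < d.
  rewrite lt_neqAle ld andbT; apply/eqP => E.
  have := hu z Xz; move: vp Mp eN; rewrite /v -(real_normK (num_real (l z))) E KE; lra.
have [z1 z2 b1 b2 E] := YE Yz.
have near_X : nbhs z X.
  have n0 : nbhs z [set w | `|l w| < d] := cl z [set t | t < d] (open_nbhs_nbhs (conj (@open_lt R d) ld)).
  have bn (h : C2 R -> R) a b : continuous h -> a < h z < b -> nbhs z [set w | a <= h w <= b].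
    move=> ch /andP[az zb].
    have n1 : nbhs z [set w | a < h w] := ch z [set t | a < t] (open_nbhs_nbhs (conj (@open_gt R a) az)).
    have n2 : nbhs z [set w | h w < b] := ch z [set t | t < b] (open_nbhs_nbhs (conj (@open_lt R b) zb)).
    by apply: (@filterS _ (nbhs z) _ _ _ _ (filterI n1 n2)) => w [/= /ltW -> /ltW ->].
  apply: filterI; last by apply: (@filterS _ (nbhs z) _ _ _ _ n0) => w /ltW.
  apply: filterI; apply: bn; [exact: c1| |exact: c2|].
    rewrite -[cmod z.1]lnK ?posrE// !ltr_expR.
    have h : d2 * (ln (cmod z.1) - x) = d1 * (ln (cmod z.2) - y) - l z by rewrite E; ring.
    move: ld; rewrite ltr_norml => /andP[ld1 ld2].
    have h1 : d1 * d2 <= d1 * (ln (cmod z.2) - y) <= 0.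
      have d10 : d1 <= 0 by rewrite subr_le0 ltW.
      case/andP: b2 => b21 b22; rewrite ler_wnM2l// ?lerD2r//= mulr_le0_ge0// subr_ge0//.
    have h2 : d2 * (d1 - 1) < d2 * (ln (cmod z.1) - x) < d2 * 1.
      by case/andP: h1 => h11 h12; rewrite h; apply/andP; split; lra.
    by move: h2; rewrite !ltr_pM2l// /d1 => /andP[k1 k2]; apply/andP; split; lra.
  case: Yz => _ /andP[k1 k2]; apply/andP; split.
    by rewrite lt_neqAle k1 andbT; apply/eqP => k; apply: zend; left.
  by rewrite lt_neqAle k2 andbT; apply/eqP => k; apply: zend; right.
have [rho rho0 rhoX] := (@nbhs_C2P R z X).1 near_X.
have nX w : near2 z rho w -> X w by case=> h1 h2; exact: rhoX.
apply: (@psh_no_local_max R Omega u l z d1 d2 (d1 * y - d2 * x) K e rho oO pu d20 (ltW K0) e_0 rho0).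
- by rewrite -cmod_gt0.
- by rewrite -cmod_gt0.
- by move=> w /nX /XO.
- by move=> w /nX[Yw _]; have [_ _ _ _ ->] := YE Yw; ring.
- by move=> w /nX Xw; exact: hz.
Qed.
End SegmentMax.
End LogarithmicSegments.

Section LogarithmicConvexity.
Variable R : realType.
Local Notation C := (Cplx R).
Variable Omega : set (C2 R).
Hypotheses (oO : open Omega) (RO : complete_Reinhardt Omega).

(** A point is the image of any point with larger moduli under a coordinatewise
    contraction. *)
Lemma reinhardt_dom z w : Omega z -> cmod w.1 <= cmod z.1 -> cmod w.2 <= cmod z.2 -> Omega w.
Proof.
move=> Oz w1 w2.
have h (a b : C) : cmod b <= cmod a -> exists2 k : C, `|k| <= 1 & k * a = b.
  move=> ba; have [a0|a0] := eqVneq a 0.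
    exists 0; first by rewrite normr0.
    by move: ba; rewrite a0 cmod0 mulr0 => b0; apply/esym/eqP; rewrite -cmod_eq0 eq_le b0 cmod_ge0.
  exists (b / a); last by rewrite divfK.
  have ca : 0 < cmod a by rewrite cmod_gt0.
  by rewrite cmodE -(@rmorph1 _ _ (@real_complex R)) lecR cmodM cmodV ler_pdivrMr// mul1r.
have [k1 k11 e1] := h _ _ w1; have [k2 k22 e2] := h _ _ w2.
by have := @RO z (k1, k2) Oz k11 k22; rewrite /= e1 e2; case: w {w1 w2 e1 e2}.
Qed.

Let E (a b : R) : C2 R := ((expR a)%:C%C, (expR b)%:C%C).

Let cmodE1 a : cmod ((expR a)%:C%C : C) = expR a.
Proof. by rewrite cmod_real ger0_norm// expR_ge0. Qed.

Let E1 a b : cmod (E a b).1 = expR a. Proof. exact: cmodE1. Qed.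
Let E2 a b : cmod (E a b).2 = expR b. Proof. exact: cmodE1. Qed.

Let domE a b a' b' : Omega (E a b) -> a' <= a -> b' <= b -> Omega (E a' b').
Proof.
move=> Oab aa bb; apply: (reinhardt_dom Oab).
  by rewrite !E1 ler_expR.
by rewrite !E2 ler_expR.
Qed.

Let EO z a b : Omega (E a b) -> cmod z.1 = expR a -> cmod z.2 = expR b -> Omega z.
Proof. by move=> Oab h1 h2; apply: (reinhardt_dom Oab); rewrite ?E1 ?E2 ?h1 ?h2. Qed.

(* openness, in logarithmic coordinates along the diagonal *)
Let bump a b : Omega (E a b) -> exists2 n, 0 < n & Omega (E (a + n) (b + n)).
Proof.
move=> Oab; have [r r0 rO] := (@nbhs_C2P R (E a b) Omega).1 (open_nbhs_nbhs (conj oO Oab)).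
pose d := r / (2 * (expR a + expR b)).
have ab : 0 < expR a + expR b by rewrite addr_gt0// expR_gt0.
have d0 : 0 < d by rewrite divr_gt0// mulr_gt0.
have dab : d * (expR a + expR b) = r / 2 by rewrite /d; field; rewrite gt_eqF.
have d1 : 0 < 1 + d by rewrite addr_gt0.
exists (ln (1 + d)); first by rewrite ln_gt0// ltrDl.
have h (x y : R) : d * (expR x + expR y) = r / 2 -> cmod ((expR (x + ln (1 + d)))%:C%C - (expR x)%:C%C : C) < r.
  move=> xy; rewrite -rmorphB cmod_real expRD lnK ?posrE//.
  have -> : expR x * (1 + d) - expR x = d * expR x by ring.
  have := expR_gt0 x; have := expR_gt0 y => y0 x0.
  have xy0 := mulr_gt0 d0 y0; have xx0 := mulr_gt0 d0 x0; rewrite mulrDr in xy.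
  by rewrite gtr0_norm//; lra.
by apply: rO; rewrite /E /=; [apply: h dab|apply: (h b a); rewrite addrC].
Qed.

(** The segment is pushed down along the diagonal until it lies in [Omega], then
    raised again. By [segment_max] the exhaustion function stays bounded on the
    raised segments by its values at the ends, so the segment cannot leave [Omega]
    on the way. *)
Lemma log_convex (x y x' y' : R) : pseudoconvex Omega -> x' < x -> y < y' ->
  Omega (E x y) -> Omega (E x' y') -> log_segment x y x' y' `<=` Omega.
Proof.
move=> [u [pu uS]] xx yy OP OQ.
have cu z : Omega z -> {for z, continuous u}.
  by move=> Oz; case: pu => cu _; move: cu; rewrite (continuous_open_subspace u oO) => /(_ z); apply; rewrite inE.
pose G s := forall t, 0 <= t <= 1 -> Omega (E (x - s + t * (x' - x)) (y - s + t * (y' - y))).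
have Gseg s : G s <-> log_segment (x - s) (y - s) (x' - s) (y' - s) `<=` Omega.
  have e (a b : R) : b - s - (a - s) = b - a by ring.
  split=> [Gs z [t t01 [h1 h2]]|h t t01].
    by apply: (EO (Gs t t01)); rewrite ?h1 ?h2 e.
  by apply: h; exists t => //; rewrite E1 E2 !e.
have Gup s s' : G s -> s <= s' -> G s'.
  by move=> Gs ss t t01; apply: (domE (Gs t t01)); lra.
suff G0 : G 0 by have := (Gseg 0).1 G0; rewrite !subr0.
have polydisc a b : Omega (E a b) -> exists N, forall z, cmod z.1 <= expR a -> cmod z.2 <= expR b -> u z < N.
  move=> Oab; pose D : set (C2 R) := [set z | cmod z.1 <= expR a /\ cmod z.2 <= expR b].
  have cD : compact D.
    apply: (@compact_C2 R _ (expR a + expR b)).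
      by move=> z [z1 z2]; have := expR_gt0 a; have := expR_gt0 b; lra.
    have cl (p : C2 R -> C) (c : R) : continuous p -> closed [set z | cmod (p z) <= c].
      move=> cp; apply: (@closed_comp _ _ (fun z => cmod (p z)) [set t | t <= c]) => [z _|]; last exact: closed_le.
      exact: (continuous_comp (cp z) (@continuous_cmod R _)).
    rewrite (_ : D = [set z | cmod z.1 <= expR a] `&` [set z | cmod z.2 <= expR b])//.
    by apply: closedI; apply: cl => z; [exact: cvg_fst|exact: cvg_snd].
  have DO z : D z -> Omega z by case=> z1 z2; apply: (reinhardt_dom Oab); rewrite ?E1 ?E2.
  have D0 : D !=set0 by exists (E a b); split; rewrite ?E1 ?E2.
  have [|z zD hz] := compact_EVT_max D0 cD (f := u).
    by apply: continuous_in_subspaceT => z; rewrite inE => /DO; exact: cu.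
  exists (u z + 1) => w w1 w2; apply: le_lt_trans (hz w _) _; last by rewrite ltrDl.
  by rewrite inE; split.
have [N1 N1P] := polydisc _ _ OP; have [N2 N2P] := polydisc _ _ OQ.
pose M := Num.max N1 N2.
pose A : set R := [set s | 0 <= s /\ G s].
have tb t (e : R) : 0 <= t <= 1 -> 0 <= e -> 0 <= t * e <= e.
  by case/andP => t0 t1 e0; rewrite mulr_ge0//= ler_piMl.
have A1 : A (y' - y).
  split; first by rewrite subr_ge0 ltW.
  move=> t t01; apply: (domE OP).
    have := tb t (x - x') t01; rewrite subr_ge0 => /(_ (ltW xx)) /andP[h1 h2]; have := yy; lra.
  have := tb t (y' - y) t01; rewrite subr_ge0 => /(_ (ltW yy)) /andP[h1 h2]; lra.
have iA : has_inf A by split; [exists (y' - y)|exists 0 => s []].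
pose s0 := inf A.
have s00 : 0 <= s0 by apply: lb_le_inf; [exists (y' - y)|move=> s []].
have [cS SO] := uS (M + 1).
set S := [set z | _] in cS SO.
have Abound s z : A s -> log_segment (x - s) (y - s) (x' - s) (y' - s) z -> S z.
  move=> [s_0 /Gseg Gs] sz; split; first exact: Gs.
  apply: (@le_lt_trans _ _ M); last by rewrite ltrDl.
  apply: (@segment_max R Omega oO u (x - s) (y - s) (x' - s) (y' - s) M pu) => //; try lra.
  move=> w [t t01 [h1 h2]] [e|e].
  - have t0 : t = 0.
      have : t * (y' - y) = 0 by move: e; rewrite h2 => /expR_inj => e'; lra.
      by move/eqP; rewrite mulf_eq0 (gt_eqF (_ : 0 < y' - y)) ?subr_gt0// orbF => /eqP.
    rewrite lt_max N1P// ?h1 ?h2 t0 ler_expR; lra.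
  - have t1 : t = 1.
      have : (t - 1) * (y' - y) = 0 by move: e; rewrite h2 => /expR_inj => e'; lra.
      by move/eqP; rewrite mulf_eq0 (gt_eqF (_ : 0 < y' - y)) ?subr_gt0// orbF subr_eq0 => /eqP.
    rewrite lt_max N2P ?orbT// ?h1 ?h2 t1 ler_expR; lra.
have Gs0 : G s0.
  move=> t t01; apply: SO => V.
  set p := E _ _; move=> /nbhs_C2P[r r0 rV].
  pose c := expR (x - s0 + t * (x' - x)) + expR (y - s0 + t * (y' - y)).
  have c0 : 0 < c by rewrite addr_gt0// expR_gt0.
  have rc : 0 < r / c by rewrite divr_gt0.
  have [s As ss] := inf_adherent rc iA; rewrite -/s0 in ss.
  have lbA : has_lbound A by case: iA.
  have s0s : s0 <= s by exact: ge_inf.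
  exists (E (x - s + t * (x' - x)) (y - s + t * (y' - y))); split.
    apply: (Abound s _ As); exists t => //; rewrite E1 E2.
    by have e (a b : R) : b - s - (a - s) = b - a by [ring]; rewrite !e.
  have h (a b : R) : expR (a - s0 + b) <= c -> cmod ((expR (a - s + b))%:C%C - (expR (a - s0 + b))%:C%C : C) < r.
    move=> ec; rewrite -rmorphB cmod_real.
    have -> : expR (a - s + b) = expR (a - s0 + b) * expR (- (s - s0)) by rewrite -expRD; congr expR; ring.
    set al := expR (a - s0 + b) in ec *; have al0 : 0 < al by exact: expR_gt0.
    have e1 := expR_ge1Dx (- (s - s0)).
    have e2 : expR (- (s - s0)) <= 1 by rewrite -expR0 ler_expR; lra.
    rewrite -[X in _ - X]mulr1 -mulrBr normrM gtr0_norm// ler0_norm ?subr_le0//.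
    apply: (@le_lt_trans _ _ (c * (s - s0))); first by rewrite ler_pM//; lra.
    by rewrite -ltr_pdivlMl// mulrC ltrBlDl.
  by apply: rV; apply: h; rewrite /c ?lerDl ?lerDr expR_ge0.
have [s0_0|s0n] := eqVneq s0 0; first by rewrite -s0_0.
have s0p : 0 < s0 by rewrite lt_neqAle eq_sym s0n.
have cI : compact `[0 : R, 1]%classic by exact: segment_compact.
have [|||U [n n0 nU] IU] := @compact_ind R _ (fun U => exists2 n : R, 0 < n & forall t : R, 0 <= t <= 1 -> U t ->
  Omega (E (x - (s0 - n) + t * (x' - x)) (y - (s0 - n) + t * (y' - y)))) cI.
- by exists 1 => // t _ [].
- move=> U V [n n0 nU] [k k0 kV]; exists (Num.min n k); first by rewrite lt_min n0.
  have m1 : Num.min n k <= n by rewrite ge_min lexx.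
  have m2 : Num.min n k <= k by rewrite ge_min lexx orbT.
  by move=> t t01 [Ut|Vt]; [apply: (domE (nU t t01 Ut))|apply: (domE (kV t t01 Vt))]; lra.
- move=> t; rewrite /= in_itv /= => t01; have [n n0 nO] := bump (Gs0 t t01).
  pose D := (x - x') + (y' - y) + 1.
  have D0 : 0 < D by rewrite /D; lra.
  exists [set t' | `|t - t'| < n / (2 * D)].
    exists (n / 2); first by rewrite divr_gt0.
    move=> t' _ /=; rewrite ltr_pdivlMr ?mulr_gt0// => tt.
    have h (e : R) : `|e| <= D -> (t' - t) * e <= n / 2.
      move=> eD; apply: le_trans (ler_norm _) _; rewrite normrM distrC.
      have := ler_wpM2l (normr_ge0 (t - t')) eD; lra.
    have h1 : (t' - t) * (x' - x) <= n / 2 by apply: h; rewrite ler_norml /D; apply/andP; split; lra.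
    have h2 : (t' - t) * (y' - y) <= n / 2 by apply: h; rewrite ler_norml /D; apply/andP; split; lra.
    by apply: (domE nO); lra.
  by apply/nbhs_ballP; exists (n / (2 * D)) => //=; rewrite divr_gt0// mulr_gt0.
have As : A (Num.max 0 (s0 - n)).
  split; first by rewrite le_max lexx.
  have Gn : G (s0 - n) by move=> t t01; apply: nU => //; apply: IU; rewrite /= in_itv.
  by apply: (Gup _ _ Gn); rewrite le_max lexx orbT.
have lbA : has_lbound A by case: iA.
have := ge_inf lbA As; rewrite -/s0 leNgt gt_max s0p /= => /negP[]; lra.
Qed.

Let perturb z : Omega z -> exists w, [/\ Omega w, w.1 != 0, w.2 != 0, cmod z.1 <= cmod w.1 & cmod z.2 <= cmod w.2].
Proof.
move=> Oz; have [r r0 rO] := (@nbhs_C2P R z Omega).1 (open_nbhs_nbhs (conj oO Oz)).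
have h (a : C) : exists b, [/\ cmod (b - a) < r, b != 0 & cmod a <= cmod b].
  have [->|a0] := eqVneq a 0; last by exists a; rewrite subrr cmod0.
  have r2 : 0 < r / 2 by rewrite divr_gt0.
  exists (r / 2)%:C%C; rewrite subr0 cmod0 -cmod_gt0 cmod_real gtr0_norm//; split=> //; lra.
have [b1 [b1r b10 b1z]] := h z.1; have [b2 [b2r b20 b2z]] := h z.2.
by exists (b1, b2); split=> //; exact: rO.
Qed.

(** Outside points are separated from the domain by a monomial: the logarithmic
    image is convex and stable under decreasing the coordinates, so it has a
    supporting line of nonpositive slope. The first two cases are the vertical and
    horizontal lines; they include the points [q] with a zero coordinate, which
    have no logarithmic image. In the third case [m] is the supremum of the slopes
    towards the points above [q]. *)
Lemma monomial_support (q : C2 R) : pseudoconvex Omega -> ~ Omega q ->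
  [\/ forall z, Omega z -> cmod z.1 <= cmod q.1,
      forall z, Omega z -> cmod z.2 <= cmod q.2 |
      [/\ q.1 != 0, q.2 != 0 & exists2 m, 0 < m & forall z, Omega z -> z.1 != 0 -> z.2 != 0 ->
        m * ln (cmod z.1) + ln (cmod z.2) <= m * ln (cmod q.1) + ln (cmod q.2)]].
Proof.
move=> psO nq.
have nd z : Omega z -> cmod q.1 <= cmod z.1 -> cmod q.2 <= cmod z.2 -> False.
  by move=> Oz h1 h2; apply: nq; exact: reinhardt_dom Oz h1 h2.
have [|/existsNP[P /not_implyP[OP /negP]]] := pselect (forall z, Omega z -> cmod z.1 <= cmod q.1).
  by constructor 1.
have [|/existsNP[Q /not_implyP[OQ /negP]]] := pselect (forall z, Omega z -> cmod z.2 <= cmod q.2).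
  by constructor 2.
rewrite -!ltNge => Q2 P1; constructor 3.
have q1 : q.1 != 0.
  apply/eqP => h; apply: (nd _ OQ); last exact: ltW.
  by rewrite h cmod0 cmod_ge0.
have q2 : q.2 != 0.
  apply/eqP => h; apply: (nd _ OP); first exact: ltW.
  by rewrite h cmod0 cmod_ge0.
split=> //.
have q1p : 0 < cmod q.1 by rewrite cmod_gt0.
have q2p : 0 < cmod q.2 by rewrite cmod_gt0.
pose X (z : C2 R) := ln (cmod z.1) - ln (cmod q.1).
pose Yc (z : C2 R) := ln (cmod z.2) - ln (cmod q.2).
have lnle (a b : C) : a != 0 -> b != 0 -> (ln (cmod a) <= ln (cmod b)) = (cmod a <= cmod b).
  by move=> a0 b0; rewrite ler_ln ?posrE ?cmod_gt0.
have EE z : Omega z -> z.1 != 0 -> z.2 != 0 -> Omega (E (ln (cmod z.1)) (ln (cmod z.2))).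
  move=> Oz z1 z2; apply: (reinhardt_dom Oz).
    by rewrite E1 lnK ?posrE ?cmod_gt0.
  by rewrite E2 lnK ?posrE ?cmod_gt0.
have cross z w : Omega z -> z.1 != 0 -> z.2 != 0 -> Omega w -> w.1 != 0 -> w.2 != 0 ->
    0 < X z -> 0 < Yc w -> X z * Yc w < X w * Yc z.
  move=> Oz z1 z2 Ow w1 w2 Xz Yw; rewrite ltNge; apply/negP => h.
  have Yz : Yc z < 0.
    rewrite ltNge; apply/negP => Yz; apply: (nd z Oz); rewrite -lnle// -subr_ge0//; exact: ltW.
  have Xw : X w < 0.
    rewrite ltNge; apply/negP => Xw; apply: (nd w Ow); rewrite -lnle// -subr_ge0//; exact: ltW.
  have xx : ln (cmod w.1) < ln (cmod z.1) by move: Xz Xw; rewrite /X; lra.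
  have yy : ln (cmod z.2) < ln (cmod w.2) by move: Yz Yw; rewrite /Yc; lra.
  have seg := log_convex psO xx yy (EE z Oz z1 z2) (EE w Ow w1 w2).
  pose t := X z / (X z - X w).
  have D0 : 0 < X z - X w by lra.
  have tD : t * (X z - X w) = X z by rewrite divfK// gt_eqF.
  have t01 : 0 <= t <= 1 by rewrite /t divr_ge0 ?(ltW Xz) ?(ltW D0)//= ler_pdivrMr// mul1r; lra.
  pose p := E (ln (cmod z.1) + t * (ln (cmod w.1) - ln (cmod z.1))) (ln (cmod z.2) + t * (ln (cmod w.2) - ln (cmod z.2))).
  have Op : Omega p by apply: seg; exists t => //; rewrite E1 E2.
  apply: (nd p Op).
    rewrite E1 -[cmod q.1]lnK ?posrE// ler_expR.
    by move: tD; rewrite /X; lra.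
  rewrite E2 -[cmod q.2]lnK ?posrE// ler_expR -subr_ge0.
  have -> : ln (cmod z.2) + t * (ln (cmod w.2) - ln (cmod z.2)) - ln (cmod q.2) = Yc z + t * (Yc w - Yc z).
    by rewrite /Yc; ring.
  rewrite -(pmulr_rge0 _ D0).
  have -> : (X z - X w) * (Yc z + t * (Yc w - Yc z)) = (X z - X w) * Yc z + t * (X z - X w) * (Yc w - Yc z) by ring.
  by rewrite tD; lra.
pose S : set R := [set v | exists2 w, [/\ Omega w, w.1 != 0 & w.2 != 0] & 0 < Yc w /\ v = Yc w / (- X w)].
have [p [Op p1 p2 Pp1 _]] := perturb OP.
have [w0 [Ow0 w01 w02 _ Qw2]] := perturb OQ.
have Xp : 0 < X p by rewrite subr_gt0 ltr_ln ?posrE ?cmod_gt0//; exact: lt_le_trans Pp1.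
have Yw0 : 0 < Yc w0 by rewrite subr_gt0 ltr_ln ?posrE ?cmod_gt0//; exact: lt_le_trans Qw2.
have Xneg w : Omega w -> w.1 != 0 -> w.2 != 0 -> 0 < Yc w -> 0 < - X w.
  move=> Ow w1 w2 Yw; rewrite oppr_gt0 ltNge; apply/negP => Xw.
  by apply: (nd w Ow); rewrite -lnle// -subr_ge0//; exact: ltW.
have ub z : Omega z -> z.1 != 0 -> z.2 != 0 -> 0 < X z -> ubound S (- Yc z / X z).
  move=> Oz z1 z2 Xz v [w [Ow w1 w2] [Yw ->]].
  have Xw := Xneg w Ow w1 w2 Yw; have := cross z w Oz z1 z2 Ow w1 w2 Xz Yw.
  rewrite ler_pdivrMr// mulrAC ler_pdivlMr// => h; nra.
have S0 : S !=set0 by exists (Yc w0 / - X w0); exists w0.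
have hS : has_sup S by split=> //; exists (- Yc p / X p); exact: ub.
have supub v : S v -> v <= sup S by move=> Sv; exact: (sup_upper_bound hS).
exists (sup S).
  apply: (@lt_le_trans _ _ (Yc w0 / - X w0)).
    by rewrite divr_gt0// Xneg.
  by apply: supub; exists w0.
have m0 : 0 < sup S.
  apply: (@lt_le_trans _ _ (Yc w0 / - X w0)); first by rewrite divr_gt0// Xneg.
  by apply: supub; exists w0.
move=> z Oz z1 z2; rewrite -subr_ge0.
have -> : sup S * ln (cmod q.1) + ln (cmod q.2) - (sup S * ln (cmod z.1) + ln (cmod z.2)) = - (sup S * X z + Yc z).
  by rewrite /X /Yc; ring.
rewrite oppr_ge0; have [Yz|Yz] := ltP 0 (Yc z).
  have Xz := Xneg z Oz z1 z2 Yz.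
  have : Yc z / - X z <= sup S by apply: supub; exists z.
  by rewrite ler_pdivrMr//; lra.
have [Xz|Xz] := ltP 0 (X z).
  have : sup S <= - Yc z / X z by apply: ge_sup => //; exact: ub.
  by rewrite ler_pdivlMr//; lra.
have : sup S * X z <= 0 by rewrite mulr_ge0_le0// ltW.
lra.
Qed.

End LogarithmicConvexity.

(** * The three kinds of boundary points *)

Section Faces.
Variable R : realType.
Local Notation C := (Cplx R).

Lemma cmod_powR_continuous (m : R) : 0 < m -> continuous (fun z : C => cmod z `^ m).
Proof.
move=> m0 z; have [->|z0] := eqVneq z 0.
  apply/(@cvgrPdist_lt _ _ _ (nbhs (0 : C))) => e e0; apply/nbhs_cmodP.
  exists (e `^ m^-1) => [|w]; first exact: powR_gt0.
  rewrite subr0 => wd; rewrite cmod0 powR0 ?gt_eqF// sub0r normrN ger0_norm ?powR_ge0//.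
  have -> : e = (e `^ m^-1) `^ m by rewrite -powRrM mulVf ?gt_eqF// powRr1// ltW.
  by rewrite gt0_ltr_powR ?nnegrE ?powR_ge0 ?cmod_ge0.
have cz : 0 < cmod z by rewrite cmod_gt0.
have cp : {for cmod z, continuous (fun x : R => x `^ m)}.
  apply: (@differentiable_continuous R R R); apply/derivable1_diffP.
  by case: (is_derive1_powR m cz).
exact: (continuous_comp (@continuous_cmod R z) cp).
Qed.

Lemma differentiable_fst (z : C2 R) : differentiable (fst : C2 R -> C) z.
Proof. by apply: linear_differentiable => w; exact: cvg_fst. Qed.

Lemma differentiable_snd (z : C2 R) : differentiable (snd : C2 R -> C) z.
Proof. by apply: linear_differentiable => w; exact: cvg_snd. Qed.

Lemma differentiable_exp (h : C2 R -> C) (n : nat) z : differentiable h z ->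
  differentiable (fun w => h w ^+ n) z.
Proof.
move=> dh; have dX : differentiable (fun x : C => x ^+ n) (h z).
  by apply/cderivP; apply: cderivableX; exact: cderivable_id.
exact: (differentiable_comp dh dX).
Qed.

Variables (Omega : set (C2 R)) (M0 : R) (phi : C2 R -> C) (f : C -> C2 R) (z0 : C) (r0 : R).
Hypotheses (oO : open Omega) (bO : bounded2 Omega M0) (RO : complete_Reinhardt Omega).
Hypothesis cphi : {within closure Omega, continuous phi}.
Hypothesis HC : compact_operator Omega (hankel Omega phi).
Hypothesis r00 : 0 < r0.
Hypothesis f1 : forall s, cmod (s - z0) <= r0 -> cderivable (fun s => (f s).1) s.
Hypothesis f2 : forall s, cmod (s - z0) <= r0 -> cderivable (fun s => (f s).2) s.
Hypothesis fO : forall s, cmod (s - z0) <= r0 -> closure Omega (f s).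
Let q := f z0.

Let z00 : cmod (z0 - z0) <= r0. Proof. by rewrite subrr cmod0 ltW. Qed.

Let qO : closure Omega q. Proof. exact: fO. Qed.

Lemma closure_dom y z : closure Omega y -> cmod z.1 < cmod y.1 -> cmod z.2 < cmod y.2 -> Omega z.
Proof.
move=> Oy z1 z2; pose r := Num.min (cmod y.1 - cmod z.1) (cmod y.2 - cmod z.2).
have r_0 : 0 < r by rewrite lt_min !subr_gt0 z1.
have [w [Ow [w1 w2]]] := Oy _ (nbhs_near2 y r_0).
have h1 : r <= cmod y.1 - cmod z.1 by rewrite ge_min lexx.
have h2 : r <= cmod y.2 - cmod z.2 by rewrite ge_min lexx orbT.
apply: (reinhardt_dom RO Ow).
  by have := ler_cmodD_dist y.1 w.1; rewrite cmodBC; lra.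
by have := ler_cmodD_dist y.2 w.2; rewrite cmodBC; lra.
Qed.

Lemma locally_constant_cderivable (r : R) : 0 < r -> (forall s, cmod (s - z0) <= r -> f s = q) ->
  cderivable (fun s => phi (f s)) z0.
Proof.
move=> r_0 fq; apply: (@cderivable_near R (fun=> phi q)); last exact: cderivable_cst.
by apply/nbhs_cmodP; exists r => // w wr; rewrite fq// ltW.
Qed.

Let scale z : Omega z -> exists2 k : R, 1 < k & Omega (k%:C%C * z.1, k%:C%C * z.2).
Proof.
move=> Oz; have [r r_0 rO] := (@nbhs_C2P R z Omega).1 (open_nbhs_nbhs (conj oO Oz)).
pose N := cmod z.1 + cmod z.2 + 1.
have N0 : 0 < N by rewrite ltr_wpDl// addr_ge0// cmod_ge0.
pose d := r / (2 * N); have d0 : 0 < d by rewrite divr_gt0 ?mulr_gt0.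
have dN : d * N = r / 2 by rewrite /d; field; rewrite gt_eqF.
have c1 := cmod_ge0 z.1; have c2 := cmod_ge0 z.2.
exists (1 + d); first by rewrite ltrDl.
have h (a : C) : cmod a <= N -> cmod ((1 + d)%:C%C * a - a) < r.
  move=> aN; have -> : (1 + d)%:C%C * a - a = d%:C%C * a by rewrite rmorphD rmorph1; ring.
  rewrite cmodM cmod_real gtr0_norm//; have := ler_wpM2l (ltW d0) aN; lra.
by apply: rO; apply: h; rewrite /N; lra.
Qed.

(** Combines the two analytic parts: what remains to be supplied for each kind of
    boundary point is a level function [lam], holomorphic functions comparable
    with its powers, and affine maps that preserve it. *)
Lemma peak_flow_cderivable (lam : C2 R -> R) (rho0 : R) (G : nat -> C2 R -> C) (CG cG : R)
    (A1 B1 A2 B2 : C -> C) (r : R) :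
  0 < rho0 -> 0 < CG -> 0 < cG -> 0 < r -> r <= r0 ->
  continuous lam -> (forall z, 0 <= lam z) -> lam q = 1 -> (forall z, Omega z -> lam z < 1) ->
  (forall z, near2 q rho0 z -> lam z < 1 -> Omega z) ->
  (forall y, closure Omega y -> lam y = 1 -> exists a1 b1 a2 b2,
    [/\ a1 != 0, a2 != 0, taff a1 b1 a2 b2 y = q & forall z, lam (taff a1 b1 a2 b2 z) = lam z]) ->
  (forall z, near2 q rho0 z -> 0 < lam z) ->
  (forall n z, differentiable (G n) z) ->
  (forall n z, Omega z -> cmod (G n z) <= CG * lam z ^+ n) ->
  (forall n z, near2 q rho0 z -> cG * lam z ^+ n <= cmod (G n z)) ->
  (forall s, cmod (s - z0) <= r ->
    [/\ cderivable A1 s, cderivable B1 s, cderivable A2 s & cderivable B2 s]) ->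
  [/\ A1 z0 = 1, B1 z0 = 0, A2 z0 = 1 & B2 z0 = 0] ->
  (forall s z, cmod (s - z0) <= r -> lam (taff (A1 s) (B1 s) (A2 s) (B2 s) z) = lam z) ->
  (forall s, cmod (s - z0) <= r -> taff (A1 s) (B1 s) (A2 s) (B2 s) q = f s) ->
  cderivable (fun s => phi (f s)) z0.
Proof.
move=> rho00 CG0 cG0 r_0 rr0 clam lam0 lamq lamO nearO mover lamN dG GC Gc dA A0 lamT Tq.
have asy := peaks_asymptotically_holomorphic oO bO rho00 clam lam0 qO lamq lamO nearO mover lamN
  CG0 cG0 dG GC Gc cphi HC.
apply: (flow_cderivable oO bO rho00 (divr_gt0 CG0 cG0) cphi clam nearO asy r_0 dA A0 lamT Tq).
by move=> s sr; apply: fO; exact: le_trans rr0.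
Qed.

Let closure_le (h : C2 R -> R) (c : R) : continuous h -> (forall z, Omega z -> h z <= c) ->
  forall z, closure Omega z -> h z <= c.
Proof.
move=> ch Oc z Oz; have cl : closed [set z | h z <= c].
  by apply: (@closed_comp _ _ h [set t | t <= c]) => [w _|]; [exact: ch|exact: closed_le].
by apply: cl; apply: (closure_subset _ Oz) => w Ow; exact: Oc.
Qed.

Let nonconst (g : C -> C) (r : R) : (forall s, cmod (s - z0) <= r -> cderivable g s) ->
  (exists2 s, cmod (s - z0) <= r & g s <> g z0) ->
  exists2 s, cmod (s - z0) <= r & cmod (g z0) < cmod (g s).
Proof.
move=> dg [s sr gs]; apply: contrapT => h; apply: gs.
apply: (max_modulus dg) => // w wr; rewrite leNgt; apply/negP => gw; apply: h.
by exists w.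
Qed.

Let cmod1_cont : continuous (fun z : C2 R => cmod z.1).
Proof.
move=> z; have cf : {for z, continuous (fst : C2 R -> C)} by exact: cvg_fst.
exact: (continuous_comp cf (@continuous_cmod R _)).
Qed.

Let cmod2_cont : continuous (fun z : C2 R => cmod z.2).
Proof.
move=> z; have cf : {for z, continuous (snd : C2 R -> C)} by exact: cvg_snd.
exact: (continuous_comp cf (@continuous_cmod R _)).
Qed.

(** When [Omega] lies in the slab where the second coordinate is bounded by that of
    [q], the second coordinate of [f] is constant by the maximum principle, and the
    translations of the first one follow [f]. Unless [f] is constant, it reaches a
    boundary point [f s] whose first coordinate is larger than that of [q]; below it,
    [Omega] fills a neighbourhood of [q] up to the face. *)
Lemma face2_cderivable : Omega !=set0 -> (forall z, Omega z -> cmod z.2 <= cmod q.2) ->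
  cderivable (fun s => phi (f s)) z0.
Proof.
move=> [x Ox] O2.
have Cl2 := closure_le cmod2_cont O2.
have O2s z : Omega z -> cmod z.2 < cmod q.2.
  move=> Oz; have [k k1 Ok] := scale Oz; have [z2|z2] := eqVneq z.2 0; last first.
    apply: lt_le_trans (O2 _ Ok); rewrite /= cmodM cmod_real gtr0_norm; last by lra.
    by rewrite ltr_pMl// cmod_gt0.
  have [r r_0 rO] := (@nbhs_C2P R z Omega).1 (open_nbhs_nbhs (conj oO Oz)).
  have r2 : 0 < r / 2 by lra.
  have : Omega (z.1, (r / 2)%:C%C).
    apply: rO; first by rewrite subrr cmod0.
    rewrite z2 subr0 cmod_real gtr0_norm//; lra.
  move=> /O2 h; have {h} : cmod ((r / 2)%:C%C : C) <= cmod q.2 := h.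
  by rewrite z2 cmod0 cmod_real gtr0_norm//; exact: lt_le_trans.
have q2 : 0 < cmod q.2 by apply: le_lt_trans (O2s x Ox); exact: cmod_ge0.
have q2n : q.2 != 0 by rewrite -cmod_gt0.
have f2q s : cmod (s - z0) <= r0 -> (f s).2 = q.2.
  by apply: (max_modulus (p := fun s => (f s).2)) => // w wr; apply/Cl2/fO.
have [fc|/existsNP[s1 /not_implyP[s1r fs1]]] := pselect (forall s, cmod (s - z0) <= r0 -> (f s).1 = q.1).
  apply: (locally_constant_cderivable r00) => s sr; rewrite [f s]surjective_pairing fc// f2q//.
  by rewrite -surjective_pairing.
have [|s sr fs] := nonconst f1; first by exists s1.
rewrite -/q in fs.
pose lam (z : C2 R) := cmod z.2 / cmod q.2.
pose rho0 := Num.min (cmod (f s).1 - cmod q.1) (cmod q.2 / 2).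
have rho00 : 0 < rho0 by rewrite lt_min subr_gt0 fs divr_gt0.
have rho1 : rho0 <= cmod (f s).1 - cmod q.1 by rewrite ge_min lexx.
have rho2 : rho0 <= cmod q.2 / 2 by rewrite ge_min lexx orbT.
apply: (@peak_flow_cderivable lam rho0 (fun n z => (q.2^-1 * z.2) ^+ n) 1 1
  (fun=> 1) (fun s => (f s).1 - q.1) (fun=> 1) (fun=> 0) r0 rho00 ltr01 ltr01 r00 (lexx r0)).
- move=> z; apply: (@continuousM _ _ (fun z : C2 R => cmod z.2) (fun=> (cmod q.2)^-1)); last exact: cvg_cst.
  exact: cmod2_cont.
- by move=> z; rewrite divr_ge0 ?cmod_ge0.
- by rewrite /lam divff// gt_eqF.
- by move=> z /O2s; rewrite /lam ltr_pdivrMr// mul1r.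
- move=> z [z1 z2]; rewrite /lam ltr_pdivrMr// mul1r => zq.
  apply: (closure_dom (fO sr)); last by rewrite f2q.
  by have := ler_cmodD_dist z.1 q.1; lra.
- move=> y Oy; rewrite /lam => y2; have yq : cmod y.2 = cmod q.2.
    by rewrite -[LHS](divfK (lt0r_neq0 q2)) y2 mul1r.
  have y2n : y.2 != 0 by rewrite -cmod_gt0 yq.
  exists 1, (q.1 - y.1), (q.2 / y.2), 0; split=> //.
  + by rewrite mulf_neq0 ?invr_neq0.
  + rewrite /taff mul1r addr0 divfK// addrC subrK; by case: (q).
  + by move=> z; rewrite /taff /= addr0 !cmodM cmodV yq divff ?mul1r// gt_eqF.
- move=> z [_ z2]; rewrite divr_gt0//; have := ler_cmodD_dist q.2 z.2; rewrite cmodBC; lra.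
- move=> n z; apply: differentiable_exp; apply: differentiableM; first exact: differentiable_cst.
  exact: differentiable_snd.
- by move=> n z _; rewrite mul1r cmodX cmodM cmodV mulrC.
- by move=> n z _; rewrite mul1r cmodX cmodM cmodV mulrC.
- move=> w wr; split; try exact: cderivable_cst.
  apply: cderivableD; [exact: f1|exact: cderivable_cst].
- by rewrite subrr.
- by move=> w z wr; rewrite /lam /taff /= mul1r addr0.
- move=> w wr; rewrite /taff !mul1r addr0 addrC subrK -(f2q w wr); by case: (f w).
Qed.

(** The mirror image of [face2_cderivable]. *)
Lemma face1_cderivable : Omega !=set0 -> (forall z, Omega z -> cmod z.1 <= cmod q.1) ->
  cderivable (fun s => phi (f s)) z0.
Proof.
move=> [x Ox] O1.
have Cl1 := closure_le cmod1_cont O1.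
have O1s z : Omega z -> cmod z.1 < cmod q.1.
  move=> Oz; have [k k1 Ok] := scale Oz; have [z2|z2] := eqVneq z.1 0; last first.
    apply: lt_le_trans (O1 _ Ok); rewrite /= cmodM cmod_real gtr0_norm; last by lra.
    by rewrite ltr_pMl// cmod_gt0.
  have [r r_0 rO] := (@nbhs_C2P R z Omega).1 (open_nbhs_nbhs (conj oO Oz)).
  have r2 : 0 < r / 2 by lra.
  have : Omega ((r / 2)%:C%C, z.2).
    apply: rO; last by rewrite subrr cmod0.
    rewrite z2 subr0 cmod_real gtr0_norm//; lra.
  move=> /O1 h; have {h} : cmod ((r / 2)%:C%C : C) <= cmod q.1 := h.
  by rewrite z2 cmod0 cmod_real gtr0_norm//; exact: lt_le_trans.
have q2 : 0 < cmod q.1 by apply: le_lt_trans (O1s x Ox); exact: cmod_ge0.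
have q2n : q.1 != 0 by rewrite -cmod_gt0.
have f1q s : cmod (s - z0) <= r0 -> (f s).1 = q.1.
  by apply: (max_modulus (p := fun s => (f s).1)) => // w wr; apply/Cl1/fO.
have [fc|/existsNP[s1 /not_implyP[s1r fs1]]] := pselect (forall s, cmod (s - z0) <= r0 -> (f s).2 = q.2).
  apply: (locally_constant_cderivable r00) => s sr; rewrite [f s]surjective_pairing fc// f1q//.
  by rewrite -surjective_pairing.
have [|s sr fs] := nonconst f2; first by exists s1.
rewrite -/q in fs.
pose lam (z : C2 R) := cmod z.1 / cmod q.1.
pose rho0 := Num.min (cmod (f s).2 - cmod q.2) (cmod q.1 / 2).
have rho00 : 0 < rho0 by rewrite lt_min subr_gt0 fs divr_gt0.
have rho1 : rho0 <= cmod (f s).2 - cmod q.2 by rewrite ge_min lexx.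
have rho2 : rho0 <= cmod q.1 / 2 by rewrite ge_min lexx orbT.
apply: (@peak_flow_cderivable lam rho0 (fun n z => (q.1^-1 * z.1) ^+ n) 1 1
  (fun=> 1) (fun=> 0) (fun=> 1) (fun s => (f s).2 - q.2) r0 rho00 ltr01 ltr01 r00 (lexx r0)).
- move=> z; apply: (@continuousM _ _ (fun z : C2 R => cmod z.1) (fun=> (cmod q.1)^-1)); last exact: cvg_cst.
  exact: cmod1_cont.
- by move=> z; rewrite divr_ge0 ?cmod_ge0.
- by rewrite /lam divff// gt_eqF.
- by move=> z /O1s; rewrite /lam ltr_pdivrMr// mul1r.
- move=> z [_ z2]; rewrite /lam ltr_pdivrMr// mul1r => zq.
  apply: (closure_dom (fO sr)); first by rewrite f1q.
  by have := ler_cmodD_dist z.2 q.2; lra.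
- move=> y Oy; rewrite /lam => y2; have yq : cmod y.1 = cmod q.1.
    by rewrite -[LHS](divfK (lt0r_neq0 q2)) y2 mul1r.
  have y2n : y.1 != 0 by rewrite -cmod_gt0 yq.
  exists (q.1 / y.1), 0, 1, (q.2 - y.2); split=> //.
  + by rewrite mulf_neq0 ?invr_neq0.
  + rewrite /taff mul1r addr0 divfK// (addrC y.2) subrK; by case: (q).
  + by move=> z; rewrite /taff /= addr0 !cmodM cmodV yq divff ?mul1r// gt_eqF.
- move=> z [z1 _]; rewrite divr_gt0//; have := ler_cmodD_dist q.1 z.1; rewrite cmodBC; lra.
- move=> n z; apply: differentiable_exp; apply: differentiableM; first exact: differentiable_cst.
  exact: differentiable_fst.
- by move=> n z _; rewrite mul1r cmodX cmodM cmodV mulrC.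
- by move=> n z _; rewrite mul1r cmodX cmodM cmodV mulrC.
- move=> w wr; split; try exact: cderivable_cst.
  apply: cderivableD; [exact: f2|exact: cderivable_cst].
- by rewrite subrr.
- by move=> w z wr; rewrite /lam /taff /= mul1r addr0.
- move=> w wr; rewrite /taff !mul1r addr0 (addrC q.2) subrK -(f1q w wr); by case: (f w).
Qed.

Hypothesis psO : pseudoconvex Omega.

Section Monomial.
Variable m : R.
Hypothesis m0 : 0 < m.
Hypotheses (q1 : q.1 != 0) (q2 : q.2 != 0).
Let c := cmod q.1 `^ m * cmod q.2.
Let lam (z : C2 R) := cmod z.1 `^ m * cmod z.2 / c.
Let Lq := m * ln (cmod q.1) + ln (cmod q.2).

Let c0 : 0 < c. Proof. by rewrite mulr_gt0 ?powR_gt0 ?cmod_gt0. Qed.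

Let lam_cont : continuous lam.
Proof.
move=> z; have cf : {for z, continuous (fst : C2 R -> C)} by exact: cvg_fst.
have cp := continuous_comp cf (@cmod_powR_continuous m m0 _).
apply: (@continuousM R (C2 R) (fun z => cmod z.1 `^ m * cmod z.2) (fun=> c^-1)); last exact: cvg_cst.
apply: (@continuousM R (C2 R) (fun z => cmod z.1 `^ m) (fun z => cmod z.2)); last exact: cmod2_cont.
exact: cp.
Qed.

Let lam0 z : 0 <= lam z.
Proof. by apply: divr_ge0; [exact: mulr_ge0 (powR_ge0 _ _) (cmod_ge0 _)|exact: ltW]. Qed.

Let lam_gt0 z : z.1 != 0 -> z.2 != 0 -> 0 < lam z.
Proof. by move=> z1 z2; rewrite divr_gt0// mulr_gt0 ?powR_gt0 ?cmod_gt0. Qed.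

Let lam_eq0 z : lam z != 0 -> z.1 != 0 /\ z.2 != 0.
Proof.
have mn : m != 0 by rewrite gt_eqF.
move=> l; split; apply: contraNneq l => h; rewrite /lam h cmod0; last by rewrite mulr0 mul0r.
by rewrite powR0// mul0r mul0r.
Qed.

Let ln_lam z : z.1 != 0 -> z.2 != 0 -> ln (lam z) = m * ln (cmod z.1) + ln (cmod z.2) - Lq.
Proof.
move=> z1 z2; have p (w : C2 R) : w.1 != 0 -> w.2 != 0 -> 0 < cmod w.1 `^ m * cmod w.2.
  by move=> w1 w2; rewrite mulr_gt0 ?powR_gt0 ?cmod_gt0.
rewrite ln_div ?posrE ?p// !lnM ?posrE ?powR_gt0 ?cmod_gt0// !ln_powR /Lq; ring.
Qed.

Let lam_scale a1 a2 z : lam (taff a1 0 a2 0 z) = cmod a1 `^ m * cmod a2 * lam z.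
Proof.
rewrite /lam /taff /= !addr0 ![cmod (_ * _)]cmodM powRM ?cmod_ge0//.
move: (_ `^ m) (_ `^ m) c^-1 => a b k; ring.
Qed.

Let lamq : lam q = 1. Proof. by rewrite /lam divff// gt_eqF. Qed.

Let ln1_le (x : R) : 0 < x -> (ln x <= 0) = (x <= 1).
Proof. by move=> x0; rewrite -ln1 ler_ln ?posrE. Qed.

Let ln1_lt (x : R) : 0 < x -> (ln x < 0) = (x < 1).
Proof. by move=> x0; rewrite -ln1 ltr_ln ?posrE. Qed.

Hypothesis sup : forall z, Omega z -> z.1 != 0 -> z.2 != 0 -> m * ln (cmod z.1) + ln (cmod z.2) <= Lq.

Let lamO z : Omega z -> lam z < 1.
Proof.
move=> Oz; have [->|/lam_eq0[z1 z2]] := eqVneq (lam z) 0; first by rewrite ltr01.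
have [k k1 Ok] := scale Oz; have k0 : 0 < k by lra.
have kn : k%:C%C != 0 :> C by rewrite -cmod_gt0 cmod_real gtr0_norm.
rewrite -ln1_lt ?lam_gt0// ln_lam//.
have := sup Ok; rewrite /= !mulf_neq0// => /(_ isT isT).
rewrite !cmodM cmod_real gtr0_norm// !lnM ?posrE ?cmod_gt0//.
have := ln_gt0 k1 => lk; have := mulr_gt0 m0 lk; lra.
Qed.

Let lamC z : closure Omega z -> lam z <= 1.
Proof. by apply: (closure_le lam_cont) => w /lamO /ltW. Qed.

(** Along the disc, the logarithm of [lam] is harmonic, nonpositive, and zero at
    the centre; hence it vanishes. *)
Let lam_disc : exists2 r, 0 < r <= r0 & forall s, cmod (s - z0) <= r ->
  [/\ (f s).1 != 0, (f s).2 != 0 & lam (f s) = 1].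
Proof.
pose g1 s := (f s).1 / q.1; pose g2 s := (f s).2 / q.2.
have dg1 s : cmod (s - z0) <= r0 -> cderivable g1 s.
  by move=> sr; apply: cderivableM; [exact: f1|exact: cderivable_cst].
have dg2 s : cmod (s - z0) <= r0 -> cderivable g2 s.
  by move=> sr; apply: cderivableM; [exact: f2|exact: cderivable_cst].
have small g : cderivable g z0 -> g z0 = 1 -> exists2 d, 0 < d & forall s, cmod (s - z0) < d -> 0 < complex.Re (g s).
  move=> /cderivable_continuous cg g1'; have h0 : 0 < 2^-1 :> R by [].
  have [d d0 dP] := (@nbhs_cmodP R z0 _).1 ((@cvg_cmodP R _ _ _ g (g z0)).1 cg _ h0).
  exists d => // s /dP /= h; have := ler_Re_cmod (g s - g z0).
  rewrite raddfB /= g1' /= ler_norml => /andP[k _]; move: h; rewrite g1'; lra.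
have [d1 d10 h1] := small g1 (dg1 _ z00) (divff q1).
have [d2 d20 h2] := small g2 (dg2 _ z00) (divff q2).
pose r := Num.min r0 (Num.min d1 d2 / 2).
have m12 : 0 < Num.min d1 d2 by rewrite lt_min d10.
have r_0 : 0 < r by rewrite lt_min r00 divr_gt0.
have rr0 : r <= r0 by rewrite ge_min lexx.
have rd : r < Num.min d1 d2 by have : r <= Num.min d1 d2 / 2 by [rewrite ge_min lexx orbT]; lra.
exists r; first by rewrite r_0.
have Rg s : cmod (s - z0) <= r -> 0 < complex.Re (g1 s) /\ 0 < complex.Re (g2 s).
  by move=> sr; have := le_lt_trans sr rd; rewrite lt_min => /andP[k1 k2]; split; [exact: h1|exact: h2].
have neq0 (a b : C) : 0 < complex.Re (a / b) -> a != 0.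
  by apply: contraTneq => ->; rewrite mul0r ltxx.
have fn s : cmod (s - z0) <= r -> (f s).1 != 0 /\ (f s).2 != 0.
  by move=> /Rg[k1 k2]; split; [exact: neq0 k1|exact: neq0 k2].
have lnE s : cmod (s - z0) <= r -> ln (lam (f s)) = m * ln (cmod (g1 s)) + ln (cmod (g2 s)).
  move=> sr; have [k1 k2] := fn s sr.
  rewrite ln_lam// /g1 /g2 !cmodM !cmodV !ln_div ?posrE ?cmod_gt0// /Lq; ring.
move=> s sr; have [k1 k2] := fn s sr; split=> //.
have [->|sz] := eqVneq s z0; first exact: lamq.
pose rs := cmod (s - z0); have rs0 : 0 < rs by rewrite cmod_gt0 subr_eq0.
have rsn : rs%:C%C != 0 :> C by rewrite -cmod_gt0 cmod_real gtr0_norm.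
pose om := (s - z0) / rs%:C%C.
have om1 : cmod om = 1 by rewrite cmodM cmodV cmod_real gtr0_norm// divff// gt_eqF.
have wr w : cmod (w - 0) <= rs -> cmod (z0 + om * w - z0) <= r.
  by rewrite subr0 addrC addKr cmodM om1 mul1r => h; exact: le_trans h sr.
have circ_r t : cmod (circ 0 rs t - 0) <= rs by rewrite cmod_circ// ltW.
pose h (g : C -> C) w := g (z0 + om * w).
have dh g : (forall s, cmod (s - z0) <= r0 -> cderivable g s) ->
    forall w, cmod (w - 0) <= rs -> cderivable (h g) w.
  move=> dg w /wr wr'; apply: (@cderivable_comp R (fun w => z0 + om * w) g); last exact/dg/(le_trans wr' rr0).
  apply: cderivableD; first exact: cderivable_cst.
  by apply: cderivableM; [exact: cderivable_cst|exact: cderivable_id].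
have h0 g : g z0 = 1 -> h g 0 = 1 by rewrite /h mulr0 addr0.
have I1 := Re_mean_ln rs0 (dh g1 dg1) (fun w ww => (Rg _ (wr w ww)).1) (@h0 g1 (divff q1)).
have I2 := Re_mean_ln rs0 (dh g2 dg2) (fun w ww => (Rg _ (wr w ww)).2) (@h0 g2 (divff q2)).
have cl g : (forall s, cmod (s - z0) <= r0 -> cderivable g s) ->
    (forall s, cmod (s - z0) <= r -> 0 < complex.Re (g s)) ->
    cont_itv 0 (2 * pi) (fun t => ln (cmod (h g (circ 0 rs t)))).
  move=> dg Rg' t _.
  have c1 : {for t, continuous (fun t => h g (circ 0 rs t))}.
    exact: (continuous_comp (@continuous_circ R 0 rs t) (cderivable_continuous (dh g dg _ (circ_r t)))).
  apply: (@continuous_comp _ _ _ (fun t => cmod (h g (circ 0 rs t))) (@ln R)).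
    exact: (continuous_comp c1 (@continuous_cmod R _)).
  apply: continuous_ln; apply: lt_le_trans (ler_Re_cmod _); apply: lt_le_trans (ler_norm _).
  exact/Rg'/wr/circ_r.
have cl1 := cl g1 dg1 (fun s sr => (Rg s sr).1).
have cl2 := cl g2 dg2 (fun s sr => (Rg s sr).2).
have p0 := twopi_gt0 R.
have I := rint_affine 0 (- m) (- 1) (ltW p0) cl1 cl2.
rewrite I1 I2 !mulr0 mul0r !addr0 in I.
have E t : 0 + - m * ln (cmod (h g1 (circ 0 rs t))) + - 1 * ln (cmod (h g2 (circ 0 rs t))) =
    - ln (lam (f (z0 + om * circ 0 rs t))).
  by rewrite lnE; [rewrite /h; ring|exact/wr/circ_r].
pose F t := 0 + - m * ln (cmod (h g1 (circ 0 rs t))) + - 1 * ln (cmod (h g2 (circ 0 rs t))).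
have cF : cont_itv 0 (2 * pi) F.
  have cM (a : R) (k : R -> R) t : {for t, continuous k} -> {for t, continuous (fun t => a * k t)}.
    by move=> ck; apply: (@continuousM _ _ (fun=> a) k); [exact: cvg_cst|exact: ck].
  move=> t tt; apply: (@continuousD R R R (fun t => 0 + - m * ln (cmod (h g1 (circ 0 rs t)))) (fun t => - 1 * ln (cmod (h g2 (circ 0 rs t))))).
    apply: (@continuousD R R R (fun=> 0) (fun t => - m * ln (cmod (h g1 (circ 0 rs t))))); first exact: cvg_cst.
    by apply: cM; exact: cl1.
  by apply: cM; exact: cl2.
have F0 : F 0 = 0.
  apply: (rint_eq0 p0 cF); last by rewrite I.
  move=> t _; rewrite /F E oppr_ge0; have wc := wr _ (circ_r t); have [l1 l2] := fn _ wc.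
  by rewrite ln1_le ?lam_gt0//; apply/lamC/fO/(le_trans wc).
move: F0; rewrite /F E.
have -> : z0 + om * circ 0 rs 0 = s by rewrite /circ cis0 mulr1 add0r /om divfK// addrC subrK.
move=> /eqP; rewrite oppr_eq0 => /eqP l.
by apply: ln_inj; rewrite ?posrE ?lam_gt0// l ln1.
Qed.

Let pow_split (x : R) n : 0 < x ->
  x ^+ (Num.truncn (m * n%:R)).+1 = (x `^ m) ^+ n * x `^ ((Num.truncn (m * n%:R)).+1%:R - m * n%:R).
Proof.
move=> x0; rewrite -!powR_mulrn ?powR_ge0 ?(ltW x0)// -powRrM -powRD; last by rewrite (gt_eqF x0) implybT.
by congr (_ `^ _); ring.
Qed.

Let frac n : 0 <= (Num.truncn (m * n%:R)).+1%:R - m * n%:R <= 1.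
Proof.
have mn : 0 <= m * n%:R by apply: mulr_ge0; [exact: ltW|exact: ler0n].
have /andP[h1 h2] := truncn_itv mn; rewrite subr_ge0 (ltW h2)/= -natr1; lra.
Qed.

(* the exponent [m * n] is rounded up to an integer; [frac] bounds what is added *)
Let G n (z : C2 R) : C := (c ^+ n)^-1%:C%C * z.1 ^+ (Num.truncn (m * n%:R)).+1 * z.2 ^+ n.

Let cmodG n z : cmod (G n z) = (c ^+ n)^-1 * cmod z.1 ^+ (Num.truncn (m * n%:R)).+1 * cmod z.2 ^+ n.
Proof.
by rewrite /G ![cmod (_ * _)]cmodM !cmodX cmod_real gtr0_norm// invr_gt0 exprn_gt0.
Qed.

Let cmodG_lam n z : z.1 != 0 ->
  cmod (G n z) = lam z ^+ n * cmod z.1 `^ ((Num.truncn (m * n%:R)).+1%:R - m * n%:R).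
Proof.
move=> z1; rewrite cmodG pow_split ?cmod_gt0// /lam.
move: (c) (_ `^ m) (_ `^ (_ - _)) (cmod z.2) => k a b y; rewrite !exprMn exprVn; ring.
Qed.

(** Coordinatewise multiplication by [f s / q] preserves [lam] and carries [q] to
    [f s], and every boundary point of level [1] is moved to [q] in the same way.
    Unless [f] is constant, the first coordinate of [f] takes moduli on both sides
    of that of [q]; by [log_convex] the logarithmic image of [Omega] fills the
    region below the supporting line between two such points, so [lam < 1] describes
    [Omega] near [q]. *)
Lemma monomial_cderivable : cderivable (fun s => phi (f s)) z0.
Proof.
have [r /andP[r_0 rr0] lf] := lam_disc.
have f1r s : cmod (s - z0) <= r -> cderivable (fun s => (f s).1) s by move=> sr; apply/f1/(le_trans sr).
have f2r s : cmod (s - z0) <= r -> cderivable (fun s => (f s).2) s by move=> sr; apply/f2/(le_trans sr).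
have [fc|/existsNP[s1 /not_implyP[s1r fs1]]] := pselect (forall s, cmod (s - z0) <= r -> (f s).1 = q.1).
  apply: (locally_constant_cderivable r_0) => s sr.
  have f2q : (f s).2 = q.2.
    apply: (max_modulus f2r) => // w wr; have [_ _] := lf w wr.
    have cq : 0 < cmod q.1 `^ m by rewrite powR_gt0// cmod_gt0.
    by rewrite -lamq /lam fc// => /(mulIf (invr_neq0 (lt0r_neq0 c0))) /(mulfI (lt0r_neq0 cq)) ->.
  by rewrite [f s]surjective_pairing fc// f2q -surjective_pairing.
have [|s' s'r fs'] := nonconst f1r; first by exists s1.
have f1V s : cmod (s - z0) <= r -> cderivable (fun s => (f s).1^-1) s.
  by move=> sr; apply: cderivableV; [exact: f1r|case: (lf s sr)].
have [|s'' s''r] := nonconst f1V; first by exists s1 => // /invr_inj.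
have [n1' n2' l'] := lf s' s'r; have [n1'' n2'' l''] := lf s'' s''r.
rewrite -/q in fs'; rewrite -/q !cmodV ltf_pV2 ?posrE ?cmod_gt0// => fs''.
have q1p : 0 < cmod q.1 by rewrite cmod_gt0.
have q2p : 0 < cmod q.2 by rewrite cmod_gt0.
pose rho0 := Num.min (Num.min (cmod (f s').1 - cmod q.1) (cmod q.1 - cmod (f s'').1)) (Num.min (cmod q.1 / 2) (cmod q.2 / 2)).
have rho00 : 0 < rho0 by rewrite !lt_min !subr_gt0 fs' fs'' !divr_gt0.
have [rh1 rh2 rh3 rh4] : [/\ rho0 <= cmod (f s').1 - cmod q.1, rho0 <= cmod q.1 - cmod (f s'').1,
    rho0 <= cmod q.1 / 2 & rho0 <= cmod q.2 / 2].
  by split; rewrite !ge_min lexx ?orbT.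
clearbody rho0.
have near z : near2 q rho0 z -> [/\ cmod (f s'').1 < cmod z.1, cmod z.1 < cmod (f s').1,
    cmod q.1 / 2 <= cmod z.1 & z.1 != 0 /\ z.2 != 0].
  move=> [h1 h2]; have k1 := ler_cmodD_dist z.1 q.1; have k2 := ler_cmodD_dist q.1 z.1.
  have k3 := ler_cmodD_dist q.2 z.2; rewrite (cmodBC q.1) in k2; rewrite (cmodBC q.2) in k3.
  by rewrite -!cmod_gt0; split; [lra|lra|lra|split; lra].
apply: (@peak_flow_cderivable lam rho0 G (Num.max 1 M0) (Num.min 1 (cmod q.1 / 2))
  (fun s => (f s).1 / q.1) (fun=> 0) (fun s => (f s).2 / q.2) (fun=> 0) r rho00).
- by rewrite lt_max ltr01.
- by rewrite lt_min ltr01 divr_gt0.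
- exact: r_0.
- exact: rr0.
- exact: lam_cont.
- exact: lam0.
- exact: lamq.
- exact: lamO.
- move=> z /near[z1'' z1' _ [z1 z2]] zl.
  have ll w : w.1 != 0 -> w.2 != 0 -> lam w = 1 -> ln (cmod w.2) = Lq - m * ln (cmod w.1).
    by move=> w1 w2 lw; have := ln_lam w1 w2; rewrite lw ln1; lra.
  have y' := ll _ n1' n2' l'; have y'' := ll _ n1'' n2'' l''.
  have d0 : 0 < Lq - (m * ln (cmod z.1) + ln (cmod z.2)).
    by rewrite -oppr_lt0 opprB -ln_lam// ln1_lt ?lam_gt0.
  have x1 : ln (cmod (f s'').1) < ln (cmod z.1) by rewrite ltr_ln ?posrE ?cmod_gt0.
  have x2 : ln (cmod z.1) < ln (cmod (f s').1) by rewrite ltr_ln ?posrE ?cmod_gt0.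
  set a' := ln (cmod (f s').1) in x2 y'; set a'' := ln (cmod (f s'').1) in x1 y''.
  set x := ln (cmod z.1) in x1 x2 d0; set y := ln (cmod z.2) in d0.
  pose d := Num.min ((Lq - (m * x + y)) / (m + 1)) (a' - x).
  have m1 : 0 < m + 1 by rewrite addr_gt0.
  have d_0 : 0 < d by rewrite lt_min divr_gt0// subr_gt0.
  have d1 : d <= a' - x by rewrite ge_min lexx orbT.
  have d2 : d * (m + 1) <= Lq - (m * x + y) by rewrite -ler_pdivlMr// ge_min lexx.
  clearbody d.
  have OE s n1 n2 : cmod (s - z0) <= r -> (f s).1 != 0 -> (f s).2 != 0 ->
      ln (cmod (f s).1) = n1 -> ln (cmod (f s).2) = n2 ->
      Omega ((expR (n1 - d))%:C%C, (expR (n2 - d))%:C%C).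
    move=> sr k1 k2 <- <-; have h (u : C) : u != 0 -> cmod ((expR (ln (cmod u) - d))%:C%C : C) < cmod u.
      move=> u0; rewrite cmod_real gtr0_norm ?expR_gt0//.
      rewrite -[ltRHS]lnK ?posrE ?cmod_gt0// ltr_expR; lra.
    by apply: (closure_dom (fO (le_trans sr rr0))); exact: h.
  have P' := OE s' _ _ s'r n1' n2' erefl y'; have P'' := OE s'' _ _ s''r n1'' n2'' erefl y''.
  have xx : a'' - d < a' - d by lra.
  have yy : Lq - m * a' - d < Lq - m * a'' - d by rewrite ltrD2r ltrD2l ltrN2 ltr_pM2l//; lra.
  have seg := log_convex oO RO psO xx yy P' P''.
  pose t := (a' - (x + d)) / (a' - a'').
  have D0 : 0 < a' - a'' by lra.
  have tD : t * (a' - a'') = a' - (x + d) by rewrite divfK// gt_eqF.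
  have t01 : 0 <= t <= 1.
    by rewrite /t divr_ge0 ?(ltW D0)//=; [rewrite ler_pdivrMr// mul1r; lra|lra].
  pose p : C2 R := ((expR (a' - d + t * (a'' - d - (a' - d))))%:C%C,
    (expR (Lq - m * a' - d + t * (Lq - m * a'' - d - (Lq - m * a' - d))))%:C%C).
  have Ep (e : R) : cmod ((expR e)%:C%C : C) = expR e by rewrite cmod_real gtr0_norm// expR_gt0.
  have Op : Omega p by apply: seg; exists t => //; split; exact: Ep.
  apply: (reinhardt_dom RO Op).
    apply: (@le_trans _ _ (expR (a' - d + t * (a'' - d - (a' - d))))); last by rewrite -[leLHS]Ep.
    rewrite -[leLHS]lnK ?posrE ?cmod_gt0// ler_expR -/x; lra.
  apply: (@le_trans _ _ (expR (Lq - m * a' - d + t * (Lq - m * a'' - d - (Lq - m * a' - d))))); last by rewrite -[leLHS]Ep.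
  rewrite -[leLHS]lnK ?posrE ?cmod_gt0// ler_expR -/y.
  have -> : Lq - m * a' - d + t * (Lq - m * a'' - d - (Lq - m * a' - d)) = Lq - m * a' - d + m * (t * (a' - a'')) by ring.
  rewrite tD; lra.
- move=> y Oy ly; have [y1 y2] : y.1 != 0 /\ y.2 != 0 by apply: lam_eq0; rewrite ly oner_neq0.
  exists (q.1 / y.1), 0, (q.2 / y.2), 0; split; [by rewrite mulf_neq0 ?invr_neq0|by rewrite mulf_neq0 ?invr_neq0| |].
    by rewrite /taff !addr0 !divfK// -surjective_pairing.
  have h : lam (taff (q.1 / y.1) 0 (q.2 / y.2) 0 y) = 1.
    by rewrite -[RHS]lamq /taff !addr0 !divfK// -surjective_pairing.
  by move=> z; rewrite lam_scale; move: h; rewrite lam_scale ly mulr1 => ->; rewrite mul1r.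
- by move=> z /near[_ _ _ [z1 z2]]; exact: lam_gt0.
- move=> n z; apply: differentiableM; last by apply: differentiable_exp; exact: differentiable_snd.
  apply: differentiableM; first exact: differentiable_cst.
  by apply: differentiable_exp; exact: differentiable_fst.
- move=> n z Oz; have [z1|z1] := eqVneq z.1 0.
    by rewrite cmodG z1 cmod0 expr0n mulr0 mul0r mulr_ge0 ?exprn_ge0// le_max ler01.
  rewrite cmodG_lam// mulrC ler_wpM2r ?exprn_ge0//.
  have zp : 0 < cmod z.1 by rewrite cmod_gt0.
  have /andP[t0 t1] := frac n; have [zM _] := bO Oz; rewrite le_max.
  have [x1|x1] := leP (cmod z.1) 1.
    by rewrite -[X in _ <= X](powRr0 (cmod z.1)) ger_powR// zp.
  apply/orP; right; apply: le_trans zM; rewrite -[leRHS]powRr1 ?(ltW zp)//.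
  by apply: ler_powR => //; exact: ltW.
- move=> n z /near[_ _ zq [z1 z2]]; rewrite cmodG_lam// [leRHS]mulrC ler_wpM2r ?exprn_ge0//.
  have zp : 0 < cmod z.1 by rewrite cmod_gt0.
  have /andP[t0 t1] := frac n; rewrite ge_min.
  have [x1|x1] := leP (cmod z.1) 1; apply/orP; [right|left].
    apply: le_trans zq _; rewrite -[leLHS]powRr1 ?(ltW zp)//; apply: ger_powR => //; by rewrite zp.
  by rewrite -[X in X <= _](powRr0 (cmod z.1)); apply: ler_powR; [exact: ltW|exact: t0].
- move=> s sr; split; try exact: cderivable_cst.
    by apply: cderivableM; [exact: f1r|exact: cderivable_cst].
  by apply: cderivableM; [exact: f2r|exact: cderivable_cst].
- by split; rewrite // divff.
- move=> s z sr; have [_ _ ls] := lf s sr.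
  have h : lam (taff ((f s).1 / q.1) 0 ((f s).2 / q.2) 0 q) = 1.
    by rewrite -[RHS]ls /taff !addr0 !divfK// -surjective_pairing.
  by rewrite lam_scale; move: h; rewrite lam_scale lamq mulr1 => ->; rewrite mul1r.
- by move=> s sr; rewrite /taff !addr0 !divfK// -surjective_pairing.
Qed.
End Monomial.
End Faces.

Theorem corollary2 (R : realType) (Omega : set (C2 R))
  (phi : C2 R -> Cplx R)
  (Omega_domain : domain Omega)
  (Omega_bounded : bounded_set Omega)
  (Omega_pseudoconvex : pseudoconvex Omega)
  (Omega_Reinhardt : complete_Reinhardt Omega)
  (phi_continuous : {within closure Omega, continuous phi})
  (hankel_compact : compact_operator Omega (hankel Omega phi))
  (f : Cplx R -> C2 R)
  (f_holomorphic : holomorphic_on (@unit_disc R) f)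
  (f_boundary : f @` @unit_disc R `<=` boundary Omega) :
  holomorphic_on (@unit_disc R) (phi \o f).
Proof.
move=> z0; rewrite /unit_disc /= cmodE -(@rmorph1 _ _ (@real_complex R)) ltcR => z01.
have [oO _ O0] := Omega_domain; have [M0 _ bO] := bounded_setP Omega_bounded.
pose r0 := (1 - cmod z0) / 2; have r00 : 0 < r0 by rewrite divr_gt0// subr_gt0.
have disc s : cmod (s - z0) <= r0 -> unit_disc s.
  move=> sr; rewrite /unit_disc /= cmodE -(@rmorph1 _ _ (@real_complex R)) ltcR.
  by have := ler_cmodD_dist s z0; move: sr; rewrite /r0; lra.
have df s : cmod (s - z0) <= r0 -> differentiable f s by move=> /disc; exact: f_holomorphic.
have f1 s : cmod (s - z0) <= r0 -> cderivable (fun s => (f s).1) s.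
  by move=> /df ds; apply/cderivP; exact: (differentiable_comp ds (differentiable_fst _)).
have f2 s : cmod (s - z0) <= r0 -> cderivable (fun s => (f s).2) s.
  by move=> /df ds; apply/cderivP; exact: (differentiable_comp ds (differentiable_snd _)).
have fb s : cmod (s - z0) <= r0 -> boundary Omega (f s).
  by move=> /disc sd; apply: f_boundary; exists s.
have fO s : cmod (s - z0) <= r0 -> closure Omega (f s) by move=> /fb[].
have nq : ~ Omega (f z0).
  have [|_ ni] := fb z0; first by rewrite subrr cmod0 ltW.
  by move=> Oq; apply: ni; exact: open_nbhs_nbhs.
apply/cderivP.
have [face1|face2|[q1 q2 [m m0 mO]]] := monomial_support oO Omega_Reinhardt Omega_pseudoconvex nq.
- exact: (face1_cderivable oO bO Omega_Reinhardt phi_continuous hankel_compact r00 f1 f2 fO O0 face1).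
- exact: (face2_cderivable oO bO Omega_Reinhardt phi_continuous hankel_compact r00 f1 f2 fO O0 face2).
- exact: (monomial_cderivable oO bO Omega_Reinhardt phi_continuous hankel_compact r00 f1 f2 fO
    Omega_pseudoconvex m0 q1 q2 mO).
Qed.
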